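(* There exists a $6$-dimensional symplectic nilmanifold $(\mathcal{M},\omega)$ such that the Euler-Lagrange cohomology groups $H^{3}_{\mathrm{EL}}(\mathcal{M},\omega)$ and $H^{1}_{\mathrm{EL}}(\mathcal{M},\omega)$ are not isomorphic as real vector spaces.
   Context: A nilmanifold is a closed manifold of the form $G/\Gamma$, where $G$ is a simply connected nilpotent Lie group and $\Gamma$ is a discrete subgroup of $G$; a symplectic nilmanifold is a nilmanifold with a symplectic form. For a $2n$-dimensional symplectic manifold $(\mathcal{M},\omega)$ let $\mathcal{X}(\mathcal{M})$ be the space of smooth vector fields, $i_X$ contraction with $X$, and $\omega^k$ the $k$-fold wedge product of $\omega$. For $1\le k\le n$ put $\mathcal{X}_{\mathrm{S}}^{2k-1}(\mathcal{M},\omega):=\{X\in\mathcal{X}(\mathcal{M}) : \mathcal{L}_X(\omega^k)=0\}$ and $\mathcal{X}_{\mathrm{H}}^{2k-1}(\mathcal{M},\omega):=\{X\in\mathcal{X}(\mathcal{M}) : -i_X(\omega^k)\text{ is exact}\}\subseteq \mathcal{X}_{\mathrm{S}}^{2k-1}(\mathcal{M},\omega)$. The $(2k-1)$st Euler-Lagrange cohomology group is $H^{2k-1}_{\mathrm{EL}}(\mathcal{M},\omega):=\mathcal{X}_{\mathrm{S}}^{2k-1}(\mathcal{M},\omega)/\mathcal{X}_{\mathrm{H}}^{2k-1}(\mathcal{M},\omega)$. *)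

(* Defs.v *)
From HB Require Import structures.
From mathcomp Require Import all_boot all_order perm all_algebra.
From mathcomp Require Import all_classical all_reals all_analysis.

Set Implicit Arguments.
Unset Strict Implicit.
Unset Printing Implicit Defensive.

Import Order.TTheory GRing.Theory Num.Theory.
Import numFieldNormedType.Exports.

Local Open Scope classical_set_scope.
Local Open Scope ring_scope.

Section SmoothAt.
Context {R : realType} {n : nat}.
Implicit Types (f g : 'rV[R]_n -> R) (s : seq 'I_n) (x : 'rV[R]_n).

Definition pderiv (j : 'I_n) f : 'rV[R]_n -> R :=
  fun x => 'D_(delta_mx 0 j) f x.

Definition iter_pderiv s f : 'rV[R]_n -> R := foldr pderiv f s.

(* The value of ['D_v f x] is junk when the derivative does not exist; that
   all iterated partial derivatives are differentiable near [x] rules this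
   out. *)
Definition smooth_at f x : Prop :=
  \forall y \near x, forall s, differentiable (iter_pderiv s f) y.

End SmoothAt.

Lemma near_eq_differentiable {R : realType} {V W : normedModType R}
    (f g : V -> W) (x : V) :
  (\forall y \near x, f y = g y) -> differentiable f x -> differentiable g x.
Proof.
move=> fg df.
suff dh : differentiable (g - f) x.
  by rewrite -(subrK f g); exact: differentiableD.
pose null : {linear V -> W} := \0.
have h0 : (g - f) x = 0 by rewrite !fctE (nbhs_singleton fg) subrr.
have e0 : (g - f) \o shift x = cst ((g - f) x) + null +o_ (0 : V) id.
  apply/eqaddoP => _/posnumP[e].
  have fg0 : \forall y \near (0 : V), f (y + x) = g (y + x).
    by move: fg; rewrite (near_shift 0 x) /= subr0.
  near=> y.
  rewrite h0 !fctE /=.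
  have -> : g (y + x) = f (y + x).
    by apply/esym; near: y.
  by rewrite subrr addr0 subr0 normr0 mulr_ge0.
have c0 : continuous null by move=> ?; exact: cst_continuous.
have d0 := diff_unique c0 e0.
by apply/diff_locallyP; rewrite d0; split.
Unshelve. all: by end_near. Qed.

Section SmoothAtTheory.
Context {R : realType} {n : nat}.
Implicit Types (f g : 'rV[R]_n -> R) (s : seq 'I_n) (x : 'rV[R]_n).
Implicit Types (U : set 'rV[R]_n).

Let ck k U f := forall s, (size s <= k)%N ->
  forall y, U y -> differentiable (iter_pderiv s f) y.

Let eq_iter_pderiv U f g s : open U -> (forall y, U y -> f y = g y) ->
  forall y, U y -> iter_pderiv s f y = iter_pderiv s g y.
Proof.
move=> oU fg; elim: s => [|j s IH] y Uy; first exact: fg.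
rewrite /= /pderiv; apply: near_eq_derive.
by apply: filterS (open_nbhs_nbhs (conj oU Uy)) => z Uz; exact: IH.
Qed.

Let ck_eq k U f g : open U -> (forall y, U y -> f y = g y) ->
  ck k U f -> ck k U g.
Proof.
move=> oU fg kf s sk y Uy; apply: near_eq_differentiable (kf s sk y Uy).
apply: filterS (open_nbhs_nbhs (conj oU Uy)) => z Uz.
exact: (eq_iter_pderiv s oU fg).
Qed.

Let ckS k U f : ck k.+1 U f <->
  (forall y, U y -> differentiable f y) /\ forall j, ck k U (pderiv j f).
Proof.
split=> [kf|[df kf] s].
  split=> [y Uy|j s sk y Uy]; first exact: (kf [::]).
  by have := kf (rcons s j); rewrite /iter_pderiv foldr_rcons size_rcons; apply.
case/lastP: s => [|s j] sk y Uy; first exact: df.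
rewrite /iter_pderiv foldr_rcons; apply: kf => //.
by rewrite size_rcons in sk.
Qed.

Let ck_le k l U f : (k <= l)%N -> ck l U f -> ck k U f.
Proof. by move=> kl lf s sk; apply: lf; exact: leq_trans kl. Qed.

Let ckD k U f g : open U -> ck k U f -> ck k U g -> ck k U (f + g).
Proof.
move=> oU; elim: k => [|k IH] in f g *.
  move=> kf kg [|//] _ y Uy /=.
  by apply: differentiableD; [exact: (kf [::])|exact: (kg [::])].
move=> /ckS[df kf] /ckS[dg kg]; apply/ckS; split=> [y Uy|j].
  by apply: differentiableD; [exact: df|exact: dg].
apply: (@ck_eq _ _ (pderiv j f + pderiv j g)) => //; last exact: IH.
move=> y Uy; rewrite /pderiv deriveD //; apply: diff_derivable.
  exact: df.
exact: dg.
Qed.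

Let ckM k U f g : open U -> ck k U f -> ck k U g -> ck k U (f * g).
Proof.
move=> oU; elim: k => [|k IH] in f g *.
  move=> kf kg [|//] _ y Uy /=.
  by apply: differentiableM; [exact: (kf [::])|exact: (kg [::])].
move=> kf1 kg1.
have [df kf] := (ckS k U f).1 kf1.
have [dg kg] := (ckS k U g).1 kg1.
apply/ckS; split=> [y Uy|j].
  by apply: differentiableM; [exact: df|exact: dg].
apply: (@ck_eq _ _ (f * pderiv j g + g * pderiv j f)) => //.
  move=> y Uy; rewrite /pderiv deriveM //; apply: diff_derivable.
    exact: df.
  exact: dg.
by apply: ckD => //; apply: IH => //; apply: (@ck_le _ k.+1) => //.
Qed.

Let smooth_atP f x : smooth_at f x <->
  exists U, [/\ open U, U x & forall k, ck k U f].
Proof.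
split=> [|[U [oU Ux kf]]].
  move=> fx; have : nbhs x [set y | forall s, differentiable (iter_pderiv s f) y].
    exact: fx.
  rewrite nbhsE => -[U [oU Ux] sU].
  by exists U; split => // k s _ y /sU; exact.
apply: filterS (open_nbhs_nbhs (conj oU Ux)) => y Uy s.
exact: (kf (size s)).
Qed.

Lemma smooth_at_cst (c : R) x : smooth_at (cst c) x.
Proof.
have pc (a : R) j : pderiv j (cst a) = cst (0 : R).
  by apply/funext => y; rewrite /pderiv derive_cst.
apply/smooth_atP; exists setT; split => //; first exact: openT.
move=> k s _ y _.
suff [a ->] : exists a, iter_pderiv s (cst c) = cst a by exact: differentiable_cst.
elim: s => [|j s [a /= ->]]; first by exists c.
by exists 0.
Qed.

Lemma smooth_atD f g x : smooth_at f x -> smooth_at g x -> smooth_at (f + g) x.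
Proof.
move=> /smooth_atP[U [oU Ux fU]] /smooth_atP[V [oV Vx gV]].
apply/smooth_atP; exists (U `&` V); split => //; first exact: openI.
move=> k; apply: ckD; first exact: openI.
  by move=> s sk y [Uy _]; exact: (fU k).
by move=> s sk y [_ Vy]; exact: (gV k).
Qed.

Lemma smooth_atM f g x : smooth_at f x -> smooth_at g x -> smooth_at (f * g) x.
Proof.
move=> /smooth_atP[U [oU Ux fU]] /smooth_atP[V [oV Vx gV]].
apply/smooth_atP; exists (U `&` V); split => //; first exact: openI.
move=> k; apply: ckM; first exact: openI.
  by move=> s sk y [Uy _]; exact: (fU k).
by move=> s sk y [_ Vy]; exact: (gV k).
Qed.

End SmoothAtTheory.

(* [cbwd] is the inverse of [cfwd] on the image of [cdom]; outside [cdom] and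
   its image both functions are irrelevant. *)
Record chart (R : realType) (n : nat) (M : topologicalType) := Chart {
  cdom : set M ;
  cfwd : M -> 'rV[R]_n ;
  cbwd : 'rV[R]_n -> M }.

Definition is_chart (R : realType) n (M : topologicalType)
    (c : chart R n M) : Prop :=
  [/\ open (cdom c), open (cfwd c @` cdom c),
      forall p, cdom c p -> cbwd c (cfwd c p) = p,
      forall p, cdom c p -> {for p, continuous (cfwd c)} &
      forall p, cdom c p -> {for cfwd c p, continuous (cbwd c)}].

Record charted (R : realType) (n : nat) := Charted {
  cspace :> topologicalType ;
  atlas : set (chart R n cspace) }.

Arguments atlas {R n} _.

Definition smooth_manifold (R : realType) n (M : charted R n) : Prop :=
  [/\ hausdorff_space M, @second_countable M,
      forall p : M, exists2 c, atlas M c & cdom c p,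
      forall c, atlas M c -> is_chart c &
      forall c d (p : M), atlas M c -> atlas M d -> cdom c p -> cdom d p ->
        forall j, smooth_at (fun x => cfwd d (cbwd c x) 0 j) (cfwd c p)].

Definition smooth_map_at (R : realType) m n (M : charted R m) (N : charted R n)
    (F : M -> N) (p : M) : Prop :=
  {for p, continuous F} /\
  forall c d, atlas M c -> atlas N d -> cdom c p -> cdom d (F p) ->
    forall j, smooth_at (fun x => cfwd d (F (cbwd c x)) 0 j) (cfwd c p).

Definition smooth_map (R : realType) m n (M : charted R m) (N : charted R n)
    (F : M -> N) : Prop := forall p, smooth_map_at F p.

Definition local_diffeo (R : realType) m n (M : charted R m) (N : charted R n)
    (F : M -> N) : Prop :=
  forall p, exists (U : set M) (G : N -> M),
    [/\ open U, U p, open (F @` U) &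
        forall q, U q -> [/\ G (F q) = q, smooth_map_at F q
                           & smooth_map_at G (F q)]].

Definition prod_chart (R : realType) m n (M N : topologicalType)
    (c : chart R m M) (d : chart R n N) : chart R (m + n) (M * N)%type :=
  Chart (cdom c `*` cdom d) (fun p => row_mx (cfwd c p.1) (cfwd d p.2))
        (fun x => (cbwd c (lsubmx x), cbwd d (rsubmx x))).

Definition prod_charted (R : realType) m n (M : charted R m) (N : charted R n) :
    charted R (m + n) :=
  @Charted R (m + n) (M * N)%type
    [set e | exists c d, [/\ atlas M c, atlas N d & e = prod_chart c d]].

Record lie_group (R : realType) (n : nat) := LieGroup {
  lspace :> charted R n ;
  lmul : lspace -> lspace -> lspace ;
  lone : lspace ;
  linv : lspace -> lspace ;
  lspaceP : smooth_manifold lspace ;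
  lmulA : associative lmul ;
  lmul1 : left_id lone lmul ;
  lmulV : left_inverse lone linv lmul ;
  lmul_smooth : @smooth_map R _ _ (prod_charted lspace lspace) lspace
                  (fun p => lmul p.1 p.2) ;
  linv_smooth : smooth_map linv }.

Arguments lone {R n} _.

Section Groups.
Context {R : realType} {n : nat} (G : lie_group R n).
Implicit Types (g h : G) (A H : set G).

Definition subgroup H : Prop :=
  [/\ H (lone G), forall g h, H g -> H h -> H (lmul g h)
    & forall g, H g -> H (linv g)].

Definition gen_subgroup A : set G :=
  [set g | forall H, subgroup H -> A `<=` H -> H g].

Definition lcommutator g h : G := lmul (lmul (linv g) (linv h)) (lmul g h).

Fixpoint lower_central (k : nat) : set G :=
  if k is k'.+1 then
    gen_subgroup [set c | exists g h, lower_central k' h /\ c = lcommutator g h]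
  else setT.

Definition nilpotent_group : Prop := exists k, lower_central k = [set lone G].

Definition discrete_subgroup H : Prop := subgroup H /\ H `<=` isolated H.

End Groups.

Definition path_conn (R : realType) (M : topologicalType) : Prop :=
  forall x y : M, exists a : R -> M,
    [/\ {within `[0, 1], continuous a}, a 0 = x & a 1 = y].

Definition simply_conn (R : realType) (M : topologicalType) : Prop :=
  path_conn R M /\
  forall a : R -> M, {within `[0, 1], continuous a} -> a 0 = a 1 ->
    exists H : R * R -> M,
      [/\ {within `[0, 1] `*` `[0, 1], continuous H},
          forall t, t \in `[0, 1] -> H (0, t) = a t,
          forall t, t \in `[0, 1] -> H (1, t) = a 0 &
          forall s, s \in `[0, 1] -> H (s, 0) = a 0 /\ H (s, 1) = a 0].

(* [M] is the quotient of [G] by a discrete subgroup [L]: the projection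
   [proj] has the left cosets of [L] as fibres and is a local
   diffeomorphism, which determines the topology and the smooth structure
   of [M]. *)
Definition is_quotient (R : realType) n (G : lie_group R n) (L : set G)
    (M : charted R n) (proj : G -> M) : Prop :=
  [/\ set_surj setT setT proj,
      forall g h, proj g = proj h <-> L (lmul (linv g) h) &
      local_diffeo proj].

Definition closed_manifold (R : realType) n (M : charted R n) : Prop :=
  smooth_manifold M /\ compact [set: M].

Definition nilmanifold (R : realType) n (M : charted R n) : Prop :=
  closed_manifold M /\
  exists (G : lie_group R n) (L : set G) (proj : G -> M),
    [/\ simply_conn R G, nilpotent_group G, discrete_subgroup L
      & is_quotient L proj].

Section Cinf.
Context {R : realType} {n : nat} (M : charted R n).

Definition is_cinf (f : M -> R) : Prop :=
  forall c p, atlas M c -> cdom c p -> smooth_at (f \o cbwd c) (cfwd c p).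

Definition cinf_pred : {pred M -> R} := fun f => `[< is_cinf f >].

Let cinf_subring : subring_closed cinf_pred.
Proof.
split=> [|f g /asboolP fs /asboolP gs|f g /asboolP fs /asboolP gs];
  apply/asboolP => c p ac cp.
- exact: (smooth_at_cst 1).
- rewrite (_ : _ \o _ = f \o cbwd c + cst (-1) * (g \o cbwd c)).
    apply: smooth_atD; first exact: fs.
    by apply: smooth_atM; [exact: smooth_at_cst|exact: gs].
  by apply/funext => x; rewrite !fctE /= mulN1r.
- exact: smooth_atM (fs _ _ ac cp) (gs _ _ ac cp).
Qed.

Let cinf_submod : scaler_closed cinf_pred.
Proof.
move=> a f /asboolP fs; apply/asboolP => c p ac cp.
exact: smooth_atM (smooth_at_cst a _) (fs _ _ ac cp).
Qed.

HB.instance Definition _ := GRing.isSubringClosed.Build _ cinf_pred cinf_subring.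
HB.instance Definition _ := GRing.isScaleClosed.Build _ _ cinf_pred cinf_submod.

Record cinf := Cinf { cinf_fun :> M -> R ; _ : cinf_fun \in cinf_pred }.

HB.instance Definition _ := [isSub for cinf_fun].
HB.instance Definition _ := [Choice of cinf by <:].
HB.instance Definition _ :=
  GRing.SubChoice_isSubComPzRing.Build _ _ cinf (subringClosedP _).
HB.instance Definition _ := [SubZmodule_isSubLmodule of cinf by <:].

End Cinf.

Section VectorFields.
Context {R : realType} {n : nat} (M : charted R n).
Implicit Types (f g : cinf M).

(* A vector field is a derivation of the algebra of smooth functions; its
   value at the point [p] is the tangent vector [f |-> X f p]. Differential
   forms are accordingly the alternating maps of vector fields that are
   multilinear over the smooth functions ([is_form] below). *)
Definition is_derivation (X : cinf M -> cinf M) : Prop :=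
  (forall (a : R) f g, X (a *: f + g) = a *: X f + X g) /\
  (forall f g, X (f * g) = f * X g + g * X f).

Definition derivation_pred : {pred cinf M -> cinf M} :=
  fun X => `[< is_derivation X >].

Lemma cinf_scaleAl (a : R) f g : a *: (f * g) = (a *: f) * g.
Proof. by apply/val_inj/funext => p; rewrite /= !fctE; exact: mulrA. Qed.

Lemma cinf_scaleAr (a : R) f g : a *: (f * g) = f * (a *: g).
Proof. by rewrite mulrC cinf_scaleAl mulrC. Qed.

Let derivation_submod : submod_closed derivation_pred.
Proof.
split=> [|a X Y /asboolP[Xl XM] /asboolP[Yl YM]]; apply/asboolP.
  split=> [a f g|f g]; first by rewrite -[RHS]/(a *: 0 + 0) scaler0 addr0.
  by rewrite -[RHS]/(f * 0 + g * 0) !mulr0 addr0.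
split=> [b f g|f g]; rewrite !fctE.
  rewrite Xl Yl !scalerDr !scalerA [a * b]mulrC.
  by rewrite -!addrA; congr (_ + _); rewrite addrCA.
rewrite XM YM !scalerDr !mulrDr !cinf_scaleAr.
by rewrite -!addrA; congr (_ + _); rewrite addrCA.
Qed.

HB.instance Definition _ :=
  GRing.isSubmodClosed.Build _ _ derivation_pred derivation_submod.

Record vfield := VField {
  vf_fun :> cinf M -> cinf M ; _ : vf_fun \in derivation_pred }.

HB.instance Definition _ := [isSub for vf_fun].
HB.instance Definition _ := [Choice of vfield by <:].
HB.instance Definition _ := [SubChoice_isSubZmodule of vfield by <:].
HB.instance Definition _ := [SubZmodule_isSubLmodule of vfield by <:].

Implicit Types (X Y Z : vfield).

Lemma vfieldP X : is_derivation X.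
Proof. by case: X => X /= /asboolP. Qed.

Lemma vfield_linear X (a : R) f g : X (a *: f + g) = a *: X f + X g.
Proof. exact: (vfieldP X).1. Qed.

Lemma vfieldM X f g : X (f * g) = f * X g + g * X f.
Proof. exact: (vfieldP X).2. Qed.

Lemma vfieldD X f g : X (f + g) = X f + X g.
Proof. by rewrite -[f in LHS]scale1r vfield_linear scale1r. Qed.

Lemma vfield0 X : X 0 = 0.
Proof. by apply: (addrI (X 0)); rewrite -vfieldD !addr0. Qed.

Lemma vfieldZ X (a : R) f : X (a *: f) = a *: X f.
Proof. by rewrite -[a *: f]addr0 vfield_linear vfield0 addr0. Qed.

Lemma vfieldB X f g : X (f - g) = X f - X g.
Proof. by rewrite -scaleN1r addrC vfield_linear scaleN1r addrC. Qed.

Let fscale_subproof f X : (fun g => f * X g) \in derivation_pred.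
Proof.
apply/asboolP; split=> [a g h|g h].
  by rewrite vfield_linear mulrDr cinf_scaleAr.
by rewrite vfieldM mulrDr !mulrA [f * g]mulrC [f * h]mulrC.
Qed.

Definition fscale f X : vfield := VField (fscale_subproof f X).

Let bracket_subproof X Y : (fun f => X (Y f) - Y (X f)) \in derivation_pred.
Proof.
apply/asboolP; split=> [a f g|f g].
  rewrite !vfield_linear scalerBr opprD -!addrA; congr (_ + _).
  by rewrite addrCA.
rewrite !vfieldM !vfieldD !vfieldM !mulrBr.
rewrite [X g * _]mulrC [X f * _]mulrC.
set a := f * _; set b := Y g * _; set c := g * _; set d := Y f * _.
set e := f * _; set h := g * _.
have -> : a + b + (c + d) - (e + d + (h + b)) = (a + c + (b + d)) - (e + h + (b + d)).
  by rewrite addrACA; congr (_ - _); rewrite addrACA [d + b]addrC.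
by rewrite opprD addrACA subrr addr0 opprD addrACA.
Qed.

Definition bracket X Y : vfield := VField (bracket_subproof X Y).

Lemma bracket_linear (a : R) X Y Z :
  bracket (a *: X + Y) Z = a *: bracket X Z + bracket Y Z.
Proof.
apply/val_inj/funext => f; rewrite /= !fctE vfieldD vfieldZ scalerBr opprD.
by rewrite addrACA.
Qed.

Lemma fscale_cst (a : R) X : fscale (a *: (1 : cinf M)) X = a *: X.
Proof.
by apply/val_inj/funext => f; rewrite /= !fctE -cinf_scaleAl mul1r.
Qed.

End VectorFields.

Section Forms.
Context {R : realType} {n : nat} (M : charted R n).
Implicit Types (X Y Z : vfield M) (k : nat).

Definition cochain k : Type := ('I_k -> vfield M) -> cinf M.

Definition upd k (V : 'I_k -> vfield M) (i : 'I_k) X : 'I_k -> vfield M :=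
  fun j => if j == i then X else V j.

Definition is_multilinear k (alpha : cochain k) : Prop :=
  forall V i (f : cinf M) X Y,
    alpha (upd V i (fscale f X + Y)) = f * alpha (upd V i X) + alpha (upd V i Y).

Definition is_alternating k (alpha : cochain k) : Prop :=
  forall V (i j : 'I_k), i != j -> V i = V j -> alpha V = 0.

Definition is_form k (alpha : cochain k) : Prop :=
  is_multilinear alpha /\ is_alternating alpha.

Record dform k := DForm { dform_fun :> cochain k ; dformP : is_form dform_fun }.

(* The exterior product normalised by [dx /\ dy = dx (x) dy - dy (x) dx]. *)
Definition wedge k l (alpha : cochain k) (beta : cochain l) : cochain (k + l) :=
  fun V => ((k`! * l`!)%N%:R^-1 : R) *:
    \sum_(s : 'S_(k + l)) (-1) ^+ s *
      (alpha (fun i => V (s (lshift l i))) * beta (fun j => V (s (rshift k j)))).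

Fixpoint wpow (omega : cochain 2) k : cochain (k * 2) :=
  if k is k'.+1 then wedge omega (@wpow omega k') else fun=> 1.

Definition vcons X k (V : 'I_k -> vfield M) : 'I_k.+1 -> vfield M :=
  fun i => oapp V X (unlift ord0 i).

Definition iprod X k : cochain k -> cochain k.-1 :=
  if k is k'.+1 then fun alpha V => alpha (vcons X V) else fun=> fun=> 0.

Definition lieD X k (alpha : cochain k) : cochain k :=
  fun V => X (alpha V) - \sum_i alpha (upd V i (bracket X (V i))).

(* With [j' = lift i j > i], the second sum is
   [\sum_(i < j') (-1)^(i + j') alpha([V_i, V_j'], .., omit i, .., omit j', ..)]. *)
Definition extd k (alpha : cochain k) : cochain k.+1 := fun V =>
  \sum_(i < k.+1) (-1) ^+ i * V i (alpha (V \o lift i)) +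
  \sum_(i < k.+1) \sum_(j < k | (i <= j)%N) (-1) ^+ (i + lift i j) *
    iprod (bracket (V i) (V (lift i j))) alpha (V \o lift i \o lift j).

Definition exact_form k : cochain k -> Prop :=
  if k is k'.+1 then fun alpha => exists2 beta, is_form beta & alpha = extd beta
  else fun alpha => alpha = 0.

Definition nondegenerate_form (omega : cochain 2) : Prop :=
  forall X (p : M), (forall V, iprod X omega V p = 0) -> forall f, X f p = 0.

Definition symplectic (omega : dform 2) : Prop :=
  extd omega = 0 /\ nondegenerate_form omega.

End Forms.

Arguments wpow {R n M} omega k.

Section FormsTheory.
Context {R : realType} {n : nat} {M : charted R n}.
Implicit Types (X Y Z : vfield M) (k : nat).

Let multilinearR k (alpha : cochain M k) V i (a : R) X Y : is_multilinear alpha ->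
  alpha (upd V i (a *: X + Y)) = a *: alpha (upd V i X) + alpha (upd V i Y).
Proof. by move=> ml; rewrite -fscale_cst ml -cinf_scaleAl mul1r. Qed.

Lemma wedge_multilinear k l (alpha : cochain M k) (beta : cochain M l) :
  is_multilinear alpha -> is_multilinear beta -> is_multilinear (wedge alpha beta).
Proof.
move=> ml_a ml_b V i f X Y; rewrite /wedge.
rewrite -cinf_scaleAr -scalerDr; congr (_ *: _).
rewrite mulr_sumr -big_split; apply: eq_bigr => s _ /=.
rewrite [f * (_ * _)]mulrCA -mulrDr; congr (_ * _).
have [j ji|j ji] := split_ordP ((s^-1)%g i).
  have El Z : (fun a => upd V i Z (s (lshift l a))) =
              upd (fun a => V (s (lshift l a))) j Z.
    apply/funext => a; rewrite /upd -(inj_eq (@perm_inj _ (s^-1)%g)) permK ji.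
    by rewrite (inj_eq (@lshift_inj _ _)).
  have Er Z : (fun b => upd V i Z (s (rshift k b))) =
              (fun b => V (s (rshift k b))).
    apply/funext => b; rewrite /upd -(inj_eq (@perm_inj _ (s^-1)%g)) permK ji.
    by rewrite eq_rlshift.
  by rewrite !El !Er ml_a mulrDl mulrA.
have El Z : (fun b => upd V i Z (s (rshift k b))) =
            upd (fun a => V (s (rshift k a))) j Z.
  apply/funext => a; rewrite /upd -(inj_eq (@perm_inj _ (s^-1)%g)) permK ji.
  by rewrite (inj_eq (@rshift_inj _ _)).
have Er Z : (fun b => upd V i Z (s (lshift l b))) =
            (fun b => V (s (lshift l b))).
  apply/funext => b; rewrite /upd -(inj_eq (@perm_inj _ (s^-1)%g)) permK ji.
  by rewrite eq_lrshift.
by rewrite !El !Er ml_b mulrDr mulrCA.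
Qed.

Lemma wpow_multilinear (omega : cochain M 2) k :
  is_multilinear omega -> is_multilinear (wpow omega k).
Proof.
move=> ml; elim: k => [|k IH]; first by move=> V [].
exact: wedge_multilinear.
Qed.

Lemma lieD_linear k (alpha : cochain M k) (a : R) X Y : is_multilinear alpha ->
  lieD (a *: X + Y) alpha = a *: lieD X alpha + lieD Y alpha.
Proof.
move=> ml; apply/funext => V; rewrite /lieD !fctE /=.
under eq_bigr do rewrite bracket_linear multilinearR //.
rewrite big_split /= -scaler_sumr opprD scalerBr.
exact: addrACA.
Qed.

Lemma vcons_upd k X Z (V : 'I_k -> vfield M) :
  vcons X V = upd (vcons Z V) ord0 X.
Proof.
apply/funext => i; rewrite /upd /vcons; by case: unliftP => [j ->|->].
Qed.

Lemma iprod_linear k (alpha : cochain M k) (a : R) X Y : is_multilinear alpha ->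
  iprod (a *: X + Y) alpha = a *: iprod X alpha + iprod Y alpha.
Proof.
case: k alpha => [|k] alpha ml; apply/funext => V; rewrite !fctE /=.
  by rewrite scaler0 addr0.
by rewrite (vcons_upd _ 0) multilinearR // -!vcons_upd.
Qed.

Lemma extd_linear k (alpha beta : cochain M k) (a : R) :
  extd (a *: alpha + beta) = a *: extd alpha + extd beta.
Proof.
have cl X : iprod X (a *: alpha + beta) = a *: iprod X alpha + iprod X beta.
  by case: k alpha beta => // alpha beta; apply/funext => V;
    rewrite !fctE /= scaler0 addr0.
apply/funext => V; rewrite /extd !fctE /= scalerDr addrACA !scaler_sumr.
congr (_ + _); rewrite -big_split; apply: eq_bigr => i _ /=.
  by rewrite vfield_linear mulrDr cinf_scaleAr.
rewrite scaler_sumr -big_split; apply: eq_bigr => j _ /=.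
by rewrite cl !fctE mulrDr cinf_scaleAr.
Qed.

Lemma is_form_linear k (alpha beta : cochain M k) (a : R) :
  is_form alpha -> is_form beta -> is_form (a *: alpha + beta).
Proof.
move=> [ml_a al_a] [ml_b al_b]; split=> [V i f X Y|V i j ij Vij]; rewrite !fctE.
  rewrite ml_a ml_b scalerDr mulrDr cinf_scaleAr.
  exact: addrACA.
by rewrite (al_a _ i j) // (al_b _ i j) // scaler0 addr0.
Qed.

Lemma is_form0 k : is_form (0 : cochain M k).
Proof.
by split=> [V i f X Y|//]; rewrite -[RHS]/(f * 0 + 0) mulr0 addr0.
Qed.

Lemma exact_form_linear k (alpha beta : cochain M k) (a : R) :
  exact_form alpha -> exact_form beta -> exact_form (a *: alpha + beta).
Proof.
case: k alpha beta => [|k] alpha beta /=.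
  by move=> -> ->; rewrite scaler0 addr0.
move=> [x fx ->] [y fy ->]; exists (a *: x + y); first exact: is_form_linear.
by rewrite extd_linear.
Qed.

Lemma exact_form0 k : exact_form (0 : cochain M k).
Proof.
case: k => [//|k]; exists 0; first exact: is_form0.
apply: (addrI (extd (0 : cochain M k))); rewrite addr0.
by rewrite -[X in X + _]scale1r -extd_linear scaler0 addr0.
Qed.

End FormsTheory.

Section QuotientSpace.
Context {R : pzRingType} {V : lmodType R} (W : submodClosed V).
Local Open Scope quotient_scope.

Let W_zmod : zmod_closed W :=
  GRing.subsemimod_closedB (GRing.subsemimodClosedP W).

Let Wz : zmodClosed V :=
  HB.pack_for (zmodClosed V) (W : {pred V})
    (GRing.isZmodClosed.Build V (W : {pred V}) W_zmod).

Definition quot_space : Type := Quotient.quot Wz.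

HB.instance Definition _ := GRing.Zmodule.copy quot_space (Quotient.quot Wz).

Let scaleq (a : R) (x : quot_space) : quot_space :=
  \pi_(Quotient.quot Wz) (a *: repr (x : Quotient.quot Wz)).

Let pi_scale a (x : V) :
  scaleq a (\pi_(Quotient.quot Wz) x) = \pi_(Quotient.quot Wz) (a *: x).
Proof.
apply/eqP; rewrite /scaleq -Quotient.idealrBE -scalerBr.
have : repr (\pi_(Quotient.quot Wz) x) - x \in W.
  by have := Quotient.idealrBE Wz (repr (\pi_(Quotient.quot Wz) x)) x;
    rewrite reprK eqxx.
by move=> xW; apply: (@rpredZ _ _ W).
Qed.

Let piD (x y : V) : \pi_(Quotient.quot Wz) x + \pi_(Quotient.quot Wz) y
  = \pi_(Quotient.quot Wz) (x + y) :> quot_space.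
Proof. exact: esym (Quotient.pi_add Wz x y). Qed.

Let scaleqA a b x : scaleq a (scaleq b x) = scaleq (a * b) x.
Proof. by rewrite -[x]reprK !pi_scale scalerA reprK. Qed.

Let scaleq1 : left_id 1 scaleq.
Proof. by move=> x; rewrite -[x]reprK pi_scale scale1r. Qed.

Let scaleqDr : right_distributive scaleq +%R.
Proof.
by move=> a x y; rewrite -[x]reprK -[y]reprK piD !pi_scale piD scalerDr.
Qed.

Let scaleqDl x : {morph scaleq^~ x : a b / a + b}.
Proof. by move=> a b /=; rewrite -[x]reprK !pi_scale piD scalerDl. Qed.

HB.instance Definition _ := GRing.Zmodule_isLmodule.Build R quot_space
  scaleqA scaleq1 scaleqDr scaleqDl.

Definition quot_pi (x : V) : quot_space := \pi_(Quotient.quot Wz) x.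

Let quot_pi_linear : linear quot_pi.
Proof. by move=> a x y; rewrite /quot_pi -piD -pi_scale. Qed.

HB.instance Definition _ :=
  GRing.isLinear.Build R V quot_space *:%R quot_pi quot_pi_linear.

Lemma quot_pi_surj (y : quot_space) : exists x, quot_pi x = y.
Proof. by exists (repr (y : Quotient.quot Wz)); exact: reprK. Qed.

Lemma quot_piP (x y : V) : quot_pi x = quot_pi y <-> x - y \in W.
Proof.
have e : (x - y \in W) = (quot_pi x == quot_pi y) := Quotient.idealrBE Wz x y.
by rewrite e; split=> /eqP.
Qed.

End QuotientSpace.

Definition lmod_isomorphic (R : pzRingType) (U V : lmodType R) : Prop :=
  exists phi : {linear U -> V}, bijective phi.

Section EulerLagrange.
Context {R : realType} {n : nat} {M : charted R n} (omega : dform M 2) (k : nat).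

Definition xS_pred : {pred vfield M} := fun X => `[< lieD X (wpow omega k) = 0 >].

Let wml : is_multilinear (wpow omega k).
Proof. exact: wpow_multilinear (dformP omega).1. Qed.

Let xS_submod : submod_closed xS_pred.
Proof.
split=> [|a X Y /asboolP X0 /asboolP Y0]; apply/asboolP.
  apply: (addrI (lieD 0 (wpow omega k))); rewrite addr0.
  by rewrite -[X in X + _]scale1r -lieD_linear // scaler0 addr0.
by rewrite lieD_linear // X0 Y0 scaler0 addr0.
Qed.

HB.instance Definition _ := GRing.isSubmodClosed.Build _ _ xS_pred xS_submod.

Record xS := XS { xS_val :> vfield M ; _ : xS_val \in xS_pred }.

HB.instance Definition _ := [isSub for xS_val].
HB.instance Definition _ := [Choice of xS by <:].
HB.instance Definition _ := [SubChoice_isSubZmodule of xS by <:].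
HB.instance Definition _ := [SubZmodule_isSubLmodule of xS by <:].

(* For closed [omega], every [X] with [- i_X omega^k] exact is in [xS] by
   Cartan's formula, so a predicate on [xS] loses nothing. *)
Definition xH_pred : {pred xS} :=
  fun X => `[< exact_form (- iprod X (wpow omega k)) >].

Let xH_submod : submod_closed xH_pred.
Proof.
split=> [|a X Y /asboolP Xe /asboolP Ye]; apply/asboolP.
  suff -> : iprod (0 : vfield M) (wpow omega k) = 0.
    by rewrite oppr0; exact: exact_form0.
  apply: (addrI (iprod (0 : vfield M) (wpow omega k))); rewrite addr0.
  by rewrite -[X in X + _]scale1r -iprod_linear // scaler0 addr0.
rewrite /= iprod_linear // opprD -scalerN.
exact: exact_form_linear.
Qed.

HB.instance Definition _ := GRing.isSubmodClosed.Build _ _ xH_pred xH_submod.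

(* The Euler-Lagrange cohomology group of degree [2 * k - 1], for [0 < k]. *)
Definition HEL : lmodType R := quot_space xH_pred.

End EulerLagrange.

(* Main.v *)
(** Let G be the free two-step nilpotent Lie group on three generators, with
    invariant coframe e0, .., e5 such that d e3 = e0 /\ e1, d e4 = e0 /\ e2,
    d e5 = e1 /\ e2 and d e0 = d e1 = d e2 = 0, and let M be the quotient of G
    by its integer points. The form
      omega = 2 e0 /\ e5 + e1 /\ e4 - e2 /\ e3
    is symplectic, and e0 /\ omega = d (e3 /\ e4) although e0 is not exact.

    Since exterior multiplication by omega is injective on two-forms in
    dimension six, L_X (omega^2) = 2 omega /\ L_X omega vanishes exactly when
    i_X omega is closed, so H^3_EL is the quotient of H^1_EL = H^1(M) by the
    kernel of the cup product with omega. Every closed one-form on M is, up to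
    an exact form, a combination of e0, e1, e2: its primitive on G changes
    under the lattice by a homomorphism, which kills commutators. Hence H^3_EL
    is spanned by the classes of e1 and e2, whereas e0, e1, e2 are independent
    in H^1_EL because a function on a compact manifold has a critical point.

    Working with derivations requires that e0, .., e5 exist as functionals on
    all derivations of the algebra of smooth functions; this is Hadamard's
    lemma combined with bump functions. *)

From HB Require Import structures.
From mathcomp Require Import all_boot all_order perm all_algebra.
From mathcomp Require Import all_classical all_reals all_analysis.
From mathcomp Require Import ring lra.
Require Import Defs.

Set Implicit Arguments.
Unset Strict Implicit.
Unset Printing Implicit Defensive.

Import Order.TTheory GRing.Theory Num.Theory.
Import numFieldNormedType.Exports.

Local Open Scope classical_set_scope.
Local Open Scope ring_scope.

(** * Smooth functions on row vectors *)

Section Smooth.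
Context {R : realType}.
Implicit Types (n : nat).

(** The comparison rests on one-sided counts: three independent classes in degree one against a
    spanning set of two classes in degree three. Smoothness at a point means differentiability of
    all iterated partials nearby, so closure properties are obtained by exhibiting classes of
    functions stable under partial differentiation instead of formulas for higher derivatives.
    Calculus is done upstairs on R^6, where functions on [M] are lattice-invariant functions. The
    fibres of the projection are left cosets, hence the frame that descends consists of the fields
    commuting with right translations. An abstract derivation comes with nothing but linearity and
    the Leibniz rule. Once it is expanded in the frame with smooth coefficients, an identity between
    forms becomes a polynomial identity in the coefficients and their derivatives, modulo the
    structure equations, and [ring] can decide it. *)

Lemma sum_delta n (t : 'I_n -> R) (a : 'I_n) : \sum_l t l * (a == l)%:R = t a.
Proof.
rewrite (bigD1 a) //= eqxx mulr1 big1 ?addr0 // => l /negbTE.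
by rewrite eq_sym => ->; rewrite mulr0.
Qed.

Lemma smooth_at_differentiable n (f : 'rV[R]_n -> R) x :
  smooth_at f x -> differentiable f x.
Proof. by move=> /nbhs_singleton /(_ [::]). Qed.

Lemma smooth_at_pderiv n (f : 'rV[R]_n -> R) j x :
  smooth_at f x -> smooth_at (pderiv j f) x.
Proof.
apply: filterS => y fy s; have := fy (rcons s j).
by rewrite /iter_pderiv foldr_rcons.
Qed.

Lemma smooth_at_near n (f : 'rV[R]_n -> R) x :
  smooth_at f x -> exists U, [/\ open U, U x & forall y, U y -> smooth_at f y].
Proof.
move=> fx; have : nbhs x [set y | smooth_at f y] by exact: nbhs_interior.
by rewrite nbhsE => -[U [oU Ux] sU]; exists U.
Qed.

Lemma near_eq_iter_pderiv n (f g : 'rV[R]_n -> R) (x : 'rV[R]_n) s :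
  (\forall y \near x, f y = g y) ->
  \forall y \near x, iter_pderiv s f y = iter_pderiv s g y.
Proof.
move=> fg; elim: s => [//|j s IH].
apply: filterS (nbhs_interior IH) => y /= ey.
by rewrite /pderiv; exact: near_eq_derive.
Qed.

Lemma near_eq_smooth_at n (f g : 'rV[R]_n -> R) (x : 'rV[R]_n) :
  (\forall y \near x, f y = g y) -> smooth_at f x -> smooth_at g x.
Proof.
move=> /nbhs_interior fg fx; near=> y => s.
have ey : \forall z \near y, f z = g z by near: y; exact: fg.
apply: near_eq_differentiable (near_eq_iter_pderiv s ey) _.
move: s; near: y; exact: fx.
Unshelve. all: by end_near. Qed.

(** By induction on the word [s], every iterated partial agrees on the open set [U] with a member of
    [P]. This is the common device behind all smoothness proofs here. *)
Lemma smooth_at_coind n (U : set 'rV[R]_n) (P : ('rV[R]_n -> R) -> Prop) :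
  open U ->
  (forall f, P f -> (forall y, U y -> differentiable f y) /\
     forall j, exists2 g, P g & forall y, U y -> pderiv j f y = g y) ->
  forall f, P f -> forall x, U x -> smooth_at f x.
Proof.
move=> oU HP f Pf x Ux.
have nU y : U y -> nbhs y U by move=> Uy; exact: open_nbhs_nbhs.
have D s : exists2 g, P g & forall y, U y -> iter_pderiv s f y = g y.
  elim: s => [|j s [g Pg eg]]; first by exists f.
  have [_ /(_ j)[h Ph eh]] := HP g Pg; exists h => // y Uy.
  rewrite -(eh y Uy) /= /pderiv; apply: near_eq_derive.
  by apply: filterS (nU y Uy) => z /eg.
apply: filterS (nU x Ux) => y Uy s; have [g Pg eg] := D s.
apply: near_eq_differentiable ((HP g Pg).1 y Uy).
by apply: filterS (nU y Uy) => z /eg.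
Qed.

(* The algebra generated by [B] and the smooth functions. When partial
   derivatives of members of [B] stay in it, all its members are smooth. *)
Inductive smooth_alg n (U : set 'rV[R]_n) (B : ('rV[R]_n -> R) -> Prop) :
    ('rV[R]_n -> R) -> Prop :=
| SalgBase f : B f -> smooth_alg U B f
| SalgSmooth f : (forall x, U x -> smooth_at f x) -> smooth_alg U B f
| SalgD f g : smooth_alg U B f -> smooth_alg U B g -> smooth_alg U B (f + g)
| SalgM f g : smooth_alg U B f -> smooth_alg U B g -> smooth_alg U B (f * g).

Lemma smooth_alg_smooth n (U : set 'rV[R]_n) (B : ('rV[R]_n -> R) -> Prop) :
  open U ->
  (forall f, B f -> (forall y, U y -> differentiable f y) /\
     forall j, exists2 g, smooth_alg U B g & forall y, U y -> pderiv j f y = g y) ->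
  forall f, smooth_alg U B f -> forall x, U x -> smooth_at f x.
Proof.
move=> oU HB; apply: smooth_at_coind => // f; 
elim=> {f}[f /HB //|f sf|f g sf [df Df] sg [dg Dg]|f g sf [df Df] sg [dg Dg]].
- split=> [y /sf/smooth_at_differentiable//|j].
  by exists (pderiv j f) => //; apply: SalgSmooth => x /sf; exact: smooth_at_pderiv.
- split=> [y Uy|j]; first by apply: differentiableD; [exact: df|exact: dg].
  have [[f' sf' ef] [g' sg' eg]] := (Df j, Dg j).
  exists (f' + g'); first exact: SalgD.
  move=> y Uy; rewrite /pderiv deriveD; last 2 first.
    by apply: diff_derivable; exact: df.
  by apply: diff_derivable; exact: dg.
  by rewrite -[LHS]/(pderiv j f y + pderiv j g y) ef // eg.
- split=> [y Uy|j]; first by apply: differentiableM; [exact: df|exact: dg].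
  have [[f' sf' ef] [g' sg' eg]] := (Df j, Dg j).
  exists (f * g' + g * f'); first by apply: SalgD; apply: SalgM.
  move=> y Uy; rewrite /pderiv deriveM; last 2 first.
    by apply: diff_derivable; exact: df.
  by apply: diff_derivable; exact: dg.
  by rewrite -[LHS]/(f y * pderiv j g y + g y * pderiv j f y) ef // eg.
Qed.

Lemma derive_coord m n (i : 'I_m) (j : 'I_n) (x v : 'M[R]_(m, n)) :
  'D_v (fun y : 'M[R]_(m, n) => y i j) x = v i j.
Proof.
rewrite /derive; apply: lim_near_cst => //; near=> h.
rewrite /= !mxE addrK [_ *: _]mulrA mulVf ?mul1r//.
by near: h; exact: nbhs_dnbhs_neq.
Unshelve. all: by end_near. Qed.

Lemma smooth_at_coord n (i : 'I_n) x : smooth_at (fun y : 'rV[R]_n => y 0 i) x.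
Proof.
apply: (@smooth_alg_smooth _ setT
  (fun f => f = fun y : 'rV[R]_n => y 0 i)) => //; first exact: openT.
  move=> f ->; split=> [y _|j]; first exact: differentiable_coord.
  exists (cst ((delta_mx 0 j : 'rV[R]_n) 0 i)).
    by apply: SalgSmooth => z _; exact: smooth_at_cst.
  by move=> y _; exact: derive_coord.
exact: SalgBase.
Qed.

Lemma smooth_atN n (f : 'rV[R]_n -> R) x : smooth_at f x -> smooth_at (- f) x.
Proof.
move=> sf; have -> : - f = cst (-1) * f.
  by apply/funext => y; rewrite !fctE mulN1r.
by apply: smooth_atM => //; exact: smooth_at_cst.
Qed.

Lemma smooth_at_sum n I (r : seq I) (P : pred I) (f : I -> 'rV[R]_n -> R) x :
  (forall i, P i -> smooth_at (f i) x) -> smooth_at (\sum_(i <- r | P i) f i) x.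
Proof.
move=> sf; elim/big_ind: _ => //; first exact: (smooth_at_cst 0).
by move=> a b; exact: smooth_atD.
Qed.

Lemma derive_pderiv n (f : 'rV[R]_n -> R) x v : differentiable f x ->
  'D_v f x = \sum_j v 0 j * pderiv j f x.
Proof.
move=> df; rewrite deriveE // {1}(row_sum_delta v) linear_sum.
by apply: eq_bigr => j _; rewrite linearZ /= /pderiv deriveE.
Qed.

Lemma smooth_at_comp m n (F : 'rV[R]_m -> 'rV[R]_n) (u : 'rV[R]_n -> R) x :
  (forall k, smooth_at (fun y => F y 0 k) x) -> smooth_at u (F x) ->
  smooth_at (u \o F) x.
Proof.
move=> sF su.
have sF' : nbhs x [set y | forall k, smooth_at (fun y => F y 0 k) y].
  apply: (@filter_forall _ _ (fun k y => smooth_at (fun y => F y 0 k) y) (nbhs x)) => k.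
  exact: nbhs_interior (sF k).
have dF y : (forall k, smooth_at (fun y => F y 0 k) y) -> differentiable F y.
  move=> sFy; have -> : F = fun y => \sum_k F y 0 k *: delta_mx 0 k.
    by apply/funext => z; rewrite {1}(row_sum_delta (F z)).
  have -> : (fun y => \sum_k F y 0 k *: delta_mx 0 k) = 
     \sum_k (fun y => F y 0 k *: (delta_mx 0 k : 'rV[R]_n)).
    by apply/funext => z; rewrite fct_sumE.
  apply: differentiable_sum => k; apply: differentiableZl.
  exact: smooth_at_differentiable.
have [V [oV Vx sV]] := smooth_at_near su.
have : nbhs x ([set y | forall k, smooth_at (fun y => F y 0 k) y] `&` F @^-1` V).
  apply: filterI => //; have /differentiable_continuous cF := dF _ sF.
  by apply: cF; exact: open_nbhs_nbhs.
rewrite nbhsE => -[U [oU Ux] sU].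
apply: (@smooth_alg_smooth _ U (fun f =>
  exists2 u, (forall y, V y -> smooth_at u y) & f = u \o F)) => //;
  last by apply: SalgBase; exists u.
move=> f [w sw ->]; split=> [y Uy|j].
  have [sFy Vy] := sU y Uy.
  apply: differentiable_comp; first exact: dF.
  exact/smooth_at_differentiable/sw.
exists (\sum_k (pderiv k w \o F) * pderiv j (fun y => F y 0 k)).
  elim/big_ind: _ => [|a b|k _]; [|exact: SalgD|].
    by apply: SalgSmooth => *; exact: (smooth_at_cst 0).
  apply: SalgM.
    by apply: SalgBase; exists (pderiv k w) => // y /sw; exact: smooth_at_pderiv.
  by apply: SalgSmooth => y /sU[sFy _]; exact: smooth_at_pderiv.
move=> y Uy; have [sFy Vy] := sU y Uy.
have dwF : differentiable w (F y) by exact/smooth_at_differentiable/sw.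
rewrite /pderiv deriveE; last exact: differentiable_comp (dF _ sFy) dwF.
rewrite diff_comp //; last exact: dF.
rewrite /comp /= -deriveE // derive_pderiv // fct_sumE.
apply: eq_bigr => k _; rewrite !fctE mulrC; congr (_ * _).
rewrite -deriveE; last exact: dF.
have dFv : derivable F y (delta_mx 0 j) by apply: diff_derivable; exact: dF.
by rewrite derive_mx // mxE.
Qed.

End Smooth.

(** * A flat function *)

Section Bump.
Context {R : realType}.

(* The [h k] are closed under differentiation up to linear combinations, so
   the algebra they generate with the smooth functions is too. *)
Lemma smooth_at_comp_family n (h : nat -> R -> R) (a b : nat -> R)
    (p q : nat -> nat) (V : set R) (u : 'rV[R]_n -> R) x :
  open V ->
  (forall k t, V t ->
     is_derive t (1 : R) (h k) (a k * h (p k) t + b k * h (q k) t)) ->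
  smooth_at u x -> V (u x) -> forall k, smooth_at (h k \o u) x.
Proof.
move=> oV dh su Vx k.
have [W [oW Wx sW]] := smooth_at_near su.
have : nbhs x (W `&` u @^-1` V).
  apply: filterI; first exact: open_nbhs_nbhs.
  have /differentiable_continuous cu := smooth_at_differentiable su.
  by apply: cu; exact: open_nbhs_nbhs.
rewrite nbhsE => -[U [oU Ux] sU].
apply: (@smooth_alg_smooth _ _ U (fun f => exists k, f = h k \o u)) => //;
  last by apply: SalgBase; exists k.
move=> _ [i ->].
have dhu y : U y -> differentiable (h i) (u y).
  by move=> /sU[_ Vy]; apply/derivable1_diffP; have := dh i _ Vy; case.
have duU y : U y -> differentiable u y.
  by move=> /sU[/sW/smooth_at_differentiable].
split=> [y Uy|j]; first by apply: differentiable_comp; [exact: duU|exact: dhu].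
exists ((cst (a i) * (h (p i) \o u) + cst (b i) * (h (q i) \o u)) * pderiv j u).
  apply: SalgM; last first.
    by apply: SalgSmooth => y /sU[/sW ? _]; exact: smooth_at_pderiv.
  apply: SalgD; (apply: SalgM;
    [by apply: SalgSmooth => *; exact: smooth_at_cst|]); apply: SalgBase.
    by exists (p i).
  by exists (q i).
move=> y Uy; rewrite /pderiv deriveE; last first.
  by apply: differentiable_comp; [exact: duU|exact: dhu].
rewrite diff_comp; [|exact: duU|exact: dhu].
rewrite /comp /= -(deriveE _ (duU _ Uy)).
rewrite -[X in 'd (h i) (u y) X]mulr1 -[_ * 1]/(_ *: (1 : R)) linearZ /=.
rewrite -(deriveE _ (dhu _ Uy)) !fctE.
have [_ Vy] := sU _ Uy.
by rewrite (@derive_val _ _ _ _ _ _ _ (dh i _ Vy)) [_ *: _]mulrC.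
Qed.

Lemma is_derive_invX k (t : R) : t != 0 ->
  is_derive t (1 : R) (fun t => t^-1 ^+ k) (- k%:R * t^-1 ^+ k.+1).
Proof.
move=> t0; have dV : is_derive t (1 : R) (fun t : R => t^-1) (- t ^- 2).
  apply: is_derive_eq (is_deriveV (f := id) _ _) _; first exact: t0.
  by rewrite /GRing.scale /= mulr1.
case: k => [|k]; first by rewrite oppr0 mul0r; exact: is_derive_cst.
have -> : (fun t : R => t^-1 ^+ k.+1) = (fun t => t^-1) ^+ k.+1.
  by apply/funext => z; rewrite exprfctE.
apply: is_derive_eq (is_deriveX k.+1 dV) _.
by rewrite /GRing.scale /= !exprS; field.
Qed.

(** Away from zero the powers of [t^-1] form a family closed under differentiation up to scalars. *)
Lemma smooth_at_inv n (u : 'rV[R]_n -> R) x :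
  smooth_at u x -> u x != 0 -> smooth_at (fun y => (u y)^-1) x.
Proof.
move=> su ux0.
pose h k (t : R) := t^-1 ^+ k.
have -> : (fun y => (u y)^-1) = h 1%N \o u.
  by apply/funext => y; rewrite /h /= expr1.
apply: (@smooth_at_comp_family _ h (fun k => - k%:R) (fun=> 0) S id
  [set t | t != 0]) => //.
move=> k t /= t0; rewrite /h mul0r addr0.
exact: is_derive_invX.
Qed.

(** For [k = 0] this is the classical exp(-1/t) extended by zero; the factors t^-k are those
    produced by differentiating it. *)
Definition flat (k : nat) (t : R) : R :=
  if 0 < t then t^-1 ^+ k * expR (- t^-1) else 0.

(** For positive [N] and s = N r, exp(s) = exp(r)^N and r <= 1 + r <= exp(r). *)
Lemma expR_pow_bound (N : nat) (s : R) : 0 <= s ->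
  s ^+ N * expR (- s) <= N%:R ^+ N.
Proof.
case: N => [|N] s0; first by rewrite !expr0 mul1r -expR0 ler_expR oppr_le0.
rewrite expRN ler_pdivrMr ?expR_gt0 //.
have -> : s = N.+1%:R * (s / N.+1%:R) by rewrite mulrC divfK // pnatr_eq0.
have r0 : 0 <= s / N.+1%:R by rewrite divr_ge0.
rewrite exprMn ler_wpM2l ?exprn_ge0 // expRM_natl lerXn2r ?nnegrE ?expR_ge0 //.
by apply: le_trans (expR_ge1Dx _); rewrite lerDr.
Qed.

(** Bounding two powers more than [flat k] contains leaves the factor t^2, which makes the
    difference quotient at zero tend to zero. *)
Lemma flat_bound k (t : R) : `|flat k t| <= k.+2%:R ^+ k.+2 * t ^+ 2.
Proof.
rewrite /flat; case: ifPn => t0; last first.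
  by rewrite normr0 mulr_ge0 ?sqr_ge0 ?exprn_ge0.
rewrite ger0_norm; last by rewrite mulr_ge0 ?expR_ge0 // exprn_ge0 // invr_ge0 ltW.
rewrite -ler_pdivrMr ?exprn_gt0 //.
apply: le_trans (expR_pow_bound k.+2 (_ : 0 <= t^-1)); last by rewrite invr_ge0 ltW.
by rewrite mulrAC -exprVn -exprD addn2.
Qed.

Lemma is_derive_flat k (t : R) :
  is_derive t (1 : R) (flat k) (- k%:R * flat k.+1 t + 1 * flat k.+2 t).
Proof.
rewrite mul1r; have [t0|t0|<-] := ltgtP 0 t.
- apply: (@near_eq_is_derive _ R^o R^o (fun t : R => t^-1 ^+ k * expR (- t^-1))).
    by near=> z; rewrite /flat ifT //; near: z; exact: lt_nbhsr.
  rewrite /flat t0; have t0' : t != 0 by rewrite gt_eqF.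
  have dE : is_derive t (1 : R) (fun t => expR (- t^-1)) (t^-1 ^+ 2 * expR (- t^-1)).
    have dV : is_derive t (1 : R) (fun t => - t^-1) (t^-1 ^+ 2).
      have := is_derive_invX 1 t0'; under eq_fun do rewrite expr1.
      by move=> /is_deriveN; rewrite mulN1r opprK.
    apply: is_derive_eq (@is_derive1_comp _ expR _ _ _ _ (is_derive_expR _) dV) _.
    by rewrite mulrC.
  apply: is_derive_eq (is_deriveM (is_derive_invX k t0') dE) _.
  by rewrite /GRing.scale /= !exprS expr0; ring.
- apply: (@near_eq_is_derive _ R^o R^o (cst (0 : R))).
    near=> z; rewrite /flat ifF //; apply/negbTE; rewrite -leNgt ltW //.
    by near: z; exact: lt_nbhsl.
  by rewrite /flat [0 < t]ltNge (ltW t0) /= mulr0 addr0; exact: is_derive_cst.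
- rewrite /flat ltxx mulr0 addr0.
  suff cv : (h^-1 *: ((flat k \o shift 0) (h *: 1) - flat k 0)) @[h --> 0^'] --> (0 : R).
    by apply: DeriveDef; [apply/cvg_ex; exists 0|apply/cvg_lim].
  set K := k.+2%:R ^+ k.+2 : R.
  apply/cvgr0Pnorm_le => e e0; near=> h.
  have h0 : h != 0 by near: h; exact: nbhs_dnbhs_neq.
  rewrite /= addr0 {2}/flat ltxx subr0 normrM normfV.
  rewrite [h *: 1]mulr1 -ler_pdivlMl ?invr_gt0 ?normr_gt0 // invrK.
  apply: le_trans (flat_bound k h) _.
  rewrite -[h ^+ 2]ger0_norm ?sqr_ge0 // normrX expr2 mulrCA ler_wpM2l //.
  have K0 : 0 < K by rewrite exprn_gt0.
  rewrite -ler_pdivlMl //.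
  by near: h; apply: dnbhs0_le; rewrite mulr_gt0 ?invr_gt0.
Unshelve. all: by end_near. Qed.

Lemma smooth_at_flat n k (u : 'rV[R]_n -> R) x :
  smooth_at u x -> smooth_at (flat k \o u) x.
Proof.
move=> su; apply: (@smooth_at_comp_family _ flat (fun k => - k%:R) (fun=> 1)
  S (fun k => k.+2) setT) => //; first exact: openT.
by move=> i t _; exact: is_derive_flat.
Qed.

End Bump.

(** * Parametric integrals *)

Section ParametricIntegral.
Context {R : realType}.
Local Notation mu := (@lebesgue_measure R).
Local Notation Int u := (\int[mu]_(t in `[0 : R, 1]) u t).
Implicit Types u w : R -> R.

Lemma integrable01 u : continuous u -> mu.-integrable `[0 : R, 1] (EFin \o u).
Proof.
move=> cu; apply: continuous_compact_integrable; first exact: segment_compact.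
exact: continuous_subspaceT.
Qed.

Lemma Int01D u w : continuous u -> continuous w ->
  Int (u + w) = Int u + Int w.
Proof. by move=> cu cw; rewrite RintegralD //; exact: integrable01. Qed.

Lemma Int01B u w : continuous u -> continuous w ->
  Int (fun t => u t - w t) = Int u - Int w.
Proof. by move=> cu cw; rewrite RintegralB //; exact: integrable01. Qed.

Lemma Int01Z c u : continuous u -> Int (fun t => c * u t) = c * Int u.
Proof. by move=> cu; rewrite RintegralZl //; exact: integrable01. Qed.

Lemma continuous_sum (T : topologicalType) n (f : 'I_n -> T -> R) :
  (forall i, continuous (f i)) -> continuous (fun x => \sum_i f i x).
Proof.
move=> cf; have -> : (fun x => \sum_i f i x) = \sum_i f i.
  by apply/funext => x; rewrite fct_sumE.
elim/big_ind: _ => [x|f1 f2 c1 c2 x|i _]; [exact: cst_continuous| |exact: cf].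
by apply: (@cvgD _ R^o _ _ _ f1 f2); [exact: c1|exact: c2].
Qed.

Lemma Int01_sum n (u : 'I_n -> R -> R) : (forall i, continuous (u i)) ->
  Int (fun t => \sum_i u i t) = \sum_i Int (u i).
Proof.
move=> cu; elim: n u cu => [|n IH] u cu.
  under eq_Rintegral do rewrite big_ord0.
  by rewrite Rintegral_cst // mul0r big_ord0.
under eq_Rintegral do rewrite big_ord_recl.
rewrite Int01D // ?big_ord_recl ?IH //.
by apply: continuous_sum => i; exact: cu.
Qed.

Lemma Int01_le u (c : R) : continuous u -> (forall t, 0 <= t <= 1 -> `|u t| <= c) ->
  `|Int u| <= c.
Proof.
move=> cu uc; have iu := integrable01 cu.
have cn : continuous (fun t => `|u t|).
  by move=> t; apply: continuous_comp; [exact: cu|exact: norm_continuous].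
apply: le_trans (le_normr_Rintegral _ iu) _ => //.
apply: (@le_trans _ _ (Int (fun=> c))); last first.
  rewrite Rintegral_cst //.
  have e : mu `[0 : R, 1]%classic = 1%E.
    by rewrite lebesgue_measure_itv /= lte_fin ltr01 /= oppr0 adde0.
  rewrite [X in c * X](_ : _ = 1) ?mulr1 //.
  by rewrite -[RHS]/(fine 1%E); congr fine; exact: e.
apply: le_Rintegral => //.
- exact: integrable01.
- by apply: integrable01; exact: cst_continuous.
Qed.

Lemma Int01_FTC (U : R -> R) u : continuous u ->
  (forall t, is_derive t (1 : R) U (u t)) -> Int u = U 1 - U 0.
Proof.
move=> cu dU.
have cU : continuous U.
  move=> t; apply: differentiable_continuous; apply/derivable1_diffP.
  by have := dU t; case.
rewrite /Rintegral (@continuous_FTC2 _ u U) //.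
- exact: continuous_subspaceT.
- split.
  + by move=> t _; have := dU t; case.
  + by apply: cvg_at_right_filter; exact: cU.
  + by apply: cvg_at_left_filter; exact: cU.
- by move=> t _; rewrite derive1E; exact: derive_val.
Qed.

Lemma is_derive_line n (f : 'rV[R]_n -> R) x v (s : R) :
  differentiable f (x + s *: v) ->
  is_derive s (1 : R) (fun s => f (x + s *: v)) ('D_v f (x + s *: v)).
Proof.
move=> df; have dv : derivable f (x + s *: v) v by exact: diff_derivable.
have E : (fun h : R => h^-1 *: (((fun s => f (x + s *: v)) \o shift s) (h *: (1 : R))
    - f (x + s *: v))) =
  (fun h : R => h^-1 *: ((f \o shift (x + s *: v)) (h *: v) - f (x + s *: v))).
  apply/funext => h /=; congr (_ *: (f _ - _)).
  by rewrite [h *: 1]mulr1 scalerDl addrCA.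
by apply: DeriveDef; rewrite /derivable /derive E.
Qed.

Lemma mean_value n (f : 'rV[R]_n -> R) x v : (forall y, differentiable f y) ->
  exists2 s : R, 0 <= s <= 1 & f (x + v) - f x = 'D_v f (x + s *: v).
Proof.
move=> df.
have [|//|s s01 e] := @MVT_segment R (fun s => f (x + s *: v))
  (fun s => 'D_v f (x + s *: v)) 0 1 ler01.
- by move=> s _; exact: is_derive_line.
- move=> s; apply: continuous_subspaceT => {}s.
  apply: differentiable_continuous; apply/derivable1_diffP.
  by have := @is_derive_line n f x v s (df _); case.
exists s; first by move: s01; rewrite in_itv.
by move: e; rewrite scale1r scale0r addr0 subr0 mulr1.
Qed.

(** The little-o characterisation identifies the differential with the linear map of coefficients
    [c], so differentiability and the values of all partials come together. *)
Lemma differentiable_of_approx n (f : 'rV[R]_n -> R) (c : 'I_n -> R)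
    (x : 'rV[R]_n) :
  (forall e, 0 < e -> \forall v \near (0 : 'rV[R]_n),
     `|f (v + x) - f x - \sum_j v 0 j * c j| <= e * `|v|) ->
  differentiable f x /\ forall j, pderiv j f x = c j.
Proof.
move=> H.
have [L LE] : exists L : {linear 'rV[R]_n -> R}, forall v, L v = \sum_j v 0 j * c j.
  have @L : {linear 'rV[R]_n -> R}.
    exists (fun v : 'rV[R]_n => \sum_j v 0 j * c j); do 2![eexists]; do ?[constructor].
    - by rewrite big1 // => j _; rewrite mxE mul0r.
    - by move=> v w; rewrite -big_split; apply: eq_bigr => j _ /=; rewrite mxE mulrDl.
    - move=> a v; rewrite /GRing.scale /= mulr_sumr; apply: eq_bigr => j _.
      by rewrite mxE mulrA.
  by exists L.
have cL : continuous L.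
  rewrite (_ : (L : _ -> _) = fun v => \sum_j v 0 j * c j); last exact/funext.
  apply: continuous_sum => j v.
  apply: (@cvgM R _ (nbhs v) _ (fun w : 'rV[R]_n => w 0 j) (fun=> c j)).
    exact: coord_continuous.
  exact: cvg_cst.
have e0 : f \o shift x = cst (f x) + L +o_ (0 : 'rV[R]_n) id.
  apply/eqaddoP => e e0; near=> v.
  rewrite !fctE /= LE opprD addrA.
  by near: v; exact: H.
have eL := diff_unique cL e0.
have df : differentiable f x by apply/diff_locallyP; rewrite eL.
split=> // j; rewrite /pderiv deriveE // eL LE.
rewrite (bigD1 j) //= big1 ?addr0 ?mxE ?eqxx ?mul1r // => i ij.
by rewrite mxE (negbTE ij) andbF mul0r.
Unshelve. all: by end_near. Qed.

Lemma coord_le_norm n (v : 'rV[R]_n) j : `|v 0 j| <= `|v|.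
Proof.
rewrite [leRHS]/Num.norm /= mx_normrE.
exact: (le_bigmax _ (fun i : 'I_1 * 'I_n => `|v i.1 i.2|) (0, j)).
Qed.

Definition homot n (p x : 'rV[R]_n) (t : R) := p + t *: (x - p).

(** A weighted mean of [f] over the segment from [p] to [x]. The weight t^m is there because each
    differentiation in [x] under the integral produces one more factor t. *)
Definition pint n (m : nat) (p : 'rV[R]_n) (f : 'rV[R]_n -> R) x : R :=
  Int (fun t => t ^+ m * f (homot p x t)).

Lemma homot_continuous2 n (p : 'rV[R]_n) :
  continuous (fun z : R * 'rV[R]_n => homot p z.2 z.1).
Proof.
move=> z; apply: cvgD; first exact: cvg_cst.
apply: cvgZ; first exact: cvg_fst.
by apply: cvgB; [exact: cvg_snd|exact: cvg_cst].
Qed.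

Lemma homot_continuous n (p x : 'rV[R]_n) : continuous (homot p x).
Proof.
move=> t; apply: cvgD; first exact: cvg_cst.
by apply: cvgZ; [exact: cvg_id|exact: cvg_cst].
Qed.

Lemma pint_integrand_continuous n m (p : 'rV[R]_n) (f : 'rV[R]_n -> R) x :
  continuous f -> continuous (fun t : R => t ^+ m * f (homot p x t)).
Proof.
move=> cf t; apply: cvgM; first exact: exprn_continuous.
by apply: (continuous_comp (@homot_continuous _ p x t)); exact: cf.
Qed.

(** Compactness of [0, 1] makes a neighbourhood of [x] that depends on [t] independent of it, as in
    the tube lemma. *)
Lemma homot_uniform n (p x : 'rV[R]_n) (g : 'rV[R]_n -> R) : continuous g ->
  forall e, 0 < e -> \forall y \near x, forall t, 0 <= t <= 1 ->
    `|g (homot p y t) - g (homot p x t)| <= e.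
Proof.
move=> cg e e0.
have cG : continuous (fun z : R * 'rV[R]_n => g (homot p z.2 z.1)).
  move=> z; apply: (@continuous_comp _ _ _ (fun z => homot p z.2 z.1) g).
    exact: homot_continuous2.
  exact: cg.
have /compact_near_coveringP K := @segment_compact R 0 1.
have Ke : \forall y \near x, `[0 : R, 1]%classic `<=`
    (fun t => `|g (homot p y t) - g (homot p x t)| <= e).
  apply: (K 'rV[R]_n (nbhs x) (fun y t =>
    `|g (homot p y t) - g (homot p x t)| <= e)) => t _.
  have e2 : 0 < e / 2 by rewrite divr_gt0.
  have := cG (t, x); move=> /cvgrPdist_le /(_ _ e2) [[A B] /= [At Bx] AB].
  exists (A, B) => //= -[t' y] /= [At' By].
  rewrite (splitr e) -(subrKA (g (homot p x t))).
  apply: le_trans (ler_normD _ _) _; apply: lerD.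
    by rewrite distrC; exact: (AB (t', y)).
  apply: (AB (t', x)); split => //=; exact: nbhs_singleton.
by apply: filterS Ke => y Hy t t01; apply: Hy; rewrite /= in_itv.
Qed.

(** Differentiation under the integral sign: the mean value theorem expresses the increment of the
    integrand by partials at a point near the segment, and [homot_uniform] makes the error small
    uniformly in [t]. *)
Lemma pint_diff n m (p : 'rV[R]_n) (f : 'rV[R]_n -> R) x :
  (forall y, differentiable f y) -> (forall j y, differentiable (pderiv j f) y) ->
  differentiable (pint m p f) x /\
  forall j, pderiv j (pint m p f) x = pint m.+1 p (pderiv j f) x.
Proof.
move=> df ddf.
have cf : continuous f by move=> y; exact: differentiable_continuous.
have cdf j : continuous (pderiv j f) by move=> y; exact: differentiable_continuous.
apply: differentiable_of_approx => e e0.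
(* The denominator [n.+1] keeps a sum of [n] errors below [e] and is nonzero also for [n = 0]. *)
have e1 : 0 < e / n.+1%:R by rewrite divr_gt0.
have : \forall y \near x, forall j t, 0 <= t <= 1 ->
    `|pderiv j f (homot p y t) - pderiv j f (homot p x t)| <= e / n.+1%:R.
  apply: (@filter_forall _ _ (fun j y => forall t, 0 <= t <= 1 ->
    `|pderiv j f (homot p y t) - pderiv j f (homot p x t)| <= e / n.+1%:R)
    (nbhs x)) => j.
  exact: homot_uniform.
move=> /nbhs_ballP[d /= d0 Bd]; apply/nbhs_ballP; exists d => // v.
rewrite -ball_normE /= sub0r normrN => vd.
pose a t := t ^+ m * f (homot p (v + x) t).
pose b t := t ^+ m * f (homot p x t).
pose c j t := v 0 j * (t ^+ m.+1 * pderiv j f (homot p x t)).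
have ca : continuous a by exact: pint_integrand_continuous.
have cb : continuous b by exact: pint_integrand_continuous.
have cc j : continuous (c j).
  move=> t; apply: (@cvgM R _ (nbhs t) _ (fun=> v 0 j)); first exact: cvg_cst.
  exact: pint_integrand_continuous.
have csc := continuous_sum cc.
have -> : pint m p f (v + x) - pint m p f x -
    \sum_j v 0 j * pint m.+1 p (pderiv j f) x =
    Int (fun t => a t - b t - \sum_j c j t).
  rewrite !Int01B //; last by move=> t; apply: (@cvgB _ R^o); [exact: ca|exact: cb].
  congr (_ - _); rewrite Int01_sum //; apply: eq_bigr => j _.
  by rewrite Int01Z //; exact: pint_integrand_continuous.
apply: Int01_le => [t|t /andP[t0 t1]].
  apply: (@cvgB _ R^o); last exact: csc.
  by apply: (@cvgB _ R^o); [exact: ca|exact: cb].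
have [s /andP[s0 s1]] := mean_value (homot p x t) (t *: v) df.
have -> : homot p x t + t *: v = homot p (v + x) t.
  by apply/rowP => i; rewrite !mxE; ring.
have -> : homot p x t + s *: (t *: v) = homot p (s *: v + x) t.
  by apply/rowP => i; rewrite !mxE; ring.
rewrite derive_pderiv // => e2.
have -> : a t - b t - \sum_j c j t = \sum_j (t ^+ m.+1 * v 0 j *
    (pderiv j f (homot p (s *: v + x) t) - pderiv j f (homot p x t))).
  rewrite /a /b -mulrBr e2 mulr_sumr -sumrB; apply: eq_bigr => j _.
  by rewrite /c mxE exprS; ring.
apply: le_trans (ler_norm_sum _ _ _) _.
apply: (@le_trans _ _ (\sum_(j < n) `|v| * (e / n.+1%:R))); last first.
  rewrite sumr_const card_ord -[_ *+ n]mulr_natr -mulrA [leRHS]mulrC ler_wpM2l //.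
  by rewrite mulrAC ler_pdivrMr // ler_wpM2l ?ler_nat // ltW.
apply: ler_sum => j _; rewrite !normrM normrX (ger0_norm t0).
apply: ler_pM => //; first by rewrite mulr_ge0 ?exprn_ge0.
  apply: (@le_trans _ _ `|v 0 j|).
    by rewrite ler_piMl // exprn_ile1.
  exact: coord_le_norm.
apply: Bd => //; last by rewrite t0.
rewrite -ball_normE /= opprD addrCA subrr addr0 normrN normrZ (ger0_norm s0).
by apply: le_lt_trans vd; rewrite ler_piMl.
Qed.

Lemma smooth_at_pint n m (p : 'rV[R]_n) (f : 'rV[R]_n -> R) x :
  (forall y, smooth_at f y) -> smooth_at (pint m p f) x.
Proof.
move=> sf; apply: (@smooth_at_coind _ _ setT (fun g => exists m f,
  (forall y, smooth_at f y) /\ g = pint m p f)) => //; first exact: openT; last first.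
  by exists m, f.
move=> _ [k [g [sg ->]]].
have D := @pint_diff n k p g _ (fun y => smooth_at_differentiable (sg y))
  (fun j y => smooth_at_differentiable (smooth_at_pderiv j (sg y))).
split=> [y _|j]; first by case: (D y).
exists (pint k.+1 p (pderiv j g)) => [|y _]; last by case: (D y).
by exists k.+1, (pderiv j g); split=> // y; exact: smooth_at_pderiv.
Qed.

End ParametricIntegral.

(** * The lemmas of Hadamard, Schwarz and Poincaré *)

Section Hadamard.
Context {R : realType} {n : nat}.
Implicit Types (f g : 'rV[R]_n -> R) (x p : 'rV[R]_n).
Local Notation Int u := (\int[@lebesgue_measure R]_(t in `[0 : R, 1]) u t).

Lemma smooth_continuous f : (forall y, smooth_at f y) -> continuous f.
Proof.
by move=> sf y; apply: differentiable_continuous; exact: smooth_at_differentiable.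
Qed.

Lemma pderivD f g j x : differentiable f x -> differentiable g x ->
  pderiv j (f + g) x = pderiv j f x + pderiv j g x.
Proof. by move=> df dg; rewrite /pderiv deriveD //; exact: diff_derivable. Qed.

Lemma pderivM f g j x : differentiable f x -> differentiable g x ->
  pderiv j (f * g) x = f x * pderiv j g x + g x * pderiv j f x.
Proof. by move=> df dg; rewrite /pderiv deriveM //; exact: diff_derivable. Qed.

Lemma pderiv_cst (c : R) j x : pderiv j (cst c) x = 0.
Proof. exact: derive_cst. Qed.

Lemma pderiv_sum (I : Type) (r : seq I) (f : I -> 'rV[R]_n -> R) j x :
  (forall i, smooth_at (f i) x) ->
  pderiv j (\sum_(i <- r) f i) x = \sum_(i <- r) pderiv j (f i) x.
Proof.
move=> sf; elim: r => [|i r IH]; first by rewrite !big_nil (pderiv_cst 0).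
rewrite !big_cons pderivD ?IH //; apply: smooth_at_differentiable => //.
exact: smooth_at_sum.
Qed.

Lemma pderiv_coord (i j : 'I_n) x :
  pderiv j (fun y : 'rV[R]_n => y 0 i) x = (i == j)%:R.
Proof. by rewrite /pderiv derive_coord mxE eqxx. Qed.

Lemma homot_FTC f p x : (forall y, smooth_at f y) ->
  Int (fun t => \sum_k (x 0 k - p 0 k) * pderiv k f (homot p x t)) = f x - f p.
Proof.
move=> sf.
have dl t : is_derive t (1 : R) (fun t => f (homot p x t))
    (\sum_k (x 0 k - p 0 k) * pderiv k f (homot p x t)).
  apply: is_derive_eq (is_derive_line _) _; first exact: smooth_at_differentiable.
  rewrite derive_pderiv; last exact: smooth_at_differentiable.
  by apply: eq_bigr => k _; rewrite !mxE.
rewrite (Int01_FTC _ dl).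
  by rewrite /homot scale1r scale0r addr0 [p + _]addrC subrK.
apply: continuous_sum => k t.
apply: (@cvgM R _ (nbhs t) _ (fun=> x 0 k - p 0 k)); first exact: cvg_cst.
apply: (continuous_comp (@homot_continuous _ _ p x t)).
by apply: smooth_continuous => y; exact: smooth_at_pderiv.
Qed.

Lemma hadamard f p x : (forall y, smooth_at f y) ->
  f x = f p + \sum_k (x 0 k - p 0 k) * pint 0 p (pderiv k f) x.
Proof.
move=> sf; apply/eqP; rewrite addrC -subr_eq -(homot_FTC p x sf).
have cp k : continuous (pderiv k f).
  by apply: smooth_continuous => y; exact: smooth_at_pderiv.
rewrite Int01_sum => [|k t]; last first.
  apply: (@cvgM R _ (nbhs t) _ (fun=> x 0 k - p 0 k)); first exact: cvg_cst.
  by apply: (continuous_comp (@homot_continuous _ _ p x t)); exact: cp.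
apply/eqP/eq_bigr => k _; rewrite -Int01Z; last exact: pint_integrand_continuous.
by apply: eq_Rintegral => t _; rewrite expr0 mul1r.
Qed.

Lemma pint_center g p : pint 0 p g p = g p.
Proof.
rewrite /pint; transitivity (Int (fun=> g p)).
  by apply: eq_Rintegral => t _; rewrite /homot subrr scaler0 addr0 expr0 mul1r.
have dl (t : R) : is_derive t (1 : R) (fun t => t * g p) (g p).
  apply: is_derive_eq (is_deriveM (is_derive_id t 1) (is_derive_cst (g p) t 1)) _.
  by rewrite scaler0 add0r [_ *: _]mulr1.
by rewrite (Int01_FTC _ dl) ?mul0r ?mul1r ?subr0 //; exact: cst_continuous.
Qed.

Lemma pint_diff_smooth m p g x : (forall y, smooth_at g y) ->
  forall j, pderiv j (pint m p g) x = pint m.+1 p (pderiv j g) x.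
Proof.
move=> sg j.
have dg y : differentiable g y by exact: smooth_at_differentiable.
have ddg k y : differentiable (pderiv k g) y.
  by apply: smooth_at_differentiable; exact: smooth_at_pderiv.
by case: (pint_diff m p x dg ddg).
Qed.

(* Writing [f = f p + \sum_k (x_k - p_k) g_k] with smooth [g_k], the mixed
   derivative at [p] is [d_i g_j + d_j g_i]. *)
Lemma schwarz f i j p : (forall y, smooth_at f y) ->
  pderiv i (pderiv j f) p = pderiv j (pderiv i f) p.
Proof.
move=> sf; pose g k := pint 0 p (pderiv k f).
have sg k y : smooth_at (g k) y.
  by apply: smooth_at_pint => z; exact: smooth_at_pderiv.
pose l k := (fun y : 'rV[R]_n => y 0 k) + cst (- p 0 k).
have sl k y : smooth_at (l k) y.
  by apply: smooth_atD; [exact: smooth_at_coord|exact: smooth_at_cst].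
have dl k a y : pderiv a (l k) y = (k == a)%:R.
  rewrite pderivD ?pderiv_coord ?pderiv_cst ?addr0 //.
  exact: differentiable_coord.
have slg k y : smooth_at (l k * g k) y by exact: smooth_atM.
have fE : f = cst (f p) + \sum_k l k * g k.
  apply/funext => y; rewrite (hadamard p y sf) !fctE; congr (_ + _).
  by rewrite fct_sumE; apply: eq_bigr => k _; rewrite !fctE.
have D1 a : pderiv a f = g a + \sum_k l k * pderiv a (g k).
  apply/funext => y; rewrite {1}fE pderivD; [|exact: differentiable_cst|]; last first.
    by apply: smooth_at_differentiable; exact: smooth_at_sum.
  rewrite pderiv_cst add0r pderiv_sum // !fctE fct_sumE.
  rewrite -[g a y](_ : \sum_k g k y * (k == a)%:R = _); last first.
    by rewrite (bigD1 a) //= big1 ?eqxx ?mulr1 ?addr0 // => k /negbTE ->; rewrite mulr0.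
  rewrite -big_split; apply: eq_bigr => k _.
  rewrite pderivM ?dl; [|exact: smooth_at_differentiable..].
  by rewrite addrC !fctE.
have D2 a b : pderiv b (pderiv a f) p = pderiv b (g a) p + pderiv a (g b) p.
  rewrite D1 pderivD; [|exact: smooth_at_differentiable|]; last first.
    apply: smooth_at_differentiable; apply: smooth_at_sum => k _; apply: smooth_atM => //.
    exact: smooth_at_pderiv.
  congr (_ + _); rewrite pderiv_sum; last first.
    by move=> k; apply: smooth_atM => //; exact: smooth_at_pderiv.
  have lp k : l k p = 0 by rewrite /l !fctE subrr.
  under eq_bigr => k _.
    rewrite pderivM ?dl ?lp ?mul0r ?add0r; last 2 first.
    - exact: smooth_at_differentiable.
    - by apply: smooth_at_differentiable; exact: smooth_at_pderiv.
    over.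
  by rewrite (bigD1 b) //= big1 ?eqxx ?mulr1 ?addr0 // => k /negbTE ->; rewrite mulr0.
exact: etrans (D2 j i) (etrans (addrC _ _) (esym (D2 i j))).
Qed.

(** The primitive is the line integral of [v] along the segment from 0 to y. By closedness its j-th
    partial is the integral over [0, 1] of the t-derivative of t v_j(t y), that is v_j(y). *)
Lemma poincare (v : 'I_n -> 'rV[R]_n -> R) :
  (forall k y, smooth_at (v k) y) ->
  (forall i j y, pderiv i (v j) y = pderiv j (v i) y) ->
  exists f, [/\ forall y, smooth_at f y, f 0 = 0 & forall k y, pderiv k f y = v k y].
Proof.
move=> sv cv; pose g k := pint 0 0 (v k).
have sg k y : smooth_at (g k) y by exact: smooth_at_pint.
pose c k := fun y : 'rV[R]_n => y 0 k.
have sc k y : smooth_at (c k) y by exact: smooth_at_coord.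
have scg k y : smooth_at (c k * g k) y by exact: smooth_atM.
exists (\sum_k c k * g k); split=> [y||j y]; first exact: smooth_at_sum.
  by rewrite fct_sumE big1 // => k _; rewrite fctE /c mxE mul0r.
rewrite pderiv_sum //.
transitivity (g j y + \sum_k y 0 k * pint 1 0 (pderiv k (v j)) y).
  rewrite -[g j y](_ : \sum_k g k y * (k == j)%:R = _); last first.
    by rewrite (bigD1 j) //= big1 ?eqxx ?mulr1 ?addr0 // => k /negbTE ->; rewrite mulr0.
  rewrite -big_split; apply: eq_bigr => k _.
  rewrite pderivM ?pderiv_coord; [|exact: smooth_at_differentiable..].
  rewrite /= addrC (pint_diff_smooth _ _ _ (sv k)).
  by have -> : pderiv j (v k) = pderiv k (v j) by apply/funext => z; exact: cv.
have cvj : continuous (v j) by exact: smooth_continuous.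
have cpv k : continuous (pderiv k (v j)).
  by apply: smooth_continuous => z; exact: smooth_at_pderiv.
have cI k : continuous (fun t : R => y 0 k * (t ^+ 1 * pderiv k (v j) (homot 0 y t))).
  move=> t; apply: (@cvgM R _ (nbhs t) _ (fun=> y 0 k)); first exact: cvg_cst.
  exact: pint_integrand_continuous.
have c0 : continuous (fun t : R => t ^+ 0 * v j (homot 0 y t)).
  exact: pint_integrand_continuous.
rewrite (eq_bigr (fun k => Int (fun t =>
    y 0 k * (t ^+ 1 * pderiv k (v j) (homot 0 y t))))) => [|k _]; last first.
  by rewrite Int01Z //; exact: pint_integrand_continuous.
rewrite -Int01_sum // -Int01D //; last exact: continuous_sum.
have dl (t : R) : is_derive t (1 : R) (fun t => t * v j (homot 0 y t))
    (t ^+ 0 * v j (homot 0 y t) +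
     \sum_k y 0 k * (t ^+ 1 * pderiv k (v j) (homot 0 y t))).
  have dl := @is_derive_line R n (v j) 0 (y - 0) t
    (smooth_at_differentiable (sv j _)).
  apply: is_derive_eq (is_deriveM (is_derive_id t 1) dl) _.
  rewrite derive_pderiv; last exact: smooth_at_differentiable.
  rewrite expr0 mul1r [_ *: 1]mulr1 addrC /GRing.scale /= mulr_sumr.
  congr (_ + _); apply: eq_bigr => k _.
  by rewrite expr1 mulrCA !mxE subr0.
rewrite (Int01_FTC _ dl).
  by rewrite mul0r mul1r subr0 /homot subr0 scale1r add0r.
move=> t; apply: (@cvgD _ R^o); first exact: c0.
exact: continuous_sum.
Qed.

Lemma pderiv0_cst f x y : (forall z, differentiable f z) ->
  (forall k z, pderiv k f z = 0) -> f x = f y.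
Proof.
move=> df f0; have [s _] := mean_value y (x - y) df.
rewrite derive_pderiv // big1 => [|k _]; last by rewrite f0 mulr0.
by rewrite [y + _]addrC subrK => /eqP; rewrite subr_eq0 => /eqP.
Qed.

End Hadamard.

(** * The free two-step nilpotent group on three generators *)

Section Group.
Context {R : realType}.
Local Notation V := 'rV[R]_6.
Implicit Types (x y z g : V) (i j k : 'I_6).

(* The coordinates 0, 1, 2 are those of the generators; the central
   coordinates 3, 4, 5 belong to the pairs (0, 1), (0, 2), (1, 2) of generators
   given by [lo1] and [lo2] (which are junk on 0, 1, 2, where [tw] is 0). *)
Definition up (j : 'I_6) : bool := (2 < j)%N.
Definition lo1 (j : 'I_6) : 'I_6 := inord (j == 5 :> nat).
Definition lo2 (j : 'I_6) : 'I_6 := inord (1 + (3 < j)).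

Lemma up_lo1 j : up (lo1 j) = false.
Proof. by rewrite /up inordK //; case: (_ == _). Qed.

Lemma up_lo2 j : up (lo2 j) = false.
Proof. by rewrite /up inordK //; case: (3 < j)%N. Qed.

Definition tw j : R := (up j)%:R.

Lemma tw_lo1 j : tw (lo1 j) = 0. Proof. by rewrite /tw up_lo1. Qed.
Lemma tw_lo2 j : tw (lo2 j) = 0. Proof. by rewrite /tw up_lo2. Qed.

(** Not exponential coordinates: the antisymmetric term with factor 1/2 of the
    Baker-Campbell-Hausdorff formula is replaced by the cohomologous cocycle x_i y_j. With it the
    integer points are closed under multiplication. *)
Definition nmul x y : V :=
  \row_j (x 0 j + y 0 j + tw j * x 0 (lo1 j) * y 0 (lo2 j)).

Definition ninv x : V := \row_j (- x 0 j + tw j * x 0 (lo1 j) * x 0 (lo2 j)).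

Lemma nmulE x y j :
  nmul x y 0 j = x 0 j + y 0 j + tw j * x 0 (lo1 j) * y 0 (lo2 j).
Proof. by rewrite mxE. Qed.

Lemma ninvE x j : ninv x 0 j = - x 0 j + tw j * x 0 (lo1 j) * x 0 (lo2 j).
Proof. by rewrite mxE. Qed.

Lemma nmulA : associative nmul.
Proof. by move=> x y z; apply/rowP => j; rewrite !nmulE !tw_lo1 !tw_lo2; ring. Qed.

Lemma nmul0x : left_id 0 nmul.
Proof. by move=> x; apply/rowP => j; rewrite !nmulE !mxE; ring. Qed.

Lemma nmulx0 : right_id 0 nmul.
Proof. by move=> x; apply/rowP => j; rewrite !nmulE !mxE; ring. Qed.

Lemma nmulVx : left_inverse 0 ninv nmul.
Proof. by move=> x; apply/rowP => j; rewrite !nmulE !ninvE !tw_lo1 !mxE; ring. Qed.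

Lemma nmulxV : right_inverse 0 ninv nmul.
Proof. by move=> x; apply/rowP => j; rewrite !nmulE !ninvE !tw_lo2 !mxE; ring. Qed.

Lemma nmulK y : cancel (nmul^~ y) (nmul^~ (ninv y)).
Proof. by move=> x; rewrite -nmulA nmulxV nmulx0. Qed.

Lemma nmulKV y : cancel (nmul^~ (ninv y)) (nmul^~ y).
Proof. by move=> x; rewrite -nmulA nmulVx nmulx0. Qed.

Lemma nmulVK x : cancel (nmul x) (nmul (ninv x)).
Proof. by move=> y; rewrite nmulA nmulVx nmul0x. Qed.

Lemma nmulVKV x : cancel (nmul (ninv x)) (nmul x).
Proof. by move=> y; rewrite nmulA nmulxV nmul0x. Qed.

Lemma ninvM x y : ninv (nmul x y) = nmul (ninv y) (ninv x).
Proof. by rewrite -[LHS](nmulK x) -[X in nmul X _](nmulK y) -(nmulA _ x) nmulVx nmul0x. Qed.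

Lemma ninvK : involutive ninv.
Proof. by move=> x; rewrite -[LHS]nmulx0 -(nmulVx x) nmulA nmulVx nmul0x. Qed.

Lemma ninv0 : ninv 0 = 0.
Proof. by rewrite -[LHS]nmul0x nmulxV. Qed.

Definition lattice : set V := [set x | forall j, x 0 j \is a Num.int].

Lemma tw_int j : tw j \is a Num.int. Proof. by rewrite /tw; case: (up j). Qed.

Lemma lattice0 : lattice 0. Proof. by move=> j; rewrite mxE. Qed.

Lemma latticeM x y : lattice x -> lattice y -> lattice (nmul x y).
Proof. by move=> lx ly j; rewrite nmulE !rpredD // !rpredM // tw_int. Qed.

Lemma latticeV x : lattice x -> lattice (ninv x).
Proof. by move=> lx j; rewrite ninvE rpredD ?rpredN // !rpredM // tw_int. Qed.

Lemma lattice_cancel x y :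
  lattice (nmul (ninv x) y) <-> exists2 g, lattice g & y = nmul x g.
Proof.
split=> [l|[g lg ->]]; last by rewrite nmulVK.
by exists (nmul (ninv x) y) => //; rewrite nmulVKV.
Qed.

Definition lat_equiv : rel V := fun x y => `[< lattice (nmul (ninv x) y) >].

Lemma lat_equiv_class : equiv_class_of lat_equiv.
Proof.
split=> [x|x y|y x z].
- by apply/asboolP; rewrite nmulVx; exact: lattice0.
- by apply/asboolP/asboolP => /latticeV; rewrite ninvM ninvK.
- move=> /asboolP lxy /asboolP lyz; apply/asboolP.
  by rewrite -(nmulVKV y z) nmulA; exact: latticeM.
Qed.

Canonical lat_equivRel := EquivRelPack lat_equiv_class.

Definition nil_space := quotient_topology {eq_quot lat_equiv}%qT.
HB.instance Definition _ := Topological.on nil_space.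
HB.instance Definition _ := Quotient.on nil_space.

Definition nproj (x : V) : nil_space := (\pi_nil_space x)%qT.

Lemma nprojP x y : nproj x = nproj y <-> exists2 g, lattice g & y = nmul x g.
Proof.
rewrite -lattice_cancel; split.
  by move/eqmodP/asboolP.
by move=> l; apply/eqmodP/asboolP.
Qed.

Lemma nproj_surj (q : nil_space) : exists x, nproj x = q.
Proof. by exists (repr q)%qT; exact: reprK. Qed.

Lemma nproj_continuous : continuous nproj.
Proof. exact: pi_continuous. Qed.

End Group.

(** * Topology of the quotient *)

Section RowTopology.
Context {R : realType}.

Lemma cvg_row n (T : Type) (F : set_system T) (FF : Filter F)
    (f : T -> 'rV[R]_n) (l : 'rV[R]_n) :
  (forall j, (fun x => f x 0 j) @ F --> l 0 j) -> f @ F --> l.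
Proof.
move=> fl; apply/cvgrPdist_le => e e0; near=> x.
rewrite [leLHS]/Num.Def.normr /= mx_normrE (bigmax_le _ (ltW e0)) //= => -[i j] _.
rewrite ord1 !mxE /=; move: j; near: x; apply: filter_forall => j.
by have /cvgrPdist_le := fl j; apply.
Unshelve. all: by end_near. Qed.

Lemma continuous_row n (T : topologicalType) (f : T -> 'rV[R]_n) (t : T) :
  (forall j, (fun x => f x 0 j) @ t --> f t 0 j) -> {for t, continuous f}.
Proof. exact: cvg_row. Qed.

Lemma coord_cvg (T : topologicalType) n (f : T -> 'rV[R]_n) j (t : T) :
  {for t, continuous f} -> (fun z => f z 0 j) @ t --> f t 0 j.
Proof.
move=> cf; apply: (@continuous_comp _ _ _ f (fun v : 'rV[R]_n => v 0 j)) => //.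
exact: coord_continuous.
Qed.

Lemma smooth_at_continuous n (f : 'rV[R]_n -> R) (x : 'rV[R]_n) :
  smooth_at f x -> {for x, continuous f}.
Proof. by move=> sf; exact/differentiable_continuous/smooth_at_differentiable. Qed.

Lemma ball_rowP n (x y : 'rV[R]_n) (e : R) : 0 < e ->
  ball x e y <-> forall j, `|x 0 j - y 0 j| < e.
Proof.
move=> e0; rewrite -ball_normE /=; split=> [xy j|xy].
  by apply: le_lt_trans xy; have := coord_le_norm (x - y) j; rewrite !mxE.
rewrite [ltLHS]/Num.Def.normr /= mx_normrE.
by apply/bigmax_ltP; split=> //= -[i j] _; rewrite ord1 !mxE.
Qed.

Lemma second_countable_row n : @second_countable 'rV[R]_n.
Proof.
pose B (z : 'rV[rat]_n * nat) := ball (map_mx ratr z.1 : 'rV[R]_n) z.2.+1%:R^-1.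
exists (range B).
  by apply: sub_countable (card_image_le _ _) (countableP _).
split=> [_ [z _ <-]|x A /nbhs_ballP[e /= e0 xA]]; first exact: ball_open.
have e2 : 0 < e / 2 by rewrite divr_gt0.
have [m] := @ltr_add_invr R 0 (e / 2) e2.
rewrite add0r => me; set d := m.+1%:R^-1 in me.
have d0 : 0 < d by rewrite invr_gt0.
have Q j : exists q : rat, `|x 0 j - ratr q| < d.
  have [|q] := @rat_in_itvoo R (x 0 j - d) (x 0 j + d).
    by rewrite ltrD2l gtrN.
  by rewrite in_itv /= => /andP[q1 q2]; exists q; rewrite distrC ltr_distl q1.
pose c := \row_j sval (cid (Q j)).
have xc : ball (map_mx ratr c : 'rV[R]_n) d x.
  apply/ball_sym/ball_rowP => // j; rewrite !mxE.
  exact: (svalP (cid (Q j))).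
exists (B (c, m)); first by split=> //; exists (c, m).
move=> y cy; apply: xA; rewrite [e]splitr.
have cy' : ball (map_mx ratr c : 'rV[R]_n) (e / 2) y by exact: (le_ball (ltW me)).
apply: ball_triangle cy'.
by apply: (le_ball (ltW me)); exact: ball_sym.
Qed.

End RowTopology.

(** * Local sections, separation and compactness of the coset space *)

Section Quotient.
Context {R : realType}.
Local Notation V := 'rV[R]_6.
Implicit Types (x y z g h : V) (i j k : 'I_6).

Lemma smooth_nmulr g k z : smooth_at (fun x => nmul x g 0 k) z.
Proof.
have -> : (fun x => nmul x g 0 k) = (fun x : V => x 0 k) + cst (g 0 k) +
    cst (tw k * g 0 (lo2 k)) * (fun x : V => x 0 (lo1 k)).
  by apply/funext => x; rewrite nmulE !fctE; ring.
by apply: smooth_atD; [apply: smooth_atD|apply: smooth_atM];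
  first [exact: smooth_at_coord|exact: smooth_at_cst].
Qed.

Lemma nmulr_continuous g : continuous (nmul^~ g).
Proof.
by move=> x; apply: continuous_row => j; apply: smooth_at_continuous; exact: smooth_nmulr.
Qed.

(** The saturation of [U] is the union of its right translates by lattice elements, and translations
    are continuous. *)
Lemma nproj_open (U : set V) : open U -> open (nproj @` U).
Proof.
move=> oU; rewrite /open /= /quotient_open.
rewrite openE => y /= [x Ux] /nprojP[g lg ey].
have cy : nbhs y ((nmul^~ (ninv g)) @^-1` U).
  by apply: nmulr_continuous; apply: open_nbhs_nbhs; split=> //; rewrite ey nmulK.
apply: filterS cy => z /= Uz; exists (nmul z (ninv g)) => //.
by apply/nprojP; exists g => //; rewrite nmulKV.
Qed.

(** With radius 1/2, two points of a box differ by less than 1 in each coordinate, too little for a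
    nonzero integer. *)
Definition box g : set V := ball g (2^-1).

Lemma half_gt0 : 0 < 2^-1 :> R. Proof. by rewrite invr_gt0. Qed.

Lemma box_center g : box g g. Proof. by apply: ballxx; exact: half_gt0. Qed.

Lemma box_open g : open (box g). Proof. exact: ball_open. Qed.

Lemma box_nbhs g x : box g x -> nbhs x (box g).
Proof. by move=> gx; apply: open_nbhs_nbhs; split=> //; exact: box_open. Qed.

(** The low coordinates of the lattice element [a] are differences of coordinates, hence vanish.
    This removes the twisting term, so the central coordinates are plain differences too. *)
Lemma nproj_inj_box g x y : box g x -> box g y -> nproj x = nproj y -> x = y.
Proof.
have h0 := half_gt0.
move=> /(ball_rowP _ _ h0) gx /(ball_rowP _ _ h0) gy /nprojP[a la ey].
have xy j : `|y 0 j - x 0 j| < 1.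
  rewrite (splitr 1) -(subrKA (g 0 j)) (le_lt_trans (ler_normD _ _)) //.
  by rewrite ltrD // div1r ?(distrC (y 0 j)).
have a0 j : y 0 j = x 0 j + a 0 j -> a 0 j = 0.
  move=> e; apply/eqP; apply: contraTT (xy j) => aj.
  by rewrite e addrAC subrr add0r -leNgt norm_intr_ge1.
have al j : up j = false -> a 0 j = 0.
  by move=> uj; apply: a0; rewrite ey nmulE /tw uj !mul0r addr0.
apply/rowP => j; rewrite ey nmulE (al _ (up_lo2 j)) mulr0 addr0 [a 0 j]a0 ?addr0 //.
by rewrite ey nmulE (al _ (up_lo2 j)) mulr0 addr0.
Qed.

(** The section of the projection over the image of [box g]; elsewhere it takes the default value
    0. *)
Definition nlift g (q : nil_space) : V := xget 0 [set x | box g x /\ nproj x = q].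

Lemma nlift_proj g x : box g x -> nlift g (nproj x) = x.
Proof.
move=> gx; rewrite /nlift; case: xgetP => [y _ [gy e]|/(_ x)]; last by case.
exact: (nproj_inj_box gy gx).
Qed.

(** Locally a change of lift is right translation by one fixed lattice element; smoothness of the
    chart transitions follows. *)
Lemma nlift_near g x y : box g y -> nproj x = nproj y ->
  exists2 a, lattice a & nmul x a = y /\ \forall z \near x, nlift g (nproj z) = nmul z a.
Proof.
move=> gy /nprojP[a la e]; exists a => //; split=> //.
have : nbhs x ((nmul^~ a) @^-1` box g).
  by apply: nmulr_continuous; apply: box_nbhs; rewrite -e.
apply: filterS => z /= gz.
by rewrite (_ : nproj z = nproj (nmul z a)) ?nlift_proj //; apply/nprojP; exists a.
Qed.

Lemma nmul_continuous : continuous (fun p : V * V => nmul p.1 p.2).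
Proof.
move=> p; apply: continuous_row => j.
have -> : (fun p : V * V => nmul p.1 p.2 0 j) = (fun p =>
    p.1 0 j + p.2 0 j + tw j * p.1 0 (lo1 j) * p.2 0 (lo2 j)).
  by apply/funext => x; rewrite nmulE.
have c1 k : (fun p : V * V => p.1 0 k) @ p --> p.1 0 k.
  by apply: coord_cvg; exact: cvg_fst.
have c2 k : (fun p : V * V => p.2 0 k) @ p --> p.2 0 k.
  by apply: coord_cvg; exact: cvg_snd.
rewrite nmulE; apply: (@cvgD _ R^o); first by apply: (@cvgD _ R^o).
by apply: cvgM => //; apply: cvgM => //; exact: cvg_cst.
Qed.

Lemma smooth_ninv k z : smooth_at (fun x => ninv x 0 k) z.
Proof.
have -> : (fun x => ninv x 0 k) = - (fun x : V => x 0 k) +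
    cst (tw k) * (fun x : V => x 0 (lo1 k)) * (fun x : V => x 0 (lo2 k)).
  by apply/funext => x; rewrite ninvE !fctE.
apply: smooth_atD; first by apply: smooth_atN; exact: smooth_at_coord.
by do 2?apply: smooth_atM; first [exact: smooth_at_coord|exact: smooth_at_cst].
Qed.

Lemma ninv_continuous : continuous (@ninv R).
Proof.
by move=> x; apply: continuous_row => j; apply: smooth_at_continuous; exact: smooth_ninv.
Qed.

Lemma closed_int : closed [set t : R | t \is a Num.int].
Proof.
rewrite -openC openE => t /= /negP tn.
have ft : (Num.floor t)%:~R < t.
  by rewrite lt_neqAle floor_le andbT -intrEfloor.
near=> z; move=> /= /floorK e.
have : (Num.floor t)%:~R < z by near: z; exact: lt_nbhsr.
have : z < (Num.floor t + 1)%:~R.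
  by near: z; apply: lt_nbhsl; exact: floorD1_gt.
by rewrite -e !ltr_int ltzD1 => /le_lt_trans h /h; rewrite ltxx.
Unshelve. all: by end_near. Qed.

Lemma closed_lattice : closed (@lattice R).
Proof.
have -> : @lattice R = \bigcap_j ((fun x : V => x 0 j) @^-1` [set t : R | t \is a Num.int]).
  by apply/seteqP; split=> [x lx j _|x lx j]; [exact: lx|exact: (lx j)].
apply: closed_bigI => j _; apply: preimage_closed; last exact: closed_int.
by move=> x _; exact: coord_continuous.
Qed.

(** As the lattice is closed, keeping x^-1 y off it is an open condition on (x, y); the open
    projection carries a product neighbourhood to disjoint open sets. *)
Lemma nproj_hausdorff : hausdorff_space (@nil_space R).
Proof.
rewrite open_hausdorff => p q pq.
have [x xp] := nproj_surj p; have [y yq] := nproj_surj q.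
pose f (z : V * V) := nmul (ninv z.1) z.2.
have cf : continuous f.
  move=> z; apply: (@continuous_comp _ _ _ (fun z : V * V => (ninv z.1, z.2))
    (fun p : V * V => nmul p.1 p.2)).
    apply: (@cvg_pair _ _ _ (nbhs z) (nbhs (ninv z.1)) (nbhs z.2) _ _ _
      (fun z : V * V => ninv z.1) (fun z : V * V => z.2)); last exact: cvg_snd.
    by apply: (@continuous_comp _ _ _ fst ninv); [exact: cvg_fst|exact: ninv_continuous].
  exact: nmul_continuous.
have : nbhs (x, y) (f @^-1` (~` lattice)).
  apply: cf; apply: open_nbhs_nbhs; split; first by rewrite openC; exact: closed_lattice.
  move=> /lattice_cancel l; move/eqP: pq; apply.
  by rewrite -xp -yq; exact/nprojP.
move=> [[A B] /= [xA yB] AB].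
exists (nproj @` A^°, nproj @` B^°) => /=.
  by split; apply/mem_set; [exists x|exists y].
split; [by apply: nproj_open; exact: open_interior..|].
apply/eqP/seteqP; split=> // r [[u /interior_subset Au ur] [v /interior_subset Bv vr]].
apply: (AB (u, v)) => //; apply/lattice_cancel/nprojP.
by rewrite ur vr.
Qed.

Lemma nproj_second_countable : @second_countable (@nil_space R).
Proof.
have [B cB [oB bB]] := @second_countable_row R 6.
exists (image B (image^~ (@nproj R))).
  exact: sub_countable (card_image_le _ _) cB.
split=> [_ [U BU <-]|q A qA]; first by apply: nproj_open; exact: oB.
have [x xq] := nproj_surj q.
have : nbhs x (@nproj R @^-1` A) by apply: nproj_continuous; rewrite xq.
move=> /bB[U [BU Ux] UA]; exists (nproj @` U); first split.
- by exists U.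
- by exists x.
- by move=> _ [y /UA Ay <-].
Qed.

Definition unit_cube : set V := [set x | forall j, `[0, 1]%classic (x 0 j)].

Lemma nproj_unit_cube q : exists2 x, unit_cube x & nproj x = q.
Proof.
have [x <-] := nproj_surj q.
pose m j : R := - (Num.floor (x 0 j))%:~R.
(* A central entry is rounded only after adding the twisting term that the reduction [m] of the low
   entries creates. *)
pose a : V := \row_j (if up j then
  - (Num.floor (x 0 j + x 0 (lo1 j) * m (lo2 j)))%:~R else m j).
have la : lattice a.
  by move=> j; rewrite mxE; case: ifP => _; rewrite rpredN intr_int.
exists (nmul x a); last by apply/esym/nprojP; exists a.
have fl (t : R) : 0 <= t - (Num.floor t)%:~R <= 1.
  rewrite subr_ge0 floor_le /= lerBlDl ltW //.
  by have := floorD1_gt t; rewrite intrD.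
move=> j; rewrite /= in_itv /= nmulE /tw !mxE up_lo2.
by case: (up j); rewrite ?mul1r ?mul0r ?addr0 // addrAC.
Qed.

Lemma nil_compact : compact [set: @nil_space R].
Proof.
have -> : [set: @nil_space R] = nproj @` unit_cube.
  by apply/seteqP; split=> // q _; have [x ux xq] := nproj_unit_cube q; exists x.
apply: continuous_compact; first by apply: continuous_subspaceT; exact: nproj_continuous.
apply: (@rV_compact R 6 (fun=> `[0, 1]%classic)) => j.
exact: segment_compact.
Qed.

End Quotient.

(** * The nilmanifold *)

Section Nilmanifold.
Context {R : realType}.
Local Notation V := 'rV[R]_6.

Definition row_charted : charted R 6 :=
  @Charted R 6 V [set Chart setT id id].

Definition nchart (g : V) : chart R 6 (@nil_space R) :=
  Chart (nproj @` box g) (nlift g) (@nproj R).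

Definition nil_charted : charted R 6 :=
  @Charted R 6 (@nil_space R) (range nchart).

Lemma row_manifold : smooth_manifold row_charted.
Proof.
split.
- exact: norm_hausdorff.
- exact: second_countable_row.
- by move=> p; exists (Chart setT id id).
- move=> c ->; split.
  + exact: openT.
  + by rewrite /= image_id; exact: openT.
  + by [].
  + by move=> p _; exact: cvg_id.
  + by move=> p _; exact: cvg_id.
- by move=> c d p -> -> _ _ j; exact: smooth_at_coord.
Qed.

Lemma nlift_smooth (x y g : V) j : box g y -> nproj x = nproj y ->
  smooth_at (fun z => nlift g (nproj z) 0 j) x.
Proof.
move=> gy xy; have [a _ [_ e]] := nlift_near gy xy.
apply: near_eq_smooth_at (smooth_nmulr a j x).
by apply: filterS e => z ->.
Qed.

Lemma nlift_continuous (g x : V) : box g x -> {for nproj x, continuous (nlift g)}.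
Proof.
move=> gx A; rewrite /= nlift_proj // => xA.
have : nbhs x ((A `&` box g)^°).
  by apply: nbhs_interior; apply: filterI => //; exact: box_nbhs.
move=> /nbhs_singleton xAg.
have : nbhs (nproj x) (nproj @` ((A `&` box g)^°)).
  apply: open_nbhs_nbhs; split; last by exists x.
  by apply: nproj_open; exact: open_interior.
by apply: filterS => _ [z /interior_subset[Az gz] <-] /=; rewrite nlift_proj.
Qed.

Lemma nil_manifold : smooth_manifold nil_charted.
Proof.
split.
- exact: nproj_hausdorff.
- exact: nproj_second_countable.
- move=> p; have [x <-] := nproj_surj p; exists (nchart x); first by exists x.
  by exists x => //; exact: box_center.
- move=> _ [g _ <-]; split.
  + by apply: nproj_open; exact: box_open.
  + have -> : cfwd (nchart g) @` cdom (nchart g) = box g; last exact: box_open.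
    apply/seteqP; split=> [_ [_ [x gx <-] <-]|x gx] /=; first by rewrite nlift_proj.
    by exists (nproj x); [exists x|rewrite nlift_proj].
  + by move=> _ [x gx <-] /=; rewrite nlift_proj.
  + by move=> _ [x gx <-]; exact: nlift_continuous.
  + by move=> _ [x gx <-]; exact: nproj_continuous.
- move=> _ _ _ [g _ <-] [h _ <-] [x gx <-] /= [y hy yx] j.
  by rewrite nlift_proj //; exact: nlift_smooth (esym yx).
Qed.

Lemma nmul_smooth :
  @smooth_map R _ _ (prod_charted row_charted row_charted) row_charted
    (fun p => nmul p.1 p.2).
Proof.
move=> p; split; first exact: nmul_continuous.
move=> _ _ [_ [_ [-> -> ->]]] -> _ _ j /=.
have sl k z : smooth_at (fun x : 'rV[R]_(6 + 6) => lsubmx x 0 k) z.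
  have -> : (fun x : 'rV[R]_(6 + 6) => lsubmx x 0 k) = (fun x => x 0 (lshift 6 k)).
    by apply/funext => x; rewrite mxE.
  exact: smooth_at_coord.
have sr k z : smooth_at (fun x : 'rV[R]_(6 + 6) => rsubmx x 0 k) z.
  have -> : (fun x : 'rV[R]_(6 + 6) => rsubmx x 0 k) = (fun x => x 0 (rshift 6 k)).
    by apply/funext => x; rewrite mxE.
  exact: smooth_at_coord.
have -> : (fun x : 'rV[R]_(6 + 6) => nmul (lsubmx x) (rsubmx x) 0 j) =
    (fun x => lsubmx x 0 j) + (fun x => rsubmx x 0 j) +
    cst (tw j) * (fun x => lsubmx x 0 (lo1 j)) * (fun x => rsubmx x 0 (lo2 j)).
  by apply/funext => x; rewrite nmulE !fctE.
apply: smooth_atD; first exact: smooth_atD.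
by apply: smooth_atM => //; apply: smooth_atM => //; exact: smooth_at_cst.
Qed.

Lemma ninv_smooth : @smooth_map R _ _ row_charted row_charted ninv.
Proof.
move=> p; split; first exact: ninv_continuous.
by move=> _ _ -> -> _ _ j /=; exact: smooth_ninv.
Qed.

Definition nil_group : lie_group R 6 :=
  @LieGroup R 6 row_charted nmul 0 ninv row_manifold nmulA nmul0x nmulVx
    nmul_smooth ninv_smooth.

(* Precomposing with [clamp] turns a path that is continuous on [0, 1] only
   into one that is continuous everywhere. *)
Definition clamp (t : R) : R := Num.max 0 (Num.min 1 t).

Lemma clamp_id t : t \in `[0, 1] -> clamp t = t.
Proof.
by rewrite in_itv /= /clamp => /andP[t0 t1]; rewrite min_r // max_r.
Qed.

Lemma clamp_itv t : clamp t \in `[0, 1].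
Proof. by rewrite in_itv /= /clamp le_max lexx ge_max ler01 ge_min lexx. Qed.

Lemma clamp_continuous : continuous clamp.
Proof.
move=> t; apply: (@continuous_max R R (cst 0) (fun t => Num.min 1 t) t).
  exact: cst_continuous.
apply: (@continuous_min R R (cst 1) id t); first exact: cst_continuous.
exact: cvg_id.
Qed.

(** The underlying space is R^6, and loops contract along straight segments to their base point. The
    endpoints stay fixed because both equal [a 0]. *)
Lemma nil_simply_conn : simply_conn R nil_group.
Proof.
split=> [x y|a ca a01].
  exists (homot x y : R -> V); split.
  - by apply: continuous_subspaceT; exact: homot_continuous.
  - by rewrite /homot scale0r addr0.
  - by rewrite /homot scale1r addrC subrK.
have cac : continuous (fun t => a (clamp t) : V).
  move=> t A /= Aa.
  have /subspace_continuousP/(_ (clamp t) (clamp_itv t)) := ca.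
  move=> ctn.
  have {}ctn : nbhs (clamp t) [set z | `[0, 1]%classic z -> A (a z)] := ctn A Aa.
  have ctn' : nbhs t (clamp @^-1` [set z | `[0, 1]%classic z -> A (a z)]).
    exact: clamp_continuous ctn.
  apply: filterS ctn' => z /= Hz.
  exact: Hz (clamp_itv z).
pose H (z : R * R) : V := homot (a (clamp z.2)) (a 0) z.1.
exists H; split.
- apply: continuous_subspaceT => z.
  have c2 : (fun z : R * R => a (clamp z.2) : V) @ z --> (a (clamp z.2) : V).
    apply: (@continuous_comp _ _ _ snd (fun t => a (clamp t) : V)).
      exact: cvg_snd.
    exact: cac.
  apply: (@cvgD _ V); first exact: c2.
  apply: (@cvgZ _ V); first exact: cvg_fst.
  by apply: (@cvgB _ V); [exact: cvg_cst|exact: c2].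
- by move=> t t01; rewrite /H /homot /= scale0r addr0 clamp_id.
- by move=> t t01; rewrite /H /homot /= scale1r addrC subrK.
- have e0 : clamp 0 = 0 by rewrite clamp_id // in_itv /= lexx ler01.
  have e1 : clamp 1 = 1 by rewrite clamp_id // in_itv /= lexx ler01.
  move=> s _; rewrite /H /homot /= e0 e1 -a01.
  by rewrite subrr scaler0 addr0.
Qed.

Definition center : set V := [set x | forall j, up j = false -> x 0 j = 0].

Lemma central_commutes x y : center y -> nmul x y = nmul y x.
Proof.
move=> cy; apply/rowP => j; rewrite !nmulE (cy _ (up_lo1 j)) (cy _ (up_lo2 j)); ring.
Qed.

Lemma nil_nilpotent : nilpotent_group nil_group.
Proof.
exists 2%N.
have L1 : lower_central (G := nil_group) 1 `<=` center.
  move=> x /= /(_ center); apply.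
    split=> [j _|g h cg ch j uj|g cg j uj]; first by rewrite mxE.
      by rewrite /= nmulE (cg _ uj) (ch _ uj) /tw uj !mul0r !addr0.
    by rewrite /= ninvE (cg _ uj) /tw uj !mul0r oppr0 addr0.
  move=> _ [g [h [_ ->]]] j uj.
  have t0 : tw j = 0 :> R by rewrite /tw uj.
  by rewrite /lcommutator /= !nmulE !ninvE t0; ring.
apply/seteqP; split=> [x /= /(_ [set 0])|_ -> H [H1 _ _] _]; last exact: H1.
apply.
  split=> [//|_ _ -> ->|_ ->] /=; first by rewrite nmul0x.
  by rewrite ninv0.
move=> _ [g [h [Lh ->]]] /=.
have ch : center h by exact: L1.
by rewrite /lcommutator /= (central_commutes g ch) -nmulA nmulVK nmulVx.
Qed.

Lemma lattice_discrete : discrete_subgroup (G := nil_group) (@lattice R).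
Proof.
split; first by split; [exact: lattice0|exact: latticeM|exact: latticeV].
move=> x lx; split; first exact/mem_set.
exists (ball (x : V) 1); first exact: nbhsx_ballx.
apply/seteqP; split=> [y [/ball_rowP xy ly]|_ ->].
  apply/rowP => j; apply/eqP; rewrite eq_sym -subr_eq0.
  apply: contraTT (xy ltr01 j) => n0; rewrite -leNgt norm_intr_ge1 //.
  by rewrite rpredB.
by split=> //; exact: ballxx.
Qed.

Lemma nil_quotient : is_quotient (G := nil_group) (M := nil_charted) (@lattice R) (@nproj R).
Proof.
split.
- by move=> p _; have [x <-] := nproj_surj p; exists x.
- by move=> g h; rewrite nprojP /= lattice_cancel.
- move=> x; exists (box (x : V)), (nlift (x : V)); split.
  + exact: box_open.
  + exact: box_center.
  + by apply: nproj_open; exact: box_open.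
  + move=> y xy; split; first exact: nlift_proj.
    * split; first exact: nproj_continuous.
      move=> _ _ -> [g _ <-] _ [z gz zy] j.
      exact: nlift_smooth (esym zy).
    * split; first exact: nlift_continuous.
      move=> _ _ [g _ <-] -> [z gz zy] _ j /=; rewrite -zy nlift_proj //.
      exact: nlift_smooth xy zy.
Qed.

Theorem nil_nilmanifold : nilmanifold nil_charted.
Proof.
split; first by split; [exact: nil_manifold|exact: nil_compact].
exists nil_group, (@lattice R), (@nproj R); split.
- exact: nil_simply_conn.
- exact: nil_nilpotent.
- exact: lattice_discrete.
- exact: nil_quotient.
Qed.

End Nilmanifold.

(** * Smooth functions and the invariant frame *)

Section CinfTheory.
Context {R : realType} {n : nat} {M : charted R n}.
Implicit Types (f g : cinf M) (p : M).

Lemma cinf_eq f g : (forall p, f p = g p) -> f = g.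
Proof. by move=> fg; apply/val_inj/funext. Qed.

Lemma cinfD f g p : (f + g) p = f p + g p. Proof. by []. Qed.
Lemma cinfN f p : (- f) p = - f p. Proof. by []. Qed.
Lemma cinfM f g p : (f * g) p = f p * g p. Proof. by []. Qed.
Lemma cinfZ (a : R) f p : (a *: f) p = a * f p. Proof. by []. Qed.
Lemma cinf0 p : (0 : cinf M) p = 0. Proof. by []. Qed.
Lemma cinf1 p : (1 : cinf M) p = 1. Proof. by []. Qed.

Lemma cinf_nat (m : nat) p : (m%:R : cinf M) p = m%:R.
Proof. by elim: m => [//|m IH]; rewrite [in LHS]mulrS [in RHS]mulrS cinfD IH. Qed.

Lemma cinf_sum (I : Type) (r : seq I) (P : pred I) (F : I -> cinf M) p :
  (\sum_(i <- r | P i) F i) p = \sum_(i <- r | P i) F i p.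
Proof.
by apply: (big_morph (fun f : cinf M => f p)).
Qed.

Definition cinfE := (cinfD, cinfN, cinfM, cinfZ, cinf0, cinf1, cinf_sum).

Lemma vfield_sum (X : vfield M) (I : Type) (r : seq I) (F : I -> cinf M) :
  X (\sum_(i <- r) F i) = \sum_(i <- r) X (F i).
Proof. exact: (big_morph X (vfieldD X) (vfield0 X)). Qed.

Lemma vfield1 (X : vfield M) : X 1 = 0.
Proof.
have := vfieldM X 1 1; rewrite !mul1r => /eqP.
by rewrite -subr_eq subrr => /eqP.
Qed.

Lemma vfield_cst (X : vfield M) (a : R) : X (a *: (1 : cinf M)) = 0.
Proof. by rewrite vfieldZ vfield1 scaler0. Qed.

End CinfTheory.

Section NilFunctions.
Context {R : realType}.
Local Notation V := 'rV[R]_6.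
Local Notation M := (@nil_charted R).
Local Notation pr := (@nproj R).
Implicit Types (x y z : V) (f : cinf M) (k l : 'I_6).

Lemma is_cinfP (f : M -> R) : is_cinf f <-> forall x, smooth_at (f \o pr) x.
Proof.
split=> [sf x|sf _ p [g _ <-] [x gx <-]] /=; last first.
  by rewrite nlift_proj //; exact: sf.
have := sf (nchart x) (pr x); rewrite /= nlift_proj; last exact: box_center.
by apply; [exists x|exists x => //; exact: box_center].
Qed.

Lemma cinf_smooth f x : smooth_at (f \o pr) x.
Proof.
case: f => f /= fc; have /asboolP := fc.
by move=> /is_cinfP; exact.
Qed.

Lemma cinf_of_inv (F : V -> R) : (forall x, smooth_at F x) ->
  (forall x a, lattice a -> F (nmul x a) = F x) ->
  exists f : cinf M, forall x, f (pr x) = F x.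
Proof.
move=> sF iF; pose f (q : M) := F (repr (q : @nil_space R)).
have fE x : f (pr x) = F x.
  have /nprojP[a la e] : pr (repr (pr x)) = pr x by exact: reprK.
  by rewrite /f [in RHS]e iF.
have fc : f \in @cinf_pred R 6 M.
  apply/asboolP/is_cinfP => x.
  by have -> : f \o pr = F by apply/funext => z; exact: fE.
by exists (Cinf fc).
Qed.

(* [wvec l x] is the velocity at [x] of left translation by the [l]-th
   one-parameter subgroup. It commutes with right translations, so it descends
   to the space of left cosets. *)
Definition wvec l x : V :=
  \row_k ((k == l)%:R + tw k * (lo1 k == l)%:R * x 0 (lo2 k)).

Lemma wvecE l x k :
  wvec l x 0 k = (k == l)%:R + tw k * (lo1 k == l)%:R * x 0 (lo2 k).
Proof. by rewrite mxE. Qed.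

(** Right translation is affine in these coordinates, so the identity is exact and not merely of
    first order; difference quotients can then be compared term by term. *)
Lemma wvec_nmul l x a (h : R) :
  h *: wvec l (nmul x a) + nmul x a = nmul (h *: wvec l x + x) a.
Proof.
apply/rowP => k; rewrite !mxE !tw_lo1 !tw_lo2.
ring.
Qed.

Lemma derive_wvec_inv (F : V -> R) l x a :
  (forall y, F (nmul y a) = F y) ->
  'D_(wvec l (nmul x a)) F (nmul x a) = 'D_(wvec l x) F x.
Proof.
move=> iF; suff e : (fun h : R => h^-1 *: ((F \o shift (nmul x a))
    (h *: wvec l (nmul x a)) - F (nmul x a))) =
    (fun h : R => h^-1 *: ((F \o shift x) (h *: wvec l x) - F x)).
  by rewrite /derive e.
by apply/funext => h /=; rewrite wvec_nmul !iF.
Qed.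

Lemma derive_wvec_smooth (F : V -> R) l : (forall x, smooth_at F x) ->
  forall x, smooth_at (fun y => 'D_(wvec l y) F y) x.
Proof.
move=> sF x.
have -> : (fun y => 'D_(wvec l y) F y) =
    \sum_k (fun y => wvec l y 0 k) * pderiv k F.
  apply/funext => y; rewrite derive_pderiv; last exact: smooth_at_differentiable.
  by rewrite fct_sumE.
apply: smooth_at_sum => k _; apply: smooth_atM; last exact: smooth_at_pderiv.
have -> : (fun y => wvec l y 0 k) = cst (k == l)%:R +
    cst (tw k * (lo1 k == l)%:R) * (fun y : V => y 0 (lo2 k)).
  by apply/funext => y; rewrite wvecE.
by apply: smooth_atD; [|apply: smooth_atM]; first [exact: smooth_at_coord|exact: smooth_at_cst].
Qed.

Lemma lift_inv f x a : lattice a -> (f \o pr) (nmul x a) = (f \o pr) x.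
Proof. by move=> la /=; congr (f _); apply/esym/nprojP; exists a. Qed.

Lemma frame_ex l f : exists g : cinf M,
  forall x, g (pr x) = 'D_(wvec l x) (f \o pr) x.
Proof.
apply: cinf_of_inv; first by apply: derive_wvec_smooth; exact: cinf_smooth.
by move=> x a la; apply: derive_wvec_inv => y; exact: lift_inv.
Qed.

Definition frame_fun l f : cinf M := sval (cid (frame_ex l f)).

Lemma frame_funE l f x : frame_fun l f (pr x) = 'D_(wvec l x) (f \o pr) x.
Proof. exact: (svalP (cid (frame_ex l f))). Qed.

Lemma nil_cinf_eq (f g : cinf M) : (forall x, f (pr x) = g (pr x)) -> f = g.
Proof. by move=> fg; apply: cinf_eq => p; have [x <-] := nproj_surj p. Qed.

Lemma cinf_differentiable f x : differentiable (f \o pr) x.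
Proof. exact/smooth_at_differentiable/cinf_smooth. Qed.

Lemma frame_derivation l : frame_fun l \in @derivation_pred R 6 M.
Proof.
have dv f x v : derivable (f \o pr) x v.
  by apply: diff_derivable; exact: cinf_differentiable.
apply/asboolP; split=> [a f g|f g]; apply: nil_cinf_eq => x;
  rewrite !cinfE !frame_funE.
  have -> : (a *: f + g) \o pr = a *: (f \o pr) + (g \o pr) by [].
  by rewrite deriveD ?deriveZ //; exact: derivableZ.
have -> : (f * g) \o pr = (f \o pr) * (g \o pr) by [].
by rewrite deriveM.
Qed.

Definition frame l : vfield M := VField (frame_derivation l).

Lemma frameE l f x : frame l f (pr x) = 'D_(wvec l x) (f \o pr) x.
Proof. exact: frame_funE. Qed.

End NilFunctions.

(** * The dual coframe *)

Section DualFrame.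
Context {R : realType}.
Local Notation V := 'rV[R]_6.
Local Notation M := (@nil_charted R).
Local Notation pr := (@nproj R).
Implicit Types (g x y z : V) (f : cinf M) (X : vfield M) (k l : 'I_6).

(** Positive exactly on the open Euclidean ball of radius 1/4 about [g]. The cube [small_box] around
    this ball is compact and lies inside [box g], which leaves room for extension by zero. *)
Definition chi g x : R := flat 0 (4^-1 ^+ 2 - \sum_k (x 0 k - g 0 k) ^+ 2).

Lemma chi_smooth g x : smooth_at (chi g) x.
Proof.
have -> : chi g = flat 0 \o (cst (4^-1 ^+ 2) - \sum_k
    ((fun x : V => x 0 k) + cst (- g 0 k)) * ((fun x : V => x 0 k) + cst (- g 0 k))).
  apply/funext => y; rewrite /chi /= !fctE fct_sumE; congr (flat _ (_ - _)).
apply: smooth_at_flat; apply: smooth_atD; first exact: smooth_at_cst.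
apply: smooth_atN; apply: smooth_at_sum => k _.
by apply: smooth_atM; apply: smooth_atD;
  first [exact: smooth_at_coord|exact: smooth_at_cst].
Qed.

Lemma chi_center g : 0 < chi g g.
Proof.
rewrite /chi big1 => [|k _]; last by rewrite subrr expr0n.
rewrite subr0 /flat ifT; first by rewrite expr0 mul1r expR_gt0.
by rewrite exprn_gt0 // invr_gt0.
Qed.

Definition small_box g : set V :=
  [set x | forall k, `[g 0 k - 4^-1, g 0 k + 4^-1]%classic (x 0 k)].

Lemma chi_supp g x : chi g x != 0 -> small_box g x.
Proof.
rewrite /chi /flat; case: ifPn; last by rewrite eqxx.
rewrite subr_gt0 => lt _ k; rewrite /= in_itv /=.
have : `|x 0 k - g 0 k| <= 4^-1.
  rewrite -(@ler_pXn2r _ 2) ?nnegrE // -?normrX ?invr_ge0 // ger0_norm ?sqr_ge0 //.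
  apply: le_trans (ltW lt); rewrite (bigD1 k) //= lerDl.
  by apply: sumr_ge0 => i _; exact: sqr_ge0.
by rewrite ler_distl.
Qed.

Lemma small_box_box g : small_box g `<=` box g.
Proof.
move=> x gx; apply/ball_rowP; first exact: half_gt0.
move=> k; have := gx k; rewrite /= in_itv /= -ler_distl distrC => /le_lt_trans; apply.
by rewrite ltf_pV2 ?posrE // ltr_nat.
Qed.

Lemma small_box_compact g : compact (small_box g).
Proof.
apply: (@rV_compact R 6 (fun k => `[g 0 k - 4^-1, g 0 k + 4^-1]%classic)) => k.
exact: segment_compact.
Qed.

(** On the image of the box the function is locally a translate of [chi g * v]. At a point outside,
    it vanishes nearby: the image of [small_box] is compact, hence closed in the Hausdorff quotient,
    and contains all points where the function is nonzero. *)
Lemma bump_ext g (v : V -> R) : (forall x, smooth_at v x) ->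
  exists f : cinf M, (forall x, box g x -> f (pr x) = chi g x * v x) /\
    forall p, ~ (pr @` box g) p -> f p = 0.
Proof.
move=> sv; pose B := pr @` box g; pose K := pr @` small_box g.
pose f (p : M) : R := if `[< B p >] then chi g (nlift g p) * v (nlift g p) else 0.
have fB x : box g x -> f (pr x) = chi g x * v x.
  move=> gx; rewrite /f ifT ?nlift_proj //.
  by apply/asboolP; exists x.
have fN p : ~ B p -> f p = 0 by move=> Bp; rewrite /f ifF //; apply/asboolP.
suff fc : f \in @cinf_pred R 6 M by exists (Cinf fc).
apply/asboolP/is_cinfP => x.
have [[y gy yx]|Bx] := EM (B (pr x)).
  have [a _ [xa near_a]] := nlift_near gy (esym yx).
  have : smooth_at ((chi g * v) \o (nmul^~ a)) x.
    apply: smooth_at_comp => [k|]; first exact: smooth_nmulr.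
    by apply: smooth_atM => //; exact: chi_smooth.
  apply: near_eq_smooth_at.
  have Bo : nbhs x (pr @^-1` B).
    apply: nproj_continuous; apply: open_nbhs_nbhs; split; last by exists y.
    by apply: nproj_open; exact: box_open.
  near=> z.
  have [w gw wz] : B (pr z) by near: z.
  rewrite /= -wz fB // -(nlift_proj gw) wz.
  by have -> : nlift g (pr z) = nmul z a by near: z.
have Kc : closed K.
  apply: compact_closed; first exact: nproj_hausdorff.
  apply: continuous_compact; last exact: small_box_compact.
  by apply: continuous_subspaceT; exact: nproj_continuous.
apply: near_eq_smooth_at (smooth_at_cst 0 x).
have Ko : nbhs x (pr @^-1` (~` K)).
  apply: nproj_continuous; apply: open_nbhs_nbhs; split; first by rewrite openC.
  by move=> [y /small_box_box gy yx]; apply: Bx; exists y.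
apply: filterS Ko => z /= Kz.
have [[w gw wz]|] := EM (B (pr z)); last by move/fN ->.
rewrite -wz fB //; have [->|/chi_supp sw] := eqVneq (chi g w) 0; first by rewrite mul0r.
by case: Kz; exists w.
Unshelve. all: by end_near. Qed.

(* Hadamard's lemma at [y], multiplied by the square of a bump function so that
   every factor extends to the quotient. *)
Lemma vf_coord X y : exists d : 'I_6 -> R,
  forall f, X f (pr y) = \sum_k d k * pderiv k (f \o pr) y.
Proof.
have s1 x : smooth_at (cst 1 : V -> R) x by exact: smooth_at_cst.
have [c [cB cN]] := bump_ext y s1.
have sx k x : smooth_at ((fun x : V => x 0 k) + cst (- y 0 k)) x.
  by apply: smooth_atD; [exact: smooth_at_coord|exact: smooth_at_cst].
have /choice[a aP] k := bump_ext y (sx k).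
have by_ := box_center y.
exists (fun k => X (a k) (pr y) / chi y y) => f.
pose F := f \o pr.
have sg k x : smooth_at (pint 0 y (pderiv k F)) x.
  by apply: smooth_at_pint => z; apply: smooth_at_pderiv; exact: cinf_smooth.
have /choice[b bP] k := bump_ext y (sg k).
have E : c * c * (f - F y *: (1 : cinf M)) = \sum_k a k * b k.
  apply: cinf_eq => p; rewrite !cinfE.
  have [[x yx <-]|Np] := EM ((pr @` box y) p); last first.
    by rewrite cN // !mul0r big1 // => k _; rewrite cinfE (aP k).2 // mul0r.
  rewrite (cB x) //.
  have -> : f (pr x) = F y + \sum_k (x 0 k - y 0 k) * pint 0 y (pderiv k F) x.
    exact: (hadamard y x (cinf_smooth f)).
  rewrite mulr1 [F y + _]addrC addrK.
  rewrite mulr_sumr; apply: eq_bigr => k _.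
  by rewrite cinfE (aP k).1 // (bP k).1 // !fctE /=; ring.
have cy : c (pr y) = chi y y by rewrite cB // mulr1.
have ch0 := chi_center y.
have := congr1 (fun h : cinf M => X h (pr y)) E.
rewrite /= vfieldM vfieldB vfield_cst subr0 vfield_sum !cinfE.
rewrite -[f (pr y)]/(F y) mulr1 subrr mul0r addr0 cy => E2.
apply: (mulfI (lt0r_neq0 ch0)); apply: (mulfI (lt0r_neq0 ch0)).
rewrite mulrA E2 !mulr_sumr; apply: eq_bigr => k _.
rewrite vfieldM !cinfE (aP k).1 // (bP k).1 // !fctE subrr mulr0 mul0r add0r.
rewrite pint_center; field.
exact: lt0r_neq0.
Qed.

Lemma sum_wvec (t : 'I_6 -> R) y k :
  \sum_l t l * wvec l y 0 k = t k + tw k * y 0 (lo2 k) * t (lo1 k).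
Proof.
under eq_bigr do rewrite wvecE mulrDr.
rewrite big_split /= sum_delta; congr (_ + _).
rewrite -(sum_delta t (lo1 k)) mulr_sumr; apply: eq_bigr => l _; ring.
Qed.

(** The matrix of the frame is the identity plus a matrix of square zero ([lo1] is never central),
    so its inverse differs only in the sign of the second term. *)
Lemma frame_sum (d : 'I_6 -> R) y f :
  \sum_k d k * pderiv k (f \o pr) y =
  \sum_k (d k - tw k * y 0 (lo2 k) * d (lo1 k)) * frame k f (pr y).
Proof.
have df := cinf_differentiable f y.
under [RHS]eq_bigr do rewrite frameE (derive_pderiv _ df) mulr_sumr.
rewrite exchange_big /=; apply: eq_bigr => k _.
under eq_bigr do rewrite mulrA.
rewrite -mulr_suml; congr (_ * _).
by rewrite sum_wvec tw_lo1; ring.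
Qed.

Lemma vf_frame_pt X (p : M) : exists t : 'I_6 -> R,
  forall f, X f p = \sum_k t k * frame k f p.
Proof.
have [y <-] := nproj_surj p; have [d dE] := vf_coord X y.
exists (fun k => d k - tw k * y 0 (lo2 k) * d (lo1 k)) => f.
by rewrite dE frame_sum.
Qed.

Definition theta_fun X k (p : M) : R := sval (cid (vf_frame_pt X p)) k.

Lemma theta_funE X f p : X f p = \sum_k theta_fun X k p * frame k f p.
Proof. exact: (svalP (cid (vf_frame_pt X p))). Qed.

(* Evaluating on a bump function [c = chi] and on [a k = chi * x_k] recovers the
   coefficients of a derivation near [g]; the formula is smooth in [y]. *)
Lemma frame_recover g : exists (c : cinf M) (a : 'I_6 -> cinf M),
  forall y (D : cinf M -> R) (t : 'I_6 -> R), box g y -> chi g y != 0 ->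
    (forall f, D f = \sum_l t l * frame l f (pr y)) ->
    forall k, t k = (D (a k) - y 0 k * D c) / chi g y -
      tw k * y 0 (lo2 k) * ((D (a (lo1 k)) - y 0 (lo1 k) * D c) / chi g y).
Proof.
have s1 x : smooth_at (cst 1 : V -> R) x by exact: smooth_at_cst.
have [c [cB _]] := bump_ext g s1.
have sx k x : smooth_at (fun x : V => x 0 k) x by exact: smooth_at_coord.
have /choice[a aP] k := bump_ext g (sx k).
exists c, a => y D t gy ch0 DE.
have H k : (D (a k) - y 0 k * D c) / chi g y = t k + tw k * y 0 (lo2 k) * t (lo1 k).
  apply: (canLR (mulfK ch0)); rewrite -sum_wvec mulr_suml !DE mulr_sumr -sumrB.
  apply: eq_bigr => l _; rewrite !frameE.
  have nb := box_nbhs gy.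
  have -> : 'D_(wvec l y) (c \o pr) y = 'D_(wvec l y) (chi g) y.
    by apply: near_eq_derive; apply: filterS nb => z gz /=; rewrite cB // mulr1.
  have -> : 'D_(wvec l y) (a k \o pr) y = 'D_(wvec l y) (chi g * (fun x : V => x 0 k)) y.
    by apply: near_eq_derive; apply: filterS nb => z gz /=; rewrite (aP k).1.
  have dc := smooth_at_differentiable (chi_smooth g y).
  have dk : differentiable (fun x : V => x 0 k) y by exact: differentiable_coord.
  rewrite deriveM; [|exact: diff_derivable..].
  rewrite derive_coord /GRing.scale /=; ring.
by move=> k; rewrite !H tw_lo1; ring.
Qed.

(** [theta_fun] is chosen separately at each point, but near [y] the coefficients are forced to be
    those of [frame_recover], an expression smooth where [chi y] does not vanish. *)
Lemma theta_cinf X k : theta_fun X k \in @cinf_pred R 6 M.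
Proof.
apply/asboolP/is_cinfP => y.
have [c [a recover]] := frame_recover y.
pose A j := ((X (a j) \o pr) - (fun z : V => z 0 j) * (X c \o pr)) * (fun z => (chi y z)^-1).
have sA j : smooth_at (A j) y.
  apply: smooth_atM; last first.
    by apply: smooth_at_inv; [exact: chi_smooth|rewrite gt_eqF // chi_center].
  apply: smooth_atD; first exact: cinf_smooth.
  by apply/smooth_atN/smooth_atM; [exact: smooth_at_coord|exact: cinf_smooth].
have : smooth_at (A k - cst (tw k) * (fun z : V => z 0 (lo2 k)) * A (lo1 k)) y.
  apply: smooth_atD => //; apply: smooth_atN; apply: smooth_atM => //.
  by apply: smooth_atM; [exact: smooth_at_cst|exact: smooth_at_coord].
apply: near_eq_smooth_at.
have chn : \forall z \near y, chi y z != 0.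
  have cc := smooth_at_continuous (chi_smooth y y).
  have : nbhs y (chi y @^-1` [set t | 0 < t]).
    exact: cc _ (lt_nbhsr (chi_center y)).
  by apply: filterS => z /= h; rewrite gt_eqF.
near=> z.
have gz : box y z by near: z; apply: box_nbhs; exact: box_center.
have cz : chi y z != 0 by near: z.
have := recover z (fun f => X f (pr z)) (fun k => theta_fun X k (pr z)) gz cz
  (fun f => theta_funE X f (pr z)) k.
by move=> /= ->.
Unshelve. all: by end_near. Qed.

Definition theta k X : cinf M := Cinf (theta_cinf X k).

Lemma vf_frame X f : X f = \sum_k theta k X * frame k f.
Proof.
by apply: cinf_eq => p; rewrite cinfE theta_funE; apply: eq_bigr => k _; rewrite cinfE.
Qed.

Lemma theta_unique X (t : 'I_6 -> cinf M) :
  (forall f, X f = \sum_k t k * frame k f) -> forall k, theta k X = t k.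
Proof.
move=> Xt k; apply: nil_cinf_eq => y.
have [c [a recover]] := frame_recover y.
have r (s : 'I_6 -> cinf M) : (forall f, X f = \sum_k s k * frame k f) ->
    s k (pr y) = (X (a k) (pr y) - y 0 k * X c (pr y)) / chi y y -
      tw k * y 0 (lo2 k) * ((X (a (lo1 k)) (pr y) - y 0 (lo1 k) * X c (pr y)) / chi y y).
  move=> Xs; apply: (recover y (fun f => X f (pr y)) (fun k => s k (pr y))).
  - exact: box_center.
  - by rewrite gt_eqF // chi_center.
  - by move=> f; rewrite Xs cinfE; apply: eq_bigr => l _; rewrite cinfE.
by rewrite (r _ Xt) (r (theta^~ X)) //; exact: vf_frame.
Qed.

End DualFrame.

(** * Structure equations *)

(* Unification otherwise unfolds the choice operators in these definitions. *)
Opaque frame theta.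

Section Structure.
Context {R : realType}.
Local Notation V := 'rV[R]_6.
Local Notation M := (@nil_charted R).
Local Notation pr := (@nproj R).
Implicit Types (x y z : V) (f : cinf M) (X Y : vfield M) (i j k l : 'I_6).

Lemma frame_pderiv l f x :
  frame l f (pr x) = \sum_k wvec l x 0 k * pderiv k (f \o pr) x.
Proof. by rewrite frameE derive_pderiv //; exact: cinf_differentiable. Qed.

Lemma tw_lo1_eq k m : tw k * (lo1 m == k)%:R = 0 :> R.
Proof. by case: eqVneq => [<-|_]; rewrite ?tw_lo1 ?mul0r ?mulr0. Qed.

Lemma tw_lo2_eq k m : tw k * (lo2 m == k)%:R = 0 :> R.
Proof. by case: eqVneq => [<-|_]; rewrite ?tw_lo2 ?mul0r ?mulr0. Qed.

(** The factor [tw k] confines the equation to central indices; there the frame field is the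
    coordinate field. *)
Lemma frame_up k f x : tw k * frame k f (pr x) = tw k * pderiv k (f \o pr) x.
Proof.
rewrite frame_pderiv mulr_sumr -(sum_delta (fun l => tw l * pderiv l (f \o pr) x) k).
apply: eq_bigr => l _; rewrite wvecE eq_sym.
have e0 := tw_lo1_eq k l.
transitivity (tw k * (k == l)%:R * pderiv l (f \o pr) x +
  tw k * (lo1 l == k)%:R * (tw l * x 0 (lo2 l) * pderiv l (f \o pr) x)); first by ring.
by rewrite e0 mul0r addr0; case: eqVneq => [->|_] /=; ring.
Qed.

Lemma pderiv_frame m j f x :
  pderiv m (frame j f \o pr) x =
  \sum_k wvec j x 0 k * pderiv m (pderiv k (f \o pr)) x +
  \sum_k tw k * (lo1 k == j)%:R * (lo2 k == m)%:R * frame k f (pr x).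
Proof.
pose w k := cst (k == j)%:R + cst (tw k * (lo1 k == j)%:R) * (fun y : V => y 0 (lo2 k)).
have sw k y : smooth_at (w k) y.
  by apply: smooth_atD; [|apply: smooth_atM];
    first [exact: smooth_at_coord|exact: smooth_at_cst].
have sF k y : smooth_at (pderiv k (f \o pr)) y.
  by apply: smooth_at_pderiv; exact: cinf_smooth.
have -> : frame j f \o pr = \sum_k w k * pderiv k (f \o pr).
  apply/funext => y; rewrite /= frame_pderiv fct_sumE; apply: eq_bigr => k _.
  by rewrite wvecE.
rewrite pderiv_sum => [|k]; last exact: smooth_atM.
rewrite -big_split; apply: eq_bigr => k _.
rewrite pderivM; [|exact: smooth_at_differentiable..].
congr (_ + _); first by rewrite wvecE.
rewrite /w pderivD; [|exact: differentiable_cst|]; last first.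
  by apply: smooth_at_differentiable; apply: smooth_atM;
    [exact: smooth_at_cst|exact: smooth_at_coord].
rewrite pderivM; [|exact: differentiable_cst|exact: differentiable_coord].
rewrite !pderiv_cst pderiv_coord mulr0 add0r addr0 /cst /=.
transitivity ((lo1 k == j)%:R * (lo2 k == m)%:R * (tw k * pderiv k (f \o pr) x)).
  by ring.
by rewrite -frame_up; ring.
Qed.

(** The structure constants of the frame, for instance [E_0, E_1] = - E_3. The sign agrees with d e3
    = e0 /\ e1, since d alpha(X, Y) contains - alpha([X, Y]). *)
Definition struct_cst i j m : R :=
  tw m * ((lo1 m == j)%:R * (lo2 m == i)%:R - (lo1 m == i)%:R * (lo2 m == j)%:R).

(** Second-order terms cancel by symmetry of mixed partials; what remains comes from differentiating
    the coefficients of [wvec]. *)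
Lemma frame_comm i j f x :
  frame i (frame j f) (pr x) - frame j (frame i f) (pr x) =
  \sum_m struct_cst i j m * frame m f (pr x).
Proof.
have H a b : frame a (frame b f) (pr x) =
    \sum_m \sum_k wvec a x 0 m * wvec b x 0 k * pderiv m (pderiv k (f \o pr)) x +
    \sum_m tw m * ((lo1 m == b)%:R * (lo2 m == a)%:R) * frame m f (pr x).
  rewrite frame_pderiv.
  under eq_bigr do rewrite pderiv_frame mulrDr.
  rewrite big_split /=; congr (_ + _).
    by apply: eq_bigr => m _; rewrite mulr_sumr; apply: eq_bigr => k _; rewrite mulrA.
  under eq_bigr do rewrite mulr_sumr.
  rewrite exchange_big /=; apply: eq_bigr => k _.
  transitivity (\sum_m (tw k * (lo1 k == b)%:R * frame k f (pr x) * wvec a x 0 m) *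
      (lo2 k == m)%:R).
    by apply: eq_bigr => m _; ring.
  rewrite sum_delta wvecE tw_lo2; ring.
apply: etrans (congr2 (fun a b => a - b) (H i j) (H j i)) _.
have -> : \sum_m \sum_k wvec i x 0 m * wvec j x 0 k * pderiv m (pderiv k (f \o pr)) x =
  \sum_m \sum_k wvec j x 0 m * wvec i x 0 k * pderiv m (pderiv k (f \o pr)) x.
  rewrite exchange_big; apply: eq_bigr => k _; apply: eq_bigr => m _.
  by rewrite schwarz; [ring|exact: cinf_smooth].
rewrite opprD addrACA subrr add0r -sumrB; apply: eq_bigr => m _.
by rewrite /struct_cst; ring.
Qed.

Lemma theta_frame i k : theta k (frame i) = (k == i)%:R *: (1 : cinf M).
Proof.
apply: (@theta_unique R (frame i) (fun k => (k == i)%:R *: (1 : cinf M))) => f.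
apply: cinf_eq => p; rewrite cinfE.
under eq_bigr do rewrite !cinfE mulr1 mulrC eq_sym.
by rewrite sum_delta.
Qed.

Lemma theta_linear k (f : cinf M) X Y :
  theta k (fscale f X + Y) = f * theta k X + theta k Y.
Proof.
apply: (@theta_unique R _ (fun k => f * theta k X + theta k Y)) => g.
rewrite -[LHS]/(f * X g + Y g) !vf_frame mulr_sumr -big_split.
by apply: eq_bigr => l _ /=; rewrite mulrDl mulrA.
Qed.

(** The structure equation d e_m = e_lo1 /\ e_lo2 at central m, and d e_m = 0 otherwise, solved for
    the bracket term. It follows by expanding both fields in the frame and using [frame_comm]. *)
Lemma theta_bracket m X Y : theta m (bracket X Y) =
  X (theta m Y) - Y (theta m X) -
  tw m *: (theta (lo1 m) X * theta (lo2 m) Y - theta (lo2 m) X * theta (lo1 m) Y).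
Proof.
apply: (@theta_unique R _ (fun m => X (theta m Y) - Y (theta m X) -
  tw m *: (theta (lo1 m) X * theta (lo2 m) Y - theta (lo2 m) X * theta (lo1 m) Y))) => f.
apply: nil_cinf_eq => x; set p := pr x.
rewrite -[LHS]/(X (Y f) p - Y (X f) p).
have H (A B : vfield M) : A (B f) p = \sum_k A (theta k B) p * frame k f p +
    \sum_i \sum_j theta i A p * theta j B p * frame i (frame j f) p.
  rewrite (vf_frame B) vfield_sum cinfE.
  under eq_bigr do rewrite vfieldM !cinfE addrC mulrC.
  rewrite big_split /=; congr (_ + _).
  rewrite exchange_big; apply: eq_bigr => j _.
  rewrite (vf_frame A) cinfE mulr_sumr; apply: eq_bigr => i _; rewrite cinfE.
  by ring.
apply: etrans (congr2 (fun a b => a - b) (H X Y) (H Y X)) _.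
have -> : \sum_i \sum_j theta i Y p * theta j X p * frame i (frame j f) p =
   \sum_i \sum_j theta i X p * theta j Y p * frame j (frame i f) p.
  rewrite [LHS]exchange_big; apply: eq_bigr => i _; apply: eq_bigr => j _.
  by congr (_ * _); exact: mulrC.
rewrite opprD addrACA -!sumrB.
have -> : \sum_i (\sum_j theta i X p * theta j Y p * frame i (frame j f) p -
    \sum_j theta i X p * theta j Y p * frame j (frame i f) p) =
  \sum_m (- tw m * (theta (lo1 m) X p * theta (lo2 m) Y p -
    theta (lo2 m) X p * theta (lo1 m) Y p)) * frame m f p.
  transitivity (\sum_i \sum_j \sum_m theta i X p * theta j Y p *
      (struct_cst i j m * frame m f p)).
    apply: eq_bigr => i _; rewrite -sumrB; apply: eq_bigr => j _.
    by rewrite -mulrBr frame_comm mulr_sumr.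
  under eq_bigr do rewrite exchange_big.
  rewrite exchange_big; apply: eq_bigr => k _ /=.
  have -> : theta (lo1 k) X p * theta (lo2 k) Y p - theta (lo2 k) X p * theta (lo1 k) Y p =
     \sum_i \sum_j theta i X p * theta j Y p *
      ((lo1 k == i)%:R * (lo2 k == j)%:R - (lo1 k == j)%:R * (lo2 k == i)%:R).
    have S (a b : 'I_6) : theta a X p * theta b Y p =
        \sum_i \sum_j theta i X p * theta j Y p * ((a == i)%:R * (b == j)%:R).
      rewrite -(sum_delta (fun i => theta i X p * theta b Y p) a).
      apply: eq_bigr => i _.
      rewrite -(sum_delta (fun j => theta i X p * theta j Y p) b) mulr_suml.
      by apply: eq_bigr => j _; ring.
    rewrite !S -sumrB; apply: eq_bigr => i _; rewrite -sumrB; apply: eq_bigr => j _.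
    ring.
  rewrite mulr_sumr mulr_suml; apply: eq_bigr => i _.
  rewrite mulr_sumr mulr_suml; apply: eq_bigr => j _.
  rewrite /struct_cst; ring.
rewrite -big_split cinfE; apply: eq_bigr => m' _; rewrite !cinfE /=.
ring.
Qed.

End Structure.

(** * Alternating sums and powers of a two-form *)

Section Permutations.
Context {A : nmodType}.

Lemma lift_perm0_bij n :
  bijective (fun p : 'I_n.+1 * 'S_n => lift_perm ord0 p.1 p.2).
Proof.
apply: inj_card_bij => [[i s] [j t] /= e|]; last first.
  by rewrite card_prod card_ord !card_Sn factS.
have ij : i = j.
  by have := congr1 (fun u : 'S_n.+1 => u ord0) e; rewrite /= !lift_perm_id.
congr (_, _) => //; apply/permP => k; apply: (@lift_inj _ i).
rewrite -(@lift_perm_lift _ ord0 i s) {2}ij -(@lift_perm_lift _ ord0 j t).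
by rewrite -e.
Qed.

Lemma sum_perm_lift n (F : 'S_n.+1 -> A) :
  \sum_s F s = \sum_i \sum_(s : 'S_n) F (lift_perm ord0 i s).
Proof.
have [g gK Kg] := lift_perm0_bij n.
by rewrite (reindex _ (onW_bij _ (Bijective gK Kg))) pair_bigA.
Qed.

Lemma sum_perm0 (F : 'S_0 -> A) : \sum_s F s = F 1%g.
Proof.
rewrite (bigD1 (1%g : {perm 'I_0})) //= big1 ?addr0 // => s.
by case/eqP; apply/permP; case.
Qed.

End Permutations.

Section Alternation.
Context {A : comPzRingType}.

(** As in a Laplace expansion: fixing the value [i] at 0 leaves a smaller permutation and the sign
    (-1)^i. Iteration evaluates the sums over S_2, S_3 and S_4 that occur in the exterior powers. *)
Lemma alt_sum_lift n (F : 'S_n.+1 -> A) :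
  \sum_(s : 'S_n.+1) (-1) ^+ s * F s =
  \sum_(i < n.+1) (-1) ^+ i * \sum_(s : 'S_n) (-1) ^+ s * F (lift_perm ord0 i s).
Proof.
rewrite sum_perm_lift; apply: eq_bigr => i _; rewrite mulr_sumr.
apply: eq_bigr => s _; rewrite mulrA odd_lift_perm; congr (_ * _).
by rewrite /= signr_addb signr_odd.
Qed.

Lemma alt_sum2 (G : nat -> nat -> A) :
  \sum_(s : 'S_2) (-1) ^+ s * G (s ord0) (s (lift ord0 ord0)) = G 0 1 - G 1 0.
Proof.
rewrite alt_sum_lift !big_ord_recl big_ord0 !alt_sum_lift !big_ord_recl !big_ord0 !sum_perm0.
rewrite !lift_perm_id !lift_perm_lift !lift_perm_id !odd_perm1 /= /bump /=.
by rewrite !expr0 !expr1 !mul1r mulN1r !addr0.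
Qed.

Lemma alt_sum3 (G : nat -> nat -> nat -> A) :
  \sum_(s : 'S_3) (-1) ^+ s * G (s ord0) (s (lift ord0 ord0))
    (s (lift ord0 (lift ord0 ord0))) =
  G 0 1 2 - G 0 2 1 - G 1 0 2 + G 1 2 0 + G 2 0 1 - G 2 1 0.
Proof.
rewrite alt_sum_lift.
under eq_bigr => i _.
  under eq_bigr do rewrite lift_perm_id !lift_perm_lift /=.
  rewrite (alt_sum2 (fun a b => G i (bump i a) (bump i b))).
  over.
by rewrite !big_ord_recl big_ord0 /= /bump /=; ring.
Qed.

Lemma alt_sum4 (G : nat -> nat -> nat -> nat -> A) :
  \sum_(s : 'S_4) (-1) ^+ s * G (s ord0) (s (lift ord0 ord0))
    (s (lift ord0 (lift ord0 ord0))) (s (lift ord0 (lift ord0 (lift ord0 ord0)))) =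
  (G 0 1 2 3 - G 0 1 3 2 - G 0 2 1 3 + G 0 2 3 1 + G 0 3 1 2 - G 0 3 2 1)
  - (G 1 0 2 3 - G 1 0 3 2 - G 1 2 0 3 + G 1 2 3 0 + G 1 3 0 2 - G 1 3 2 0)
  + (G 2 0 1 3 - G 2 0 3 1 - G 2 1 0 3 + G 2 1 3 0 + G 2 3 0 1 - G 2 3 1 0)
  - (G 3 0 1 2 - G 3 0 2 1 - G 3 1 0 2 + G 3 1 2 0 + G 3 2 0 1 - G 3 2 1 0).
Proof.
rewrite alt_sum_lift.
under eq_bigr => i _.
  under eq_bigr do rewrite lift_perm_id !lift_perm_lift /=.
  rewrite (alt_sum3 (fun a b c => G i (bump i a) (bump i b) (bump i c))).
  over.
by rewrite !big_ord_recl big_ord0 /= /bump /=; ring.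
Qed.

End Alternation.

Section Wedge.
Context {R : realType} {n : nat} {M : charted R n}.
Implicit Types (b : vfield M -> vfield M -> cinf M) (X : vfield M).

Definition form2 b : cochain M 2 := fun V => b (V ord0) (V (lift ord0 ord0)).

Lemma scale_natK m (f : cinf M) : (0 < m)%N -> (m%:R^-1 : R) *: (m%:R * f) = f.
Proof.
move=> m0; apply: cinf_eq => p; rewrite cinfZ cinfM mulrA cinf_nat.
by rewrite mulVf ?mul1r // pnatr_eq0 -lt0n.
Qed.

(** The first power is a product with the constant 1, which antisymmetrises [b]; the two equal
    contributions cancel the factor 1/2!. *)
Lemma wpow1E b : (forall X Y, b Y X = - b X Y) ->
  wpow (form2 b) 1 = form2 b :> cochain M 2.
Proof.
move=> bN; apply/funext => V; rewrite /= /wedge /form2.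
have -> : (2`! * (0 * 2)`!)%N = 2%N by [].
transitivity ((2%:R^-1 : R) *: (2%:R * b (V ord0) (V (lift ord0 ord0)))); last exact: scale_natK.
congr (_ *: _).
pose G i j := b (V (inord i)) (V (inord j)).
transitivity (\sum_(s : 'S_2) (-1) ^+ s * G (s ord0) (s (lift ord0 ord0))).
  apply: eq_bigr => s _; rewrite mulr1 /G !inord_val.
  by congr (_ * b (V (s _)) (V (s _))); exact: val_inj.
rewrite alt_sum2 /G.
have -> : inord 0 = ord0 :> 'I_2 by apply: val_inj; rewrite /= inordK.
have -> : inord 1 = lift ord0 ord0 :> 'I_2 by apply: val_inj; rewrite /= inordK.
by rewrite (bN (V ord0)) opprK; ring.
Qed.

Definition o0 : 'I_4 := ord0.
Definition o1 : 'I_4 := lift ord0 ord0.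
Definition o2 : 'I_4 := lift ord0 (lift ord0 ord0).
Definition o3 : 'I_4 := lift ord0 (lift ord0 (lift ord0 ord0)).

(** Antisymmetry groups the 24 permutations into three pairings, each met 8 times; dividing by 2! 2!
    leaves the factor 2. *)
Lemma wpow2E b : (forall X Y, b Y X = - b X Y) ->
  wpow (form2 b) 2 = (fun V => 2 * (b (V o0) (V o1) * b (V o2) (V o3) -
    b (V o0) (V o2) * b (V o1) (V o3) + b (V o0) (V o3) * b (V o1) (V o2)))
  :> cochain M 4.
Proof.
move=> bN; apply/funext => V.
rewrite -[LHS]/(wedge (form2 b) (wpow (form2 b) 1) V) wpow1E // /wedge /form2.
have -> : (2`! * (1 * 2)`!)%N = 4%N by [].
set r := RHS; transitivity ((4%:R^-1 : R) *: (4%:R * r)); last exact: scale_natK.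
congr (_ *: _).
pose B i j := b (V (inord i)) (V (inord j)).
transitivity (\sum_(s : 'S_4) (-1) ^+ s * (fun i j k l => B i j * B k l)
    (s ord0 : nat) (s (lift ord0 ord0) : nat)
    (s (lift ord0 (lift ord0 ord0)) : nat)
    (s (lift ord0 (lift ord0 (lift ord0 ord0))) : nat)).
  apply: eq_bigr => s _; rewrite /B !inord_val.
  congr (_ * (b (V (s _)) (V (s _)) * b (V (s _)) (V (s _)))); exact: val_inj.
rewrite (alt_sum4 (fun i j k l => B i j * B k l)).
have BN i j : B j i = - B i j by exact: bN.
rewrite (BN 0 1)%N (BN 0 2)%N (BN 0 3)%N (BN 1 2)%N (BN 1 3)%N (BN 2 3)%N.
have e0 : inord 0 = o0 by apply: val_inj; rewrite /= inordK.
have e1 : inord 1 = o1 by apply: val_inj; rewrite /= inordK.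
have e2 : inord 2 = o2 by apply: val_inj; rewrite /= inordK.
have e3 : inord 3 = o3 by apply: val_inj; rewrite /= inordK.
by rewrite /r -e0 -e1 -e2 -e3 -![b _ _]/(B _ _); ring.
Qed.

End Wedge.

(** * Lie derivative and exterior derivative *)

Section FormCalculus.
Context {R : realType} {n : nat} {M : charted R n}.
Implicit Types (f g : cinf M) (X Y Z W : vfield M).

Lemma vfieldN X f : X (- f) = - X f.
Proof. by rewrite -[LHS]addr0 -(subrr (X f)) addrA -vfieldD addNr vfield0 add0r. Qed.

Lemma vfield_double X f : X (2 * f) = 2 * X f.
Proof. by rewrite !mulr_natl !mulr2n vfieldD. Qed.

Section Biform.
Context (b : vfield M -> vfield M -> cinf M).
Implicit Types (V : 'I_4 -> vfield M).

Definition lie2 X Y Z : cinf M := X (b Y Z) - b (bracket X Y) Z - b Y (bracket X Z).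

Lemma lieD_form2 X (V : 'I_2 -> vfield M) :
  lieD X (form2 b) V = lie2 X (V ord0) (V (lift ord0 ord0)).
Proof.
by rewrite /lieD /form2 !big_ord_recl big_ord0 /upd /= addr0 opprD addrA.
Qed.

Definition square V : cinf M :=
  2 * (b (V o0) (V o1) * b (V o2) (V o3) -
    b (V o0) (V o2) * b (V o1) (V o3) + b (V o0) (V o3) * b (V o1) (V o2)).

(** The Leibniz rule: the right-hand side is 2 omega /\ L_X omega, written out for the two-form
    [b]. *)
Lemma lieD_square X V :
  lieD X square V = 2 * (
   lie2 X (V o0) (V o1) * b (V o2) (V o3) + b (V o0) (V o1) * lie2 X (V o2) (V o3)
  - lie2 X (V o0) (V o2) * b (V o1) (V o3) - b (V o0) (V o2) * lie2 X (V o1) (V o3)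
  + lie2 X (V o0) (V o3) * b (V o1) (V o2) + b (V o0) (V o3) * lie2 X (V o1) (V o2)).
Proof.
rewrite /lieD !big_ord_recl big_ord0 /square -/o0 -/o1 -/o2 -/o3 /upd /=.
rewrite vfield_double vfieldD vfieldD vfieldN !vfieldM /lie2.
ring.
Qed.

Lemma extd0E (beta : cochain M 0) (V : 'I_1 -> vfield M) :
  extd beta V = V ord0 (beta (V \o lift ord0)).
Proof.
by rewrite /extd !big_ord_recl !big_ord0 /= expr0 mul1r !addr0.
Qed.

Lemma extd2E (V : 'I_3 -> vfield M) :
  let X := V ord0 in let Y := V (lift ord0 ord0) in
  let Z := V (lift ord0 (lift ord0 ord0)) in
  extd (form2 b) V = X (b Y Z) - Y (b X Z) + Z (b X Y)
    - b (bracket X Y) Z + b (bracket X Z) Y - b (bracket Y Z) X.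
Proof.
rewrite /= /extd !big_ord_recl !big_ord0.
do 2!rewrite big_mkcond !big_ord_recl !big_ord0 /=.
rewrite /form2 /= /vcons !unlift_none !liftK /=.
have -> : lift (lift ord0 ord0) ord0 = ord0 :> 'I_2 by exact: val_inj.
have -> : lift (lift ord0 ord0) ord0 = ord0 :> 'I_3 by exact: val_inj.
have -> : lift (lift ord0 ord0) (lift ord0 ord0) = lift ord0 (lift ord0 ord0) :> 'I_3.
  exact: val_inj.
have -> : lift (lift ord0 (lift ord0 ord0)) ord0 = ord0 :> 'I_3 by exact: val_inj.
have -> : lift (lift ord0 (lift ord0 ord0)) (lift ord0 ord0) = lift ord0 ord0 :> 'I_3.
  exact: val_inj.
rewrite !addr0 !add0r /bump /= !expr0 !expr1 !mul1r.
rewrite -[(1 + (1 + 0))%N]/2%N -[(0 + 2)%N]/2%N -[(1 + 0 + 2)%N]/3%N.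
ring.
Qed.

End Biform.
End FormCalculus.

(** * The symplectic form and Cartan's formula *)

Section Omega.
Context {R : realType}.
Local Notation V := 'rV[R]_6.
Local Notation M := (@nil_charted R).
Local Notation pr := (@nproj R).
Implicit Types (f g : cinf M) (X Y Z W : vfield M).

Definition j0 : 'I_6 := Ordinal (isT : (0 < 6)%N).
Definition j1 : 'I_6 := Ordinal (isT : (1 < 6)%N).
Definition j2 : 'I_6 := Ordinal (isT : (2 < 6)%N).
Definition j3 : 'I_6 := Ordinal (isT : (3 < 6)%N).
Definition j4 : 'I_6 := Ordinal (isT : (4 < 6)%N).
Definition j5 : 'I_6 := Ordinal (isT : (5 < 6)%N).

Lemma lo1E : (lo1 j3 = j0) * (lo1 j4 = j0) * (lo1 j5 = j1).
Proof. by do !split; apply: val_inj; rewrite /= inordK. Qed.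

Lemma lo2E : (lo2 j3 = j1) * (lo2 j4 = j2) * (lo2 j5 = j2).
Proof. by do !split; apply: val_inj; rewrite /= inordK. Qed.

Lemma theta_bracket_low k X Y : up k = false ->
  theta k (bracket X Y) = X (theta k Y) - Y (theta k X).
Proof. by move=> uk; rewrite theta_bracket /tw uk scale0r subr0. Qed.

Lemma theta_bracket_up k X Y : up k ->
  theta k (bracket X Y) = X (theta k Y) - Y (theta k X) -
    (theta (lo1 k) X * theta (lo2 k) Y - theta (lo2 k) X * theta (lo1 k) Y).
Proof. by move=> uk; rewrite theta_bracket /tw uk scale1r. Qed.

(** The differentials of e0 /\ e5, e1 /\ e4 and - e2 /\ e3 are -1, 1 and 1 times e0 /\ e1 /\ e2; the
    coefficient 2 makes them cancel. *)
Definition om X Y : cinf M :=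
  2 * (theta j0 X * theta j5 Y - theta j5 X * theta j0 Y)
  + (theta j1 X * theta j4 Y - theta j4 X * theta j1 Y)
  - (theta j2 X * theta j3 Y - theta j3 X * theta j2 Y).

Lemma omN X Y : om Y X = - om X Y.
Proof. by rewrite /om; ring. Qed.

Definition theta_br X Y := (@theta_bracket_low j0 X Y erefl, @theta_bracket_low j1 X Y erefl,
  @theta_bracket_low j2 X Y erefl, @theta_bracket_up j3 X Y erefl,
  @theta_bracket_up j4 X Y erefl, @theta_bracket_up j5 X Y erefl, lo1E, lo2E).

Lemma om_closed X Y Z :
  X (om Y Z) - Y (om X Z) + Z (om X Y)
  - om (bracket X Y) Z + om (bracket X Z) Y - om (bracket Y Z) X = 0.
Proof.
rewrite /om !theta_br !(vfieldD, vfieldN, vfield_double, vfieldM).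
ring.
Qed.

Notation tau := (lie2 om).

(** Cartan's formula for closed omega: L_X omega = d (i_X omega). *)
Lemma tauE X Y Z : tau X Y Z = Y (om X Z) - Z (om X Y) - om X (bracket Y Z).
Proof.
rewrite /lie2 (omN (bracket X Z) Y) (omN (bracket Y Z) X).
have := om_closed X Y Z; set a := X _; set b := Y _; set c := Z _.
move=> /eqP; rewrite -subr_eq0 => /eqP e.
by apply/eqP; rewrite -subr_eq0 -[X in _ == X]e; apply/eqP; ring.
Qed.

End Omega.

(** * Closed one-forms *)

Section ClosedOneForms.
Context {R : realType}.
Local Notation V := 'rV[R]_6.
Local Notation M := (@nil_charted R).
Local Notation pr := (@nproj R).
Implicit Types (f g : cinf M) (x y z : V) (i j k l m : 'I_6).

(* The change of frame: [E_l = d_l + \sum_k pmat l k * d_k]. *)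
Definition pmat l k x : R := tw k * (lo1 k == l)%:R * x 0 (lo2 k).

Lemma derive_wvecE (F : V -> R) l x : differentiable F x ->
  'D_(wvec l x) F x = pderiv l F x + \sum_k pmat l k x * pderiv k F x.
Proof.
move=> dF; rewrite derive_pderiv // -(sum_delta (fun k => pderiv k F x) l) -big_split.
by apply: eq_bigr => k _ /=; rewrite wvecE /pmat eq_sym; ring.
Qed.

Lemma pmat_pmat l k m x y : pmat l k x * pmat k m y = 0.
Proof.
rewrite /pmat; transitivity (tw k * (lo1 m == k)%:R *
    ((lo1 k == l)%:R * x 0 (lo2 k) * tw m * y 0 (lo2 m))).
  by ring.
by rewrite tw_lo1_eq mul0r.
Qed.

Lemma pderiv_wvecE (F : V -> R) l x : differentiable F x ->
  pderiv l F x = 'D_(wvec l x) F x - \sum_k pmat l k x * 'D_(wvec k x) F x.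
Proof.
move=> dF; rewrite derive_wvecE //.
under [X in _ - X]eq_bigr => k _.
  rewrite derive_wvecE // mulrDr mulr_sumr.
  under eq_bigr do rewrite mulrA pmat_pmat mul0r.
  rewrite big1 // addr0.
  over.
by rewrite addrK.
Qed.

Lemma struct_up k j m : tw k * struct_cst k j m = 0 :> R.
Proof.
rewrite /struct_cst.
transitivity (tw m * (tw k * (lo2 m == k)%:R * (lo1 m == j)%:R -
  tw k * (lo1 m == k)%:R * (lo2 m == j)%:R) : R).
  by ring.
by rewrite tw_lo1_eq tw_lo2_eq; ring.
Qed.

Lemma smooth_pmat l k x : smooth_at (pmat l k) x.
Proof.
have -> : pmat l k = cst (tw k * (lo1 k == l)%:R) * (fun y : V => y 0 (lo2 k)) by [].
by apply: smooth_atM; [exact: smooth_at_cst|exact: smooth_at_coord].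
Qed.

Lemma pderiv_pmat l k i x : pderiv i (pmat l k) x = tw k * (lo1 k == l)%:R * (lo2 k == i)%:R.
Proof.
have -> : pmat l k = cst (tw k * (lo1 k == l)%:R) * (fun y : V => y 0 (lo2 k)) by [].
rewrite pderivM; [|exact: differentiable_cst|exact: differentiable_coord].
by rewrite pderiv_cst mulr0 addr0 pderiv_coord.
Qed.

(** The [u i] are the values of a one-form on the frame, and [uC] says that its differential
    vanishes on pairs of frame fields. *)
Context (u : 'I_6 -> cinf M)
  (uC : forall i j x, frame i (u j) (pr x) - frame j (u i) (pr x) =
    \sum_m struct_cst i j m * u m (pr x)).

(** The components of the lifted form with respect to the coordinate differentials; as [pmat] has
    square zero, inverting the change of frame only changes its sign. *)
Let v l : V -> R := (u l \o pr) - \sum_k pmat l k * (u k \o pr).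

Let sv l x : smooth_at (v l) x.
Proof.
apply: smooth_atD; first exact: cinf_smooth.
apply: smooth_atN; apply: smooth_at_sum => k _.
by apply: smooth_atM; [exact: smooth_pmat|exact: cinf_smooth].
Qed.

Let dv i j x : pderiv i (v j) x =
  frame i (u j) (pr x) - \sum_k pmat i k x * frame k (u j) (pr x)
  - \sum_k pmat j k x * frame i (u k) (pr x)
  + \sum_k \sum_l pmat j k x * pmat i l x * frame l (u k) (pr x)
  - \sum_k tw k * (lo1 k == j)%:R * (lo2 k == i)%:R * u k (pr x).
Proof.
have du k : differentiable (u k \o pr) x by exact: cinf_differentiable.
have sp k y : smooth_at (pmat j k * (u k \o pr)) y.
  by apply: smooth_atM; [exact: smooth_pmat|exact: cinf_smooth].
have dpu k : pderiv i (u k \o pr) x =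
    frame i (u k) (pr x) - \sum_l pmat i l x * frame l (u k) (pr x).
  rewrite pderiv_wvecE // frameE; congr (_ - _).
  by apply: eq_bigr => l _; rewrite frameE.
have dN (F : V -> R) : differentiable F x -> pderiv i (- F) x = - pderiv i F x.
  by move=> dF; rewrite /pderiv deriveN //; exact: diff_derivable.
rewrite /v pderivD //; last first.
  by apply/smooth_at_differentiable/smooth_atN/smooth_at_sum.
rewrite dN; last by apply/smooth_at_differentiable/smooth_at_sum.
rewrite pderiv_sum // dpu -!addrA; congr (_ + (_ + _)).
rewrite addrA -!sumrN -!big_split /=; apply: eq_bigr => k _.
rewrite pderivM //; last exact/smooth_at_differentiable/smooth_pmat.
rewrite dpu pderiv_pmat /= mulrBr mulr_sumr.
have -> : \sum_l pmat j k x * (pmat i l x * frame l (u k) (pr x)) =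
    \sum_l pmat j k x * pmat i l x * frame l (u k) (pr x).
  by apply: eq_bigr => l _; rewrite mulrA.
set a := \sum_l _; ring.
Qed.

(** The derivatives of the coefficients [pmat] account for the structure constants in [uC]. The
    remaining terms are symmetric in [i] and [j], because central frame fields commute with all
    others ([struct_up]). *)
Let cv i j x : pderiv i (v j) x = pderiv j (v i) x.
Proof.
have z1 k a : tw k * (frame k (u a) (pr x) - frame a (u k) (pr x)) = 0.
  by rewrite uC mulr_sumr big1 // => m _; rewrite mulrA struct_up mul0r.
have pz l k a : pmat l k x * (frame k (u a) (pr x) - frame a (u k) (pr x)) = 0.
  have := z1 k a; set D := (_ - _) => zD.
  transitivity ((lo1 k == l)%:R * x 0 (lo2 k) * (tw k * D)); first by rewrite /pmat; ring.
  by rewrite zD mulr0.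
apply/eqP; rewrite -subr_eq0; apply/eqP.
rewrite !dv.
have S : \sum_k tw k * (lo1 k == j)%:R * (lo2 k == i)%:R * u k (pr x) -
    \sum_k tw k * (lo1 k == i)%:R * (lo2 k == j)%:R * u k (pr x) =
    frame i (u j) (pr x) - frame j (u i) (pr x).
  by rewrite uC -sumrB; apply: eq_bigr => k _; rewrite /struct_cst; ring.
have Q a b : \sum_k pmat a k x * frame k (u b) (pr x) =
    \sum_k pmat a k x * frame b (u k) (pr x).
  apply: eq_bigr => k _; apply/eqP; rewrite -subr_eq0 -mulrBr; apply/eqP.
  exact: pz.
have T : \sum_k \sum_l pmat j k x * pmat i l x * frame l (u k) (pr x) =
    \sum_k \sum_l pmat i k x * pmat j l x * frame l (u k) (pr x).
  rewrite [LHS]exchange_big; apply: eq_bigr => k _; apply: eq_bigr => l _ /=.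
  apply/eqP; rewrite -subr_eq0; apply/eqP.
  transitivity (pmat j l x * (pmat i k x * (frame k (u l) (pr x) - frame l (u k) (pr x)))).
    by move: (frame k (u l) (pr x)) (frame l (u k) (pr x)) => p q; ring.
  by rewrite pz mulr0.
rewrite T (Q i j) (Q j i).
move: S; set A := \sum_k tw k * _ * _ * _; set B := \sum_k tw k * _ * _ * _.
set a := frame i (u j) _; set b := frame j (u i) _.
set c := \sum_k _; set d := \sum_k _; set e := \sum_k _ => S.
transitivity (a - b - (A - B)); first by ring.
by rewrite S subrr.
Qed.

Let e k : V := delta_mx 0 k.

(** The two generators attached to a central index are distinct, which makes each coordinate axis a
    one-parameter subgroup. *)
Lemma tw_lo12 k m : tw k * (lo1 k == m)%:R * (lo2 k == m)%:R = 0 :> R.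
Proof.
rewrite /tw; have [uk|_] := boolP (up k); last by rewrite !mul0r.
case: eqVneq => [<-|_]; last by rewrite mulr0 mul0r.
case: eqVneq => [|_]; last by rewrite mulr0.
move: uk; rewrite /up /lo1 /lo2; case: k => [[|[|[|[|[|[|//]]]]]] ?] //= _;
  by move/(congr1 val); rewrite /= !inordK.
Qed.

Lemma nmul_line k (s t : R) : nmul (s *: e k) (t *: e k) = (s + t) *: e k.
Proof.
apply/rowP => j; rewrite nmulE !mxE /= -[RHS]addr0.
rewrite -[in RHS](mulr0 (s * t)) -(tw_lo12 j k); ring.
Qed.

Lemma ord6P (P : 'I_6 -> Prop) : P j0 -> P j1 -> P j2 -> P j3 -> P j4 -> P j5 ->
  forall k, P k.
Proof.
move=> p0 p1 p2 p3 p4 p5 [[|[|[|[|[|[|//]]]]]] lk].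
- by rewrite (_ : Ordinal lk = j0) //; exact: val_inj.
- by rewrite (_ : Ordinal lk = j1) //; exact: val_inj.
- by rewrite (_ : Ordinal lk = j2) //; exact: val_inj.
- by rewrite (_ : Ordinal lk = j3) //; exact: val_inj.
- by rewrite (_ : Ordinal lk = j4) //; exact: val_inj.
- by rewrite (_ : Ordinal lk = j5) //; exact: val_inj.
Qed.

Lemma tw_val : (tw j0 = 0 :> R) * (tw j1 = 0 :> R) * (tw j2 = 0 :> R) *
  (tw j3 = 1 :> R) * (tw j4 = 1 :> R) * (tw j5 = 1 :> R).
Proof. by []. Qed.

(** In decreasing order of the generators all twisting terms vanish, so the exponents are the
    coordinates themselves. *)
Lemma nmul_decomp (a : V) : a = nmul (nmul (nmul (nmul (nmul (a 0 j2 *: e j2)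
  (a 0 j1 *: e j1)) (a 0 j0 *: e j0)) (a 0 j3 *: e j3)) (a 0 j4 *: e j4))
  (a 0 j5 *: e j5).
Proof.
apply/rowP; elim/ord6P; rewrite !nmulE !tw_val ?lo1E ?lo2E ?mxE /=; ring.
Qed.

Lemma nmul_comm_e : (nmul (e j0) (e j1) = nmul (nmul (e j1) (e j0)) (e j3)) *
  (nmul (e j0) (e j2) = nmul (nmul (e j2) (e j0)) (e j4)) *
  (nmul (e j1) (e j2) = nmul (nmul (e j2) (e j1)) (e j5)).
Proof.
by do !split; apply/rowP; elim/ord6P; rewrite !nmulE !tw_val ?lo1E ?lo2E ?mxE /=; ring.
Qed.


Lemma derive_wvec_nmul (F : V -> R) l x a :
  'D_(wvec l x) (F \o nmul^~ a) x = 'D_(wvec l (nmul x a)) F (nmul x a).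
Proof.
suff E : (fun h : R =>
    h^-1 *: (((F \o nmul^~ a) \o shift x) (h *: wvec l x) - (F \o nmul^~ a) x)) =
    (fun h : R =>
    h^-1 *: ((F \o shift (nmul x a)) (h *: wvec l (nmul x a)) - F (nmul x a))).
  by rewrite /derive E.
by apply/funext => h /=; rewrite wvec_nmul.
Qed.

(** The constants are the periods [F (e k)] of the primitive. Subtracting the linear function with
    these coefficients leaves a function that vanishes on the lattice and is invariant under it,
    hence descends. *)
Lemma closed_frame : exists (f : cinf M) (c : 'I_6 -> R),
  (forall k, up k -> c k = 0) /\ forall k, u k = c k *: (1 : cinf M) + frame k f.
Proof.
have [F [sF F0 dF]] := poincare sv cv.
have diffF x : differentiable F x by exact: smooth_at_differentiable.
have EF l x : 'D_(wvec l x) F x = u l (pr x).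
  rewrite derive_wvecE // dF /v !fctE fct_sumE.
  have -> : \sum_k pmat l k x * pderiv k F x = \sum_k pmat l k x * u k (pr x).
    apply: eq_bigr => k _; rewrite dF /v !fctE fct_sumE mulrBr.
    rewrite mulr_sumr big1 ?subr0 // => m _.
    by rewrite fctE mulrA pmat_pmat mul0r.
  by rewrite /= subrK.
(* A lattice translate of [F] has the same frame derivatives as [F], so the difference is constant;
   its value at 0 is [F a]. *)
have FM x a : lattice a -> F (nmul x a) = F x + F a.
  move=> la; pose G := (F \o nmul^~ a) - F.
  have sFa y : smooth_at (F \o nmul^~ a) y.
    by apply: smooth_at_comp => // k; exact: smooth_nmulr.
  have sG y : smooth_at G y by apply: smooth_atD => //; exact: smooth_atN.
  have EG l y : 'D_(wvec l y) G y = 0.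
    rewrite deriveB; [|exact/diff_derivable/smooth_at_differentiable..].
    rewrite derive_wvec_nmul !EF; apply/eqP; rewrite subr_eq0; apply/eqP.
    by congr (u l _); apply/esym/nprojP; exists a.
  have dG k y : pderiv k G y = 0.
    rewrite pderiv_wvecE; last exact: smooth_at_differentiable.
    by rewrite EG big1 ?subr0 // => m _; rewrite EG mulr0.
  have := @pderiv0_cst _ _ G x 0 (fun y => smooth_at_differentiable (sG y)) dG.
  rewrite /G !fctE /= nmul0x F0 subr0 => /eqP.
  by rewrite subr_eq addrC => /eqP.
have le k : lattice (e k) by move=> j; rewrite mxE; case: (_ && _).
(* Central generators are commutators. *)
have Fup k : up k -> F (e k) = 0.
  have C a b c : lattice a -> lattice b -> lattice c ->
      nmul a b = nmul (nmul b a) c -> F c = 0.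
    move=> la lb lc /(congr1 F); rewrite !FM //.
    by rewrite [F b + F a]addrC -[LHS]addr0 => /addrI <-.
  move: k; apply: ord6P => // _.
  - exact: C nmul_comm_e.1.1.
  - exact: C nmul_comm_e.1.2.
  - exact: C nmul_comm_e.2.
pose c k := F (e k).
pose H x := F x - \sum_k c k * x 0 k.
(* The linear part is additive on products: twisting affects only central coordinates, where [c]
   vanishes. *)
have HM x a : lattice a -> H (nmul x a) = H x + H a.
  move=> la; rewrite /H FM // addrACA -opprD -big_split; congr (_ - _).
  apply: eq_bigr => k _ /=; rewrite -mulrDr nmulE /tw.
  have [uk|_] := boolP (up k); first by rewrite /c Fup // !mul0r.
  by rewrite !mul0r addr0.
have H0 : H 0 = 0 by rewrite /H F0 big1 ?subrr // => k _; rewrite mxE mulr0.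
have He k : H (e k) = 0.
  rewrite /H -/(c k); rewrite -[X in _ - X](_ : c k = _) ?subrr //.
  rewrite -[c k](sum_delta c k); apply: eq_bigr => l _.
  by rewrite mxE /= eq_sym.
have lint k (t : R) : t \is a Num.int -> lattice (t *: e k).
  by move=> ti j; rewrite mxE rpredM // le.
have Hnat k n : H (n%:R *: e k) = 0.
  elim: n => [|n IH]; first by rewrite scale0r H0.
  rewrite mulrSr -nmul_line HM ?IH scale1r ?He ?addr0 //; exact: le.
have Hint k t : t \is a Num.int -> H (t *: e k) = 0.
  move=> ti; have [t0|t0] := leP 0 t.
    by have /natrP[n ->] : t \is a Num.nat by rewrite -intrEge0.
  have /natrP[n en] : - t \is a Num.nat by rewrite -intrEge0 ?rpredN // oppr_ge0 ltW.
  have := HM (- t *: e k) (t *: e k) (lint k t ti).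
  by rewrite nmul_line addNr scale0r H0 en Hnat add0r.
have Hlat a : lattice a -> H a = 0.
  move=> la; rewrite (nmul_decomp a) !HM ?Hint ?addr0 //; exact: lint.
have sH x : smooth_at H x.
  have -> : H = F - \sum_k cst (c k) * (fun x : V => x 0 k).
    by apply/funext => y; rewrite /H !fctE fct_sumE.
  apply: smooth_atD => //; apply/smooth_atN/smooth_at_sum => k _.
  by apply: smooth_atM; [exact: smooth_at_cst|exact: smooth_at_coord].
have [f fE] := @cinf_of_inv R H sH (fun x a la => etrans (HM x a la)
  (etrans (congr1 (fun t => H x + t) (Hlat a la)) (addr0 _))).
exists f, c; split=> [k uk|k]; first exact: Fup.
apply: nil_cinf_eq => x; rewrite cinfD cinfZ cinf1 mulr1 frameE.
have -> : f \o pr = F - \sum_k cst (c k) * (fun x : V => x 0 k).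
  by apply/funext => y; rewrite /= fE /H !fctE fct_sumE.
have sc l y : smooth_at (cst (c l) * (fun x : V => x 0 l)) y.
  by apply: smooth_atM; [exact: smooth_at_cst|exact: smooth_at_coord].
have ss y : smooth_at (\sum_l cst (c l) * (fun x : V => x 0 l)) y by exact: smooth_at_sum.
rewrite deriveB; [|exact/diff_derivable/smooth_at_differentiable..].
rewrite EF -[X in _ + (_ - X)](_ : c k = _); first by rewrite addrC subrK.
rewrite derive_pderiv; last exact: smooth_at_differentiable.
under [RHS]eq_bigr do rewrite pderiv_sum //.
transitivity (\sum_l c l * wvec k x 0 l).
  rewrite -(sum_delta c k); apply: eq_bigr => l _; rewrite wvecE /tw eq_sym.
  have [ul|_] := boolP (up l); first by rewrite /c Fup // !mul0r.
  by rewrite !mul0r addr0.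
apply: eq_bigr => l _; rewrite mulrC; congr (_ * _).
rewrite -[LHS](sum_delta c l); apply: eq_bigr => m _.
rewrite pderivM; [|exact: differentiable_cst|exact: differentiable_coord].
by rewrite pderiv_cst pderiv_coord mulr0 addr0 eq_sym.
Qed.

End ClosedOneForms.

(** * Euler-Lagrange cohomology *)

Section Cohomology.
Context {R : realType}.
Local Notation V := 'rV[R]_6.
Local Notation M := (@nil_charted R).
Local Notation pr := (@nproj R).
Implicit Types (f g : cinf M) (X Y Z W : vfield M).

Lemma form2_is_form (b : vfield M -> vfield M -> cinf M) :
  (forall f X Y Z, b (fscale f X + Y) Z = f * b X Z + b Y Z) ->
  (forall X Y, b Y X = - b X Y) -> (forall X, b X X = 0) -> is_form (form2 b).
Proof.
move=> bl bN b0; split=> [V i f X Y|V i j ij Vij].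
  rewrite /form2 /upd; case: i => [[|[|//]] ?] /=; first exact: bl.
  by rewrite bN bl !(bN (V ord0)) opprD mulrN !opprK.
have e0 (k : 'I_2) : k = ord0 \/ k = lift ord0 ord0.
  by case: k => [[|[|//]] ?]; [left|right]; exact: val_inj.
rewrite /form2; move: ij Vij; case: (e0 i) => ->; case: (e0 j) => -> //= _ e.
  by rewrite e.
by rewrite e.
Qed.

Lemma om_linear f X Y Z : om (fscale f X + Y) Z = f * om X Z + om Y Z.
Proof. by rewrite /om !theta_linear; ring. Qed.

Lemma om_scale (a : R) X Y Z : om (a *: X + Y) Z = a *: om X Z + om Y Z.
Proof. by rewrite -fscale_cst om_linear -cinf_scaleAl mul1r. Qed.

Lemma om_diag X : om X X = 0.
Proof. by rewrite /om; ring. Qed.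

Definition omega : dform M 2 := DForm (form2_is_form om_linear (@omN R) om_diag).

Lemma omega_closed : extd omega = 0.
Proof. by apply/funext => V; rewrite /= extd2E om_closed. Qed.

Lemma thetaE k l : theta k (frame l) = (k == l)%:R :> cinf M.
Proof. by rewrite theta_frame; case: (k == l); rewrite ?scale1r ?scale0r. Qed.

Lemma om_frame X : (om X (frame j0) = - 2 * theta j5 X) *
  (om X (frame j1) = - theta j4 X) * (om X (frame j2) = theta j3 X) *
  (om X (frame j3) = - theta j2 X) * (om X (frame j4) = theta j1 X) *
  (om X (frame j5) = 2 * theta j0 X).
Proof. by do !split; rewrite /om !thetaE /=; ring. Qed.

Lemma omega_symplectic : symplectic omega.
Proof.
split; first exact: omega_closed.
move=> X p Xp f.
have H l : om X (frame l) p = 0.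
  have := Xp (fun=> frame l).
  by rewrite /= /form2 /vcons unlift_none liftK.
have := (H j0, H j1, H j2, H j3, H j4, H j5); rewrite !om_frame !cinfE ?cinf_nat.
move=> [[[[[h0 h1] h2] h3] h4] h5].
have t0 : forall k, theta k X p = 0 by apply: ord6P; lra.
by rewrite (vf_frame X f) cinf_sum big1 // => k _; rewrite cinfM t0 mul0r.
Qed.

Lemma frame_crit g : exists p, forall k, frame k g p = 0.
Proof.
have cg : continuous (g : M -> R).
  by apply/quotient_continuous; apply: smooth_continuous => x; exact: cinf_smooth.
have [p _ pmax] : exists2 c, c \in [set: M] & forall t, t \in [set: M] -> g t <= g c.
  apply: compact_EVT_max.
  - by exists (pr 0).
  - exact: nil_compact.
  - exact: continuous_subspaceT.
have [x xp] := nproj_surj p; exists p => k; rewrite -xp frameE.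
pose G := g \o pr.
have D s : is_derive s (1 : R) (fun s => G (x + s *: wvec k x))
    ('D_(wvec k x) G (x + s *: wvec k x)).
  by apply: is_derive_line; exact: cinf_differentiable.
have : is_derive (0 : R) (1 : R) (fun s => G (x + s *: wvec k x)) 0.
  apply: (@derive1_at_max _ _ (-1) 1).
  - lra.
  - by move=> t _; have := D t; case.
  - by rewrite in_itv /=; apply/andP; split; lra.
  - move=> t _; rewrite scale0r addr0 /G /= xp.
    by apply: pmax; rewrite inE.
move=> D0; have := @derive_val _ _ _ _ _ _ _ (D 0).
by rewrite (@derive_val _ _ _ _ _ _ _ D0) scale0r addr0.
Qed.

Notation tau := (lie2 om).

Lemma tau_anti X Y Z : tau X Z Y = - tau X Y Z.
Proof.
rewrite /lie2 (omN Y Z) vfieldN (omN Y (bracket X Z)) (omN (bracket X Y) Z).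
by move: (X (om Y Z)) => a; ring.
Qed.

Lemma lie_omega1 X : lieD X (wpow omega 1) = 0 <-> forall Y Z, tau X Y Z = 0.
Proof.
rewrite (wpow1E (@omN R)); split=> [H Y Z|H]; last first.
  by apply/funext => V; rewrite lieD_form2 H.
have := congr1 (fun a : cochain M 2 => a (fun i => if i == ord0 then Y else Z)) H.
by rewrite lieD_form2.
Qed.

Lemma wpow_omega2 : wpow omega 2 = square om.
Proof. exact: (wpow2E (@omN R)). Qed.

Lemma lie_omega2 X : (forall Y Z, tau X Y Z = 0) -> lieD X (wpow omega 2) = 0.
Proof.
by move=> H; apply/funext => V; rewrite wpow_omega2 lieD_square !H -[RHS]/(0 : cinf M); ring.
Qed.

(* [omega] pairs [j0] with [j5], [j1] with [j4] and [j2] with [j3]: the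
   coefficient of [omega /\ tau] on two disjoint pairs is a combination of two
   diagonal entries of [tau], on other quadruples a single entry. *)
Lemma tau_frame X : lieD X (wpow omega 2) = 0 ->
  forall i j, tau X (frame i) (frame j) = 0.
Proof.
move=> H i j; apply: cinf_eq => p; rewrite cinf0.
pose T a b := tau X (frame a) (frame b) p.
pose Om a b : R := om (frame a) (frame b) p.
have E a b c d : T a b * Om c d + Om a b * T c d - T a c * Om b d - Om a c * T b d
    + T a d * Om b c + Om a d * T b c = 0.
  pose V (i : 'I_4) : vfield M := frame (nth j0 [:: a; b; c; d] i).
  have := congr1 (fun al : cochain M 4 => al V p) H.
  rewrite wpow_omega2 lieD_square /V /=.
  rewrite -/(T a b).
  move=> e.
  have : 2 * (T a b * Om c d + Om a b * T c d - T a c * Om b d - Om a c * T b d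
    + T a d * Om b c + Om a d * T b c) = 0 :> R by rewrite -[RHS]e.
  by move/eqP; rewrite mulf_eq0 pnatr_eq0 /= => /eqP.
have TN a b : T b a = - T a b by rewrite /T tau_anti.
have OE a : (Om a j0 = - 2 * (j5 == a)%:R) * (Om a j1 = - (j4 == a)%:R) *
   (Om a j2 = (j3 == a)%:R) * (Om a j3 = - (j2 == a)%:R) *
   (Om a j4 = (j1 == a)%:R) * (Om a j5 = 2 * (j0 == a)%:R).
  by rewrite /Om !om_frame !cinfE !thetaE; do !split; case: (_ == a); rewrite ?cinf0 ?cinf1.
rewrite -/(T i j); clearbody T Om.
have T05 := E j0 j5 j1 j4; have T05' := E j0 j5 j2 j3; have T14 := E j1 j4 j2 j3.
rewrite !OE /= in T05 T05' T14.
have T01 := E j0 j1 j2 j3; have T04 := E j0 j4 j2 j3; have T51 := E j1 j5 j2 j3.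
have T54 := E j4 j5 j2 j3; rewrite !OE /= in T01 T04 T51 T54.
have T02 := E j0 j2 j1 j4; have T03 := E j0 j3 j1 j4; have T52 := E j2 j5 j1 j4.
have T53 := E j3 j5 j1 j4; rewrite !OE /= in T02 T03 T52 T53.
have T12 := E j1 j2 j0 j5; have T13 := E j1 j3 j0 j5; have T42 := E j2 j4 j0 j5.
have T43 := E j3 j4 j0 j5; rewrite !OE /= in T12 T13 T42 T43.
have Td a : T a a = 0 by move: (TN a a); clear; lra.
(* One equation for each two of the three symplectic pairs; this linear system has only the zero
   solution. *)
have U : [/\ T j0 j5 = 0, T j1 j4 = 0 & T j2 j3 = 0].
  by move: T05 T05' T14; clear; split; lra.
have {T05 T05' T14 U} [U05 U14 U23] := U.
have {}T01 : T j0 j1 = 0 by move: T01; clear; lra.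
have {}T04 : T j0 j4 = 0 by move: T04; clear; lra.
have {}T51 : T j1 j5 = 0 by move: T51; clear; lra.
have {}T54 : T j4 j5 = 0 by move: T54; clear; lra.
have {}T02 : T j0 j2 = 0 by move: T02; clear; lra.
have {}T03 : T j0 j3 = 0 by move: T03; clear; lra.
have {}T52 : T j2 j5 = 0 by move: T52; clear; lra.
have {}T53 : T j3 j5 = 0 by move: T53; clear; lra.
have {}T12 : T j1 j2 = 0 by move: T12; clear; lra.
have {}T13 : T j1 j3 = 0 by move: T13; clear; lra.
have {}T42 : T j2 j4 = 0 by move: T42; clear; lra.
have {}T43 : T j3 j4 = 0 by move: T43; clear; lra.
move: i j; apply: ord6P; apply: ord6P; first [exact: Td|assumption|
  by rewrite TN; apply/eqP; rewrite oppr_eq0; apply/eqP; assumption].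
Qed.

Lemma om_frame_sum X Y : om X Y = \sum_k theta k Y * om X (frame k).
Proof.
rewrite !big_ord_recl big_ord0.
have -> : ord0 = j0 by exact: val_inj.
have -> : lift j0 ord0 = j1 by exact: val_inj.
have -> : lift j0 (lift ord0 ord0) = j2 by exact: val_inj.
have -> : lift j0 (lift ord0 (lift ord0 ord0)) = j3 by exact: val_inj.
have -> : lift j0 (lift ord0 (lift ord0 (lift ord0 ord0))) = j4 by exact: val_inj.
have -> : lift j0 (lift ord0 (lift ord0 (lift ord0 (lift ord0 ord0)))) = j5 by exact: val_inj.
rewrite !om_frame /om; ring.
Qed.

Lemma theta_bracket_frame i j k :
  theta k (bracket (frame i) (frame j)) = struct_cst i j k *: (1 : cinf M).
Proof.
rewrite theta_bracket !theta_frame !vfield_cst subrr sub0r.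
apply: cinf_eq => p; rewrite !cinfE /struct_cst; ring.
Qed.

Lemma xS2_decomp X : lieD X (wpow omega 2) = 0 ->
  exists (c : 'I_6 -> R) (f : cinf M), (forall k, up k -> c k = 0) /\
    forall Y, om X Y = \sum_k c k *: theta k Y + Y f.
Proof.
move=> /tau_frame T.
have C i j x : frame i (om X (frame j)) (pr x) - frame j (om X (frame i)) (pr x) =
    \sum_m struct_cst i j m * om X (frame m) (pr x).
  have := T i j; rewrite tauE (om_frame_sum X (bracket _ _)) => /eqP.
  rewrite subr_eq0 => /eqP /(congr1 (fun h : cinf M => h (pr x))) e.
  apply: (etrans e); rewrite cinf_sum; apply: eq_bigr => m _.
  by rewrite theta_bracket_frame cinfM cinfZ cinf1 mulr1.
have [f [c [cu E]]] := closed_frame C.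
exists c, f; split=> // Y; rewrite om_frame_sum (vf_frame Y) -big_split.
apply: eq_bigr => k _ /=; rewrite E mulrDr; congr (_ + _).
by rewrite -cinf_scaleAr mulr1.
Qed.

Definition low (k : 'I_3) : 'I_6 := widen_ord (isT : (3 <= 6)%N) k.

(* The vector field [X] with [i_X omega = e_k]. *)
Definition dual_vf (k : 'I_3) : vfield M :=
  if k == 0 :> nat then (- 2^-1) *: frame j5
  else if k == 1 :> nat then - frame j4 else frame j3.

Lemma om0l Y : om 0 Y = 0.
Proof.
have := om_scale 1 0 0 Y; rewrite scale1r addr0 scale1r => /eqP.
by rewrite -subr_eq subrr eq_sym => /eqP.
Qed.

Lemma omZl (a : R) X Y : om (a *: X) Y = a *: om X Y.
Proof. by rewrite -[a *: X]addr0 om_scale om0l addr0. Qed.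

Lemma om_dual k Y : om (dual_vf k) Y = theta (low k) Y.
Proof.
rewrite /dual_vf; case: k => [[|[|[|//]]] lk] /=.
- rewrite omZl omN om_frame.
  have -> : low (Ordinal lk) = j0 by exact: val_inj.
  by apply: cinf_eq => p; rewrite cinfZ cinfN cinfM cinf_nat; field.
- have -> : low (Ordinal lk) = j1 by exact: val_inj.
  by rewrite -scaleN1r omZl omN om_frame scaleN1r opprK.
- have -> : low (Ordinal lk) = j2 by exact: val_inj.
  by rewrite omN om_frame opprK.
Qed.

Lemma up_low k : up (low k) = false.
Proof. by rewrite /up /= ltnNge -ltnS ltn_ord. Qed.

Lemma tau_dual k Y Z : tau (dual_vf k) Y Z = 0.
Proof.
by rewrite tauE !om_dual theta_bracket_low ?up_low // subrr.
Qed.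

Lemma om_sum_dual (c : 'I_3 -> R) Y :
  om (\sum_k c k *: dual_vf k) Y = \sum_k c k *: theta (low k) Y.
Proof.
rewrite !big_ord_recl !big_ord0 !om_scale om0l addr0.
by rewrite !om_dual addr0.
Qed.

Lemma xH1P X : exact_form (- iprod X (wpow omega 1)) ->
  exists g, forall Y, om X Y = Y g.
Proof.
rewrite (wpow1E (@omN R)) => -[beta _ e].
(* A zero-form is a function of the empty family, so any family indexed by ['I_0] serves as
   argument. The sign undoes the one in - i_X omega. *)
exists (- beta (fun=> 0)) => Y.
have := congr1 (fun a : cochain M 1 => a (fun=> Y)) e.
rewrite extd0E vfieldN /= /form2 /vcons unlift_none liftK => e2.
rewrite -[LHS]opprK; congr (- _).
apply: etrans e2 _; congr (vf_fun Y (beta _)).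
by apply/funext; case.
Qed.

Let v0 (V : 'I_3 -> vfield M) := V ord0.
Let v1 (V : 'I_3 -> vfield M) := V (lift ord0 ord0).
Let v2 (V : 'I_3 -> vfield M) := V (lift ord0 (lift ord0 ord0)).

Lemma iprod_square X (V : 'I_3 -> vfield M) : iprod X (square om) V =
  2 * (om X (v0 V) * om (v1 V) (v2 V) - om X (v1 V) * om (v0 V) (v2 V)
       + om X (v2 V) * om (v0 V) (v1 V)).
Proof. by rewrite /= /square /vcons unlift_none !liftK. Qed.

(* [i_X (omega^2) = 2 dg /\ omega = d (2 g omega)] when [i_X omega = dg]. *)
Lemma exact_H2 X g : (forall Y, om X Y = Y g) -> exact_form (- iprod X (wpow omega 2)).
Proof.
move=> H; rewrite wpow_omega2.
exists (form2 (fun Y Z => - (2 * (g * om Y Z)))).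
  apply: form2_is_form => [f Y Z W|Y Z|Y].
  - by rewrite om_linear; ring.
  - by rewrite (omN Y Z); ring.
  - by rewrite om_diag; ring.
apply/funext => V; rewrite -[LHS]/(- iprod X (square om) V) iprod_square extd2E !H.
rewrite -/(v0 V) -/(v1 V) -/(v2 V).
rewrite !vfieldN !vfield_double !vfieldM.
have := om_closed (v0 V) (v1 V) (v2 V).
set a := v0 V (om _ _); set b := v1 V (om _ _); set c := v2 V (om _ _).
set d := om _ _; set e := om _ _; set h := om _ _ => Z.
set r := RHS; transitivity (r + 2 * g * (a - b + c - d + e - h)); last by rewrite Z mulr0 addr0.
rewrite /r; ring.
Qed.

(** For this field i_X (omega^2) = 2 e0 /\ omega = 2 (e0 /\ e1 /\ e4 - e0 /\ e2 /\ e3), which is 2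
    (d e3 /\ e4 - e3 /\ d e4) = d (2 e3 /\ e4). *)
Lemma exact_dual0 : exact_form (- iprod (dual_vf ord0) (wpow omega 2)).
Proof.
rewrite wpow_omega2.
exists (form2 (fun Y Z => - (2 * (theta j3 Y * theta j4 Z - theta j4 Y * theta j3 Z)))).
  apply: form2_is_form => [f Y Z W|Y Z|Y]; first rewrite !theta_linear; ring.
apply/funext => V; rewrite -[LHS]/(- iprod (dual_vf ord0) (square om) V) iprod_square extd2E.
rewrite !om_dual.
have -> : low ord0 = j0 by exact: val_inj.
rewrite -/(v0 V) -/(v1 V) -/(v2 V) !theta_br.
rewrite !vfieldN !vfield_double !(vfieldD, vfieldN, vfieldM) /om.
ring.
Qed.

(** * Generators of the two cohomology groups *)

Lemma dual_xS1 k : dual_vf k \in xS_pred omega 1.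
Proof. by apply/asboolP/lie_omega1; exact: tau_dual. Qed.

Lemma dual_xS2 k : dual_vf k \in xS_pred omega 2.
Proof. by apply/asboolP/lie_omega2; exact: tau_dual. Qed.

Definition class1 k : HEL omega 1 := quot_pi (@xH_pred R 6 M omega 1) (XS (dual_xS1 k)).
Definition class2 k : HEL omega 2 := quot_pi (@xH_pred R 6 M omega 2) (XS (dual_xS2 k)).

Lemma class1_free (c : 'I_3 -> R) : \sum_k c k *: class1 k = 0 -> forall k, c k = 0.
Proof.
pose x := \sum_k c k *: XS (dual_xS1 k).
have -> : \sum_k c k *: class1 k = quot_pi (@xH_pred R 6 M omega 1) x.
  by rewrite linear_sum; apply: eq_bigr => k _; rewrite linearZ.
rewrite -(linear0 (quot_pi (@xH_pred R 6 M omega 1))) => /quot_piP.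
rewrite subr0 => /asboolP /xH1P[g Hg] k.
have xE : (x : vfield M) = \sum_k c k *: dual_vf k.
  by rewrite /x !big_ord_recl !big_ord0.
(* At a critical point of the primitive, evaluation on the frame field of index [low k] leaves
   exactly [c k]. *)
have [p pg] := frame_crit g.
have := Hg (frame (low k)); rewrite xE om_sum_dual => /(congr1 (fun h : cinf M => h p)).
move=> e; rewrite -(pg (low k)) -e cinf_sum.
rewrite -(sum_delta c k); apply: eq_bigr => l _; rewrite thetaE.
rewrite -[X in _ = X]/(c l * _); congr (_ * _).
have -> : (low l == low k) = (k == l) by rewrite eq_sym.
exact: esym (cinf_nat _ p).
Qed.

Lemma class2_span (y : HEL omega 2) : exists c : 'I_3 -> R,
  y = \sum_k c k *: class2 k.
Proof.
have [x <-] := quot_pi_surj y.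
have : lieD (x : vfield M) (wpow omega 2) = 0 by case: x => X /= /asboolP.
move=> /xS2_decomp[c [f [cu E]]].
exists (c \o low).
have -> : \sum_k (c \o low) k *: class2 k =
    quot_pi (@xH_pred R 6 M omega 2) (\sum_k (c \o low) k *: XS (dual_xS2 k)).
  by rewrite linear_sum; apply: eq_bigr => k _; rewrite linearZ.
apply/quot_piP/asboolP; apply: (@exact_H2 _ f) => Y.
set z := \sum_k _.
have zE : (z : vfield M) = \sum_k c (low k) *: dual_vf k.
  by rewrite /z !big_ord_recl !big_ord0.
rewrite -[xS_val _]/((x : vfield M) - (z : vfield M)) zE.
have S : \sum_k c k *: theta k Y = \sum_k c (low k) *: theta (low k) Y.
  rewrite (@big_split_ord _ _ _ 3 3) /= [X in _ + X]big1 ?addr0.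
    by apply: eq_bigr => k _; have -> : lshift 3 k = low k by exact: val_inj.
  by move=> k _; rewrite cu ?scale0r.
by rewrite addrC -scaleN1r om_scale om_sum_dual E S scaleN1r addKr.
Qed.

Lemma class2_0 : class2 ord0 = 0.
Proof.
rewrite -(linear0 (quot_pi (@xH_pred R 6 M omega 2))).
by apply/quot_piP; rewrite subr0; apply/asboolP; exact: exact_dual0.
Qed.

End Cohomology.

(** * Comparison of dimensions *)

Lemma exists_relation (R : fieldType) (A : 'M[R]_(3, 2)) :
  exists2 c : 'rV[R]_3, c != 0 & c *m A = 0.
Proof.
have : kermx A != 0.
  rewrite -mxrank_eq0 mxrank_ker subn_eq0 -ltnNge.
  by apply: leq_ltn_trans (rank_leq_col A) _.
move=> /matrix0Pn[i [j ij]]; exists (row i (kermx A)).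
  by apply/matrix0Pn; exists 0, j; rewrite mxE.
by rewrite -row_mul mulmx_ker row0.
Qed.

Theorem theorem6 (R : realType) :
  exists (M : charted R 6) (omega : dform M 2),
    [/\ nilmanifold M, symplectic omega
      & ~ lmod_isomorphic (HEL omega 2) (HEL omega 1)].
Proof.
exists nil_charted, omega; split.
- exact: nil_nilmanifold.
- exact: omega_symplectic.
move=> [phi [psi phiK psiK]].
have /choice[a aE] k := class2_span (psi (@class1 R k)).
(* Since [class2 ord0] is zero, each [psi (class1 k)] depends on its two remaining coordinates only.
   A relation between the three rows of these is carried by [phi] to a relation between the
   independent classes in degree one. *)
have [c c0 cA] := exists_relation (\matrix_(k < 3, l < 2) a k (lift ord0 l)).
move/negP: c0; apply; apply/eqP/rowP => k; rewrite mxE.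
apply: (@class1_free R (fun k => c 0 k)).
transitivity (phi (\sum_k c 0 k *: psi (class1 k))).
  by rewrite linear_sum; apply: eq_bigr => l _; rewrite linearZ psiK.
suff -> : \sum_k c 0 k *: psi (class1 k) = 0 by rewrite linear0.
under eq_bigr => l _ do rewrite aE scaler_sumr.
rewrite exchange_big big1 // => m _ /=.
under eq_bigr do rewrite scalerA.
rewrite -scaler_suml; case: (unliftP ord0 m) => [l ->|->]; last first.
  by rewrite class2_0 scaler0.
have := congr1 (fun B : 'rV[R]_2 => B 0 l) cA; rewrite !mxE => e.
rewrite (_ : \sum_i c 0 i * a i (lift ord0 l) = 0) ?scale0r // -[RHS]e.
by apply: eq_bigr => i _; rewrite mxE.
Qed.
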